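(* Let $(X(t))_{t\in\mathbb{R}}$ be a centered real-valued Gaussian process with stationary increments and semi-variogram $V$, and let $\delta_n=n^{-\alpha}$ with $0<\alpha\le 1$ fixed. Assume: (i) $V$ is $C^\infty$ on $(0,+\infty)$; (ii) $V$ is $2D$ times differentiable on $\mathbb{R}$ for some integer $D\ge 0$, and there exist $C>0$ and $0<s<2$ such that for all $h\in\mathbb{R}$, $V^{(2D)}(h)=V^{(2D)}(0)+C(-1)^D|h|^s+r(h)$, with $r(h)=o(|h|^s)$ as $h\to 0$; if $\alpha<1$, assume in addition that there is a constant $K$ with $|r(h)|\le K|h|^s$ for all $|h|>1$; (iii) with $d=2$ if $s<3/2$ and $d=3$ if $s\ge 3/2$, there exist $\beta$ with $s-d<\beta<-1/2$ and a constant $K'$ such that $|r^{(d)}(h)|\le K'|h|^\beta$ for all $0<|h|<1$ if $\alpha=1$, and for all $h\ne 0$ if $\alpha<1$; (iv) $r(h)=o(|h|^{s+1/(2\alpha)})$ as $h\to0$. Let $a$ be a non-zero finitely supported real sequence with zero sum whose order satisfies $M(a)>D+s/2+1/4$. Then, as $n\to\infty$, $$\frac{C_{a,n}-C}{\sqrt{\mathrm{Var}(C_{a,n})}}\longrightarrow\mathcal{N}(0,1)\quad\text{in distribution},$$ and there is a positive constant $c$ (not depending on $n$) such that $\mathrm{Var}(C_{a,n})=c\,n^{-1}(1+o(1))$.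
   Context: The semi-variogram is $V(h)=\frac12\mathbb{E}[(X(t+h)-X(t))^2]$, which does not depend on $t$ by stationarity of increments. A sequence $a$ is written $(a_0,\dots,a_{L-1})$ with $a_0\ne0$, $a_{L-1}\neq 0$; $L=L(a)$ is its length. Its order $M(a)$ is the integer such that $\sum_j a_j j^k=0$ for $0\le k<M(a)$ and $\sum_j a_j j^{M(a)}\ne 0$. The sequence $a^{2*}$ (indexed by $\mathbb{Z}$) is $a^{2*}_j=\sum_{k-l=j}a_k a_l$. The discrete $a$-differences of $X$ are $\Delta_{a,i}(X)=\sum_{j=0}^{L-1}a_jX((i+j)\delta_n)$, $i=1,\dots,n'$, with $n'=n-L+1$, and the quadratic $a$-variation is $V_{a,n}=\sum_{i=1}^{n'}(\Delta_{a,i}(X))^2$. For a finitely supported sequence $b$ indexed by $\mathbb{Z}$, $i\in\mathbb{Z}$, $\delta>0$, an integer $q\ge 1$ and a function $f$, $$R(i,\delta,q,f,b)=-\sum_j b_j j^q\int_0^1\frac{(1-\eta)^{q-1}}{(q-1)!}f((i+j\eta)\delta)\,d\eta,$$ and for $q=0$, $R(i,\delta,0,f,b)=-\sum_j b_j f((i+j)\delta)$. The estimator of $C$ is $$C_{a,n}=\frac{V_{a,n}}{n(-1)^D\delta_n^{2D+s}R(0,1,2D,|\cdot|^s,a^{2*})}$$ (the denominator is positive whenever $M(a)>D$). *)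

(* Defs.v *)
From HB Require Import structures.
From mathcomp Require Export all_boot all_order all_algebra.
From mathcomp Require Export all_classical all_reals all_analysis.
From mathcomp Require Export measurable_realfun.
Export Order.TTheory GRing.Theory Num.Theory.
Export numFieldNormedType.Exports.

Set Implicit Arguments.
Unset Strict Implicit.
Unset Printing Implicit Defensive.

Local Open Scope classical_set_scope.
Local Open Scope ring_scope.

Section Processes.
Context d (T : measurableType d) (R : realType) (P : probability T R).
Implicit Type X : R -> {RV P >-> R}.

(* The point masses are the Gaussian laws of variance 0; they have to be added
   by hand because [normal_prob m 0] is not a point mass. *)
Definition gaussian_law (mu : set R -> \bar R) : Prop :=
  exists m : R,
    (exists s : R, 0 < s /\
       forall A : set R, measurable A -> mu A = normal_prob m s A) \/
    (forall A : set R, measurable A -> mu A = \d_m A).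

Definition gaussian_process X : Prop :=
  forall (k : nat) (t c : 'I_k -> R),
    gaussian_law (pushforward P (fun w => \sum_(i < k) c i * X (t i) w)).

Definition centered X : Prop := forall t : R, ('E_P[X t] = 0)%E.

Definition stationary_increments X : Prop :=
  forall (k : nat) (u v : 'I_k -> R) (h : R) (B : set (k.-tuple R)),
    measurable B ->
    pushforward P (fun w => [tuple X (v i + h) w - X (u i + h) w | i < k]) B =
    pushforward P (fun w => [tuple X (v i) w - X (u i) w | i < k]) B.

Definition is_semivariogram X (V : R -> R) : Prop :=
  forall t h : R,
    (V h)%:E = ((2^-1)%:E * 'E_P[fun w => ((X (t + h) w - X t w) ^+ 2)%R])%E.

Definition cvg_in_distribution (Z : nat -> {RV P >-> R})
    (mu : set R -> \bar R) : Prop :=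
  forall x : R, {for x, continuous (fun y : R => mu `]-oo, y]%classic)} ->
    cdf (Z n) x @[n --> \oo] --> mu `]-oo, x]%classic.

End Processes.

Section Sequences.
Context (R : realType).
Implicit Types (a : seq R) (V f : R -> R).

(* A list a stands for the sequence (a_0, ..., a_{L-1}) with L = size a. *)
Definition trimmed a : Prop := a`_0 != 0 /\ a`_(size a).-1 != 0.

(* Here 0 ^+ 0 = 1, so that the moment of order 0 is the sum of a. *)
Definition moment a (k : nat) : R := \sum_(j < size a) a`_j * j%:R ^+ k.

Definition is_order a (M : nat) : Prop :=
  (forall k : nat, (k < M)%N -> moment a k = 0) /\ moment a M != 0.

Definition autoconv a (j : int) : R :=
  \sum_(k < size a) \sum_(l < size a | k%:Z - l%:Z == j) a`_k * a`_l.

Definition times_derivable (k : nat) f : Prop :=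
  forall (j : nat) (x : R), (j < k)%N -> derivable (derive1n j f) x 1.

Definition smooth_on (A : set R) f : Prop :=
  forall (k : nat) (x : R), A x -> derivable (derive1n k f) x 1.

Definition Rfun (i : int) (delta : R) (q : nat) f (b : int -> R) : R :=
  if q == 0%N then
    - \sum_(j \in [set: int]) b j * f ((i + j)%:~R * delta)
  else
    - \sum_(j \in [set: int]) b j * j%:~R ^+ q *
        \int[lebesgue_measure]_(eta in `[0, 1])
          ((1 - eta) ^+ q.-1 / (q.-1)`!%:R * f ((i%:~R + j%:~R * eta) * delta)).

Definition mesh (alpha : R) (n : nat) : R := n%:R `^ (- alpha).

End Sequences.

Lemma measurable_fun_sum d (T : measurableType d) (R : realType) (I : Type)
    (l : seq I) (f : I -> T -> R) :
  (forall i, measurable_fun [set: T] (f i)) ->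
  measurable_fun [set: T] (fun w => \sum_(i <- l) f i w).
Proof.
move=> mf; elim: l => [|i l IHl].
  by under eq_fun do rewrite big_nil; exact: measurable_cst.
by under eq_fun do rewrite big_cons; exact: measurable_funD.
Qed.

Section Estimator.
Context d (T : measurableType d) (R : realType) (P : probability T R).
Context (X : R -> {RV P >-> R}) (a : seq R) (alpha : R) (n : nat).

Definition adiff (i : nat) (w : T) : R :=
  \sum_(j < size a) a`_j * X ((i + j)%:R * mesh alpha n) w.

(* The index runs over 1 <= i <= n' with n' = n - L + 1; the range is empty
   when n < L. *)
Definition quadvar (w : T) : R :=
  \sum_(1 <= i < (n.+1 - size a).+1) adiff i w ^+ 2.

Definition estimatorC (D : nat) (s : R) (w : T) : R :=
  quadvar w /
  (n%:R * (-1) ^+ D * mesh alpha n `^ ((2 * D)%N%:R + s) *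
   Rfun 0 1 (2 * D)%N (fun x : R => `|x| `^ s) (autoconv a)).

Lemma measurable_adiff i : measurable_fun [set: T] (adiff i).
Proof.
apply: measurable_fun_sum => j.
by apply: measurable_funM; [exact: measurable_cst | exact: measurable_funPT].
Qed.

Lemma measurable_quadvar : measurable_fun [set: T] quadvar.
Proof.
apply: measurable_fun_sum => i; apply: measurable_funX; exact: measurable_adiff.
Qed.

Lemma measurable_estimatorC D s : measurable_fun [set: T] (estimatorC D s).
Proof.
apply: measurable_funM; [exact: measurable_quadvar | exact: measurable_cst].
Qed.

HB.instance Definition _ D s :=
  isMeasurableFun.Build _ _ _ _ (estimatorC D s) (measurable_estimatorC D s).

Definition standardized_error (D : nat) (s C : R) (w : T) : R :=
  (estimatorC D s w - C) / Num.sqrt (fine (variance P (estimatorC D s))).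

Lemma measurable_standardized_error D s C :
  measurable_fun [set: T] (standardized_error D s C).
Proof.
apply: measurable_funM; last exact: measurable_cst.
by apply: measurable_funB; [exact: measurable_estimatorC
                           | exact: measurable_cst].
Qed.

HB.instance Definition _ D s C := isMeasurableFun.Build _ _ _ _
  (standardized_error D s C) (measurable_standardized_error D s C).

End Estimator.

(* Main.v *)
From mathcomp Require Import ring lra zify.
Require Import Defs.
Import HBNNSimple.

(* Since the coefficients of [a] sum to zero, the a-differences D_i have
   covariances E[D_i D_j] = - sum_{k,l} a_k a_l V((i - j + k - l) delta). Taylor's
   formula of order 2D + d away from the origin and the expansion of V near the
   origin show that E[D_i D_{i+k}] / delta^(2D+s) converges for each k, and is
   dominated by a square-summable sequence O(k^e), e < -1/2. Hence the covariance
   matrix K of D_1, ..., D_n' has squared Frobenius norm of order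
   n delta^(2(2D+s)), and row sums, which bound the operator norm, of smaller
   order than its Frobenius norm.

   For F = V_{a,n} - E V_{a,n}, Gaussian integration by parts expresses
   E[F^k q_A], where q_A is the quadratic form of a matrix A, through E[F^k],
   E[F^(k-1) q_{KA}] and E[q_A]. Iterating over the powers of K gives
   E F^(k+2) = (k+1) Var(F) E F^k up to a term of relative order
   |K|_op / |K|_Frobenius, so that the moments of F / sd(F) converge to those of
   the standard normal law. The normal law is determined by its moments:
   convergence of moments implies convergence of the expectations of
   trigonometric polynomials, which approximate indicators of half-lines on
   large intervals. The bias is negligible by (iv). *)

Set Implicit Arguments.
Unset Strict Implicit.
Unset Printing Implicit Defensive.

Local Open Scope classical_set_scope.
Local Open Scope ring_scope.

(** * Random variables with all moments *)

(** Joint normality is only known through the one-dimensional laws of linear combinations. Mixed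
    moments are recovered by polarization: the moment recurrence of [L + e x] is an identity between
    polynomials in [e], and its coefficient of degree 1 is integration by parts.

    The exponents in the hypotheses enter as follows. The limiting correlations decay like k^(p -
    2M) with p = 2D + s, and M > D + s/2 + 1/4 says exactly p - 2M < -1/2. The residual part decays
    like k^beta with beta < -1/2, and beta > s - d makes its power of delta_n at least p. The values
    of d ensure 2D + d <= 2M, so that Taylor polynomials of degree < 2D + d are annihilated. Square
    summability is just enough: the sum of b_k over k < m is then o(sqrt m), while the Frobenius
    norm, in the same scale, grows like sqrt m.

    The limit variance must not vanish. Some limiting correlation g(k) is non-zero, by its
    asymptotics in k, or at an explicit lag when s = 1, where the asymptotic coefficient vanishes;
    |g(k)| <= g(0) then gives g(0) > 0. *)

Section AllMoments.
Context d (T : measurableType d) (R : realType) (P : probability T R).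
Implicit Types Y Z : T -> R.

(** These variables form an algebra, so that the integrability of every polynomial in Gaussian
    variables follows from closure lemmas. *)
Definition all_moments Z : Prop :=
  measurable_fun [set: T] Z /\
  forall k : nat, P.-integrable [set: T] (EFin \o (fun w => `|Z w| ^+ k)).

Local Notation E Z := (Rintegral P [set: T] Z).

Lemma all_moments_integrable Z : all_moments Z ->
  P.-integrable [set: T] (EFin \o Z).
Proof.
move=> [mZ /(_ 1%N) iZ]; apply: le_integrable iZ => //.
  exact/measurable_EFinP.
by move=> w _; rewrite /= expr1 lee_fin normr_id.
Qed.

Lemma all_moments_le Y Z : measurable_fun [set: T] Y ->
  (forall w, `|Y w| <= `|Z w|) -> all_moments Z -> all_moments Y.
Proof.
move=> mY YZ [mZ iZ]; split=> // k; apply: le_integrable (iZ k) => //.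
  apply/measurable_EFinP; apply: measurable_funX.
  exact: measurableT_comp.
move=> w _; rewrite /= lee_fin !normrX !normr_id.
by apply: lerXn2r; rewrite ?nnegrE.
Qed.

Lemma all_moments_bounded Z (B : R) : measurable_fun [set: T] Z ->
  (forall w, `|Z w| <= B) -> all_moments Z.
Proof.
move=> mZ ZB; split=> // k.
apply: (@le_integrable _ _ _ _ _ _ _ (EFin \o cst (B ^+ k))) => //.
- by apply/measurable_EFinP; apply: measurable_funX; exact: measurableT_comp.
- move=> w _; rewrite /= lee_fin !normrX !normr_id.
  by apply: lerXn2r; rewrite ?nnegrE// (le_trans (ZB w)) ?ler_norm.
- exact: finite_measure_integrable_cst.
Qed.

Lemma all_moments_cst (c : R) : all_moments (fun=> c).
Proof. by apply: (@all_moments_bounded _ `|c|). Qed.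

Lemma all_momentsD Y Z : all_moments Y -> all_moments Z ->
  all_moments (fun w => Y w + Z w).
Proof.
move=> [mY iY] [mZ iZ]; split; first exact: measurable_funD.
move=> k.
have iYZ : P.-integrable [set: T]
    (EFin \o (fun w => 2 ^+ k * (`|Y w| ^+ k + `|Z w| ^+ k))).
  have := @integrableZl _ _ _ P _ measurableT (2 ^+ k) _
    (integrableD measurableT (iY k) (iZ k)).
  by apply: eq_integrable => // w _ /=; rewrite EFinM EFinD.
apply: le_integrable iYZ => //.
  apply/measurable_EFinP; apply: measurable_funX.
  by apply: measurableT_comp => //; exact: measurable_funD.
move=> w _ /=; rewrite lee_fin [leRHS]ger0_norm; last first.
  by rewrite mulr_ge0// ?exprn_ge0// addr_ge0// exprn_ge0.
rewrite normrX normr_id.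
have [yz|zy] := leP `|Y w| `|Z w|.
- apply: (@le_trans _ _ ((2 * `|Z w|) ^+ k)).
    apply: lerXn2r; rewrite ?nnegrE ?mulr_ge0//.
    by rewrite (le_trans (ler_normD _ _))// mulr2n mulrDl mul1r lerD2r.
  by rewrite exprMn ler_wpM2l ?exprn_ge0// lerDr exprn_ge0.
- apply: (@le_trans _ _ ((2 * `|Y w|) ^+ k)).
    apply: lerXn2r; rewrite ?nnegrE ?mulr_ge0//.
    by rewrite (le_trans (ler_normD _ _))// mulr2n mulrDl mul1r lerD2l ltW.
  by rewrite exprMn ler_wpM2l ?exprn_ge0// lerDl exprn_ge0.
Qed.

Lemma all_momentsM Y Z : all_moments Y -> all_moments Z ->
  all_moments (fun w => Y w * Z w).
Proof.
move=> [mY iY] [mZ iZ]; split; first exact: measurable_funM.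
move=> k.
have iYZ : P.-integrable [set: T]
    (EFin \o (fun w => `|Y w| ^+ (2 * k) + `|Z w| ^+ (2 * k))).
  have := integrableD measurableT (iY (2 * k)%N) (iZ (2 * k)%N).
  by apply: eq_integrable => // w _ /=; rewrite EFinD.
apply: le_integrable iYZ => //.
  apply/measurable_EFinP; apply: measurable_funX.
  by apply: measurableT_comp => //; exact: measurable_funM.
move=> w _ /=; rewrite lee_fin [leRHS]ger0_norm; last first.
  by rewrite addr_ge0// exprn_ge0.
rewrite normrX normr_id normrM exprMn !exprM ![_ ^+ 2 ^+ k]exprAC.
have h0 : forall u : R, 0 <= `|u| ^+ k by move=> u; rewrite exprn_ge0.
move: (h0 (Y w)) (h0 (Z w)); set u := _ ^+ k; set v := (`|Z w| ^+ k) => u0 v0.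
rewrite -subr_ge0.
have -> : u ^+ 2 + v ^+ 2 - u * v = (u - v) ^+ 2 + u * v by ring.
by rewrite addr_ge0 ?sqr_ge0 ?mulr_ge0.
Qed.

Lemma all_momentsZ (c : R) Z : all_moments Z -> all_moments (fun w => c * Z w).
Proof. by apply: all_momentsM; exact: all_moments_cst. Qed.

Lemma all_momentsN Z : all_moments Z -> all_moments (fun w => - Z w).
Proof.
by move=> /(all_momentsZ (-1)); under eq_fun do rewrite mulN1r.
Qed.

Lemma all_momentsB Y Z : all_moments Y -> all_moments Z ->
  all_moments (fun w => Y w - Z w).
Proof. by move=> ? /all_momentsN; exact: all_momentsD. Qed.

Lemma all_momentsX k Z : all_moments Z -> all_moments (fun w => Z w ^+ k).
Proof.
move=> mZ; elim: k => [|k IHk].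
  by under eq_fun do rewrite expr0; exact: all_moments_cst.
by under eq_fun do rewrite exprS; exact: all_momentsM.
Qed.

Lemma all_moments_sum (I : Type) (l : seq I) (f : I -> T -> R) :
  (forall i, all_moments (f i)) -> all_moments (fun w => \sum_(i <- l) f i w).
Proof.
move=> mf; elim: l => [|i l IHl].
  by under eq_fun do rewrite big_nil; exact: all_moments_cst.
by under eq_fun do rewrite big_cons; exact: all_momentsD.
Qed.

Lemma mean_cst (c : R) : E (fun=> c) = c.
Proof. by rewrite /Rintegral integral_cst//= probability_setT mule1. Qed.

Lemma meanD Y Z : all_moments Y -> all_moments Z ->
  E (fun w => Y w + Z w) = E Y + E Z.
Proof. by move=> mY mZ; rewrite RintegralD//; exact: all_moments_integrable. Qed.

Lemma meanB Y Z : all_moments Y -> all_moments Z ->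
  E (fun w => Y w - Z w) = E Y - E Z.
Proof. by move=> mY mZ; rewrite RintegralB//; exact: all_moments_integrable. Qed.

Lemma meanZ (c : R) Z : all_moments Z -> E (fun w => c * Z w) = c * E Z.
Proof. by move=> mZ; rewrite RintegralZl//; exact: all_moments_integrable. Qed.

Lemma mean_sum (I : Type) (l : seq I) (f : I -> T -> R) :
  (forall i, all_moments (f i)) ->
  E (fun w => \sum_(i <- l) f i w) = \sum_(i <- l) E (f i).
Proof.
move=> mf; elim: l => [|i l IHl].
  by rewrite big_nil; under eq_fun do rewrite big_nil; rewrite mean_cst.
rewrite big_cons -IHl; under eq_fun do rewrite big_cons.
by rewrite meanD//; exact: all_moments_sum.
Qed.

Lemma mean_le Y Z : all_moments Y -> all_moments Z ->
  (forall w, Y w <= Z w) -> E Y <= E Z.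
Proof.
by move=> mY mZ YZ; apply: le_Rintegral => //; exact: all_moments_integrable.
Qed.

Lemma mean_norm Z : all_moments Z -> `|E Z| <= E (fun w => `|Z w|).
Proof.
by move=> mZ; apply: le_normr_Rintegral => //; exact: all_moments_integrable.
Qed.

Lemma all_moments_norm Z : all_moments Z -> all_moments (fun w => `|Z w|).
Proof.
move=> mZ; apply: all_moments_le (mZ); last by move=> w; rewrite normr_id.
by apply: measurableT_comp => //; case: mZ.
Qed.

Lemma all_moments_indic (A : set T) : measurable A -> all_moments (\1_A : T -> R).
Proof.
move=> mA; apply: (@all_moments_bounded _ 1); first exact: measurable_indic.
by move=> w; rewrite indicE; case: (_ \in _); rewrite /= ?normr1 ?normr0.
Qed.

Lemma mean_indic (A : set T) : measurable A -> E (\1_A : T -> R) = fine (P A).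
Proof. by move=> mA; rewrite /Rintegral integral_indic// setIT. Qed.

Lemma mean_sqr_ge0 Z : 0 <= E (fun w => Z w ^+ 2).
Proof. by apply: Rintegral_ge0 => w _; exact: sqr_ge0. Qed.

Lemma mean_CauchySchwarz Y Z : all_moments Y -> all_moments Z ->
  E (fun w => Y w ^+ 2) = E (fun w => Z w ^+ 2) ->
  `|E (fun w => Y w * Z w)| <= E (fun w => Y w ^+ 2).
Proof.
move=> mY mZ YZ.
have mYY := all_momentsX 2 mY; have mZZ := all_momentsX 2 mZ.
have mYZ := all_momentsM mY mZ.
have key (c : R) : c ^+ 2 = 1 ->
    0 <= 2 * E (fun w => Y w ^+ 2) + 2 * c * E (fun w => Y w * Z w).
  move=> c1.
  have := mean_sqr_ge0 (fun w => Y w + c * Z w).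
  have -> : (fun w => (Y w + c * Z w) ^+ 2) =
      (fun w => (Y w ^+ 2 + Z w ^+ 2) + (2 * c) * (Y w * Z w)).
    by apply/funext => w; rewrite sqrrD exprMn c1; ring.
  rewrite meanD; [|exact: all_momentsD|exact: all_momentsZ].
  rewrite meanD// meanZ// -YZ => h; lra.
rewrite ler_norml; apply/andP; split.
- have := key 1 (expr1n _ _); lra.
- have := key (-1); rewrite sqrrN expr1n => /(_ erefl); lra.
Qed.

End AllMoments.

(** * Gaussian integration by parts *)

Lemma poly_ext (R : numDomainType) (p q : {poly R}) :
  (forall x, p.[x] = q.[x]) -> p = q.
Proof.
move=> pq; apply/eqP; rewrite -subr_eq0; apply/eqP.
apply: (@roots_geq_poly_eq0 _ _ [seq i%:R | i <- iota 0 (size (p - q))]).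
- by apply/allP => x _; rewrite rootE hornerD hornerN pq subrr.
- by rewrite map_inj_uniq ?iota_uniq// => i j /eqP; rewrite eqr_nat => /eqP.
- by rewrite size_map size_iota.
Qed.

Section Wick.
Context d (T : measurableType d) (R : realType) (P : probability T R).
Implicit Types (Y Z L A x : T -> R) (l : seq (T -> R)).

Local Notation E Z := (Rintegral P [set: T] Z).

(* Centered joint normality is only used through the moment recurrence of each
   member of a vector space [G] of variables, which by polarization determines
   all mixed moments. *)
Definition gaussian_family (G : (T -> R) -> Prop) : Prop :=
  [/\ forall c L Y, G L -> G Y -> G (fun w => L w + c * Y w),
      forall L, G L -> all_moments P L,
      forall L, G L -> E L = 0 &
      forall L k, G L -> E (fun w => L w ^+ k.+2) =
        k.+1%:R * E (fun w => L w ^+ 2) * E (fun w => L w ^+ k)].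

(** The polynomial in [e] whose value is E[A (L + e x)^n]. Its coefficient of degree 1 is the
    derivative in the direction [x], which turns identities on powers of [L] into identities on
    mixed moments. *)
Definition mean_poly A L x n : {poly R} :=
  \poly_(i < n.+1) ('C(n, i)%:R * E (fun w => A w * (L w ^+ (n - i) * x w ^+ i))).

Lemma mean_polyE A L x n (e : R) :
  all_moments P A -> all_moments P L -> all_moments P x ->
  E (fun w => A w * (L w + e * x w) ^+ n) = (mean_poly A L x n).[e].
Proof.
move=> mA mL mx.
have h (i : nat) :
    all_moments P (fun w => A w * (L w ^+ (n - i) * x w ^+ i)).
  by apply: all_momentsM => //; apply: all_momentsM; exact: all_momentsX.
rewrite horner_poly -(big_mkord xpredT (fun i =>
  'C(n, i)%:R * E (fun w => A w * (L w ^+ (n - i) * x w ^+ i)) * e ^+ i)).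
under eq_bigr => i _ do rewrite mulrAC -meanZ//.
rewrite -mean_sum; last by move=> i; exact: all_momentsZ.
congr Rintegral; apply/funext => w.
rewrite exprDn mulr_sumr big_mkord; apply: eq_bigr => i _.
by rewrite exprMn -mulr_natl; ring.
Qed.

Lemma mean_poly_coef0 A L x n :
  (mean_poly A L x n)`_0 = E (fun w => A w * L w ^+ n).
Proof.
rewrite coef_poly/= bin0 mul1r subn0; congr Rintegral.
by apply/funext => w; rewrite expr0 mulr1.
Qed.

Lemma mean_poly_coef1 A L x n :
  (mean_poly A L x n)`_1 = n%:R * E (fun w => A w * (L w ^+ n.-1 * x w)).
Proof.
by rewrite coef_poly; case: n => [|n] /=; rewrite ?mul0r// bin1 subn1.
Qed.

(** The derivative of the product of [l] in the direction [Y], by Leibniz's rule: the sum over [x]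
    in [l] of E[Y x] times the product of the other factors. *)
Fixpoint contract Y l : T -> R :=
  if l is x :: l' then
    fun w => E (fun u => Y u * x u) * (\prod_(y <- l') y w) + x w * contract Y l' w
  else fun=> 0.

Variable G : (T -> R) -> Prop.
Hypothesis gaussG : gaussian_family G.

Lemma gauss_all_moments L : G L -> all_moments P L.
Proof. by case: gaussG => _ + _ _; exact. Qed.

Lemma all_moments_prod l : (forall x, x \in l -> G x) ->
  all_moments P (fun w => \prod_(y <- l) y w).
Proof.
elim: l => [|x l IHl] Gl.
  by under eq_fun do rewrite big_nil; exact: all_moments_cst.
under eq_fun do rewrite big_cons.
apply: all_momentsM; first by apply/gauss_all_moments/Gl; rewrite mem_head.
by apply: IHl => y yl; apply: Gl; rewrite in_cons yl orbT.
Qed.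

Lemma all_moments_contract Y l : (forall x, x \in l -> G x) ->
  all_moments P (contract Y l).
Proof.
elim: l => [|x l IHl] Gl /=; first exact: all_moments_cst.
have Gl' y : y \in l -> G y by move=> yl; apply: Gl; rewrite in_cons yl orbT.
apply: all_momentsD; first exact/all_momentsZ/all_moments_prod.
apply: all_momentsM; last exact: IHl.
by apply/gauss_all_moments/Gl; rewrite mem_head.
Qed.

(** The recurrence E Z^(r+3) = (r+2) E Z^2 E Z^(r+1) for Z = L + e Y holds for every [e]; the
    coefficients of [e] express E[Y L^(r+2)] through E[Y L^r], whence an induction in steps of
    two. *)
Lemma gauss_mean_mul_exp Y L r : G Y -> G L ->
  E (fun w => Y w * L w ^+ r) =
  r%:R * E (fun w => Y w * L w) * E (fun w => L w ^+ r.-1).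
Proof.
move=> GY GL; have [Glin Gam Gmean Grec] := gaussG.
have mY := Gam _ GY; have mL := Gam _ GL.
suff: E (fun w => Y w * L w ^+ r) =
        r%:R * E (fun w => Y w * L w) * E (fun w => L w ^+ r.-1) /\
      E (fun w => Y w * L w ^+ r.+1) =
        r.+1%:R * E (fun w => Y w * L w) * E (fun w => L w ^+ r) by case.
elim: r => [|r [IH1 IH2]].
  split; first by rewrite !mul0r; under eq_fun do rewrite expr0 mulr1; exact: Gmean.
  by under [X in Rintegral _ _ X = _]eq_fun do rewrite expr1;
     under [X in _ * Rintegral _ _ X]eq_fun do rewrite expr0; rewrite mean_cst mul1r mulr1.
split=> //.
have m1 := @all_moments_cst _ _ _ P 1.
pose p := mean_poly (fun=> 1) L Y.
have pE k e : E (fun w => (L w + e * Y w) ^+ k) = (p k).[e].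
  by rewrite -mean_polyE//; congr Rintegral; apply/funext => w; rewrite mul1r.
have : p r.+3 = r.+2%:R *: (p 2%N * p r.+1).
  apply: poly_ext => e; rewrite hornerZ hornerM -!pE Grec ?mulrA//.
  exact: Glin.
move/(congr1 (fun q : {poly R} => q`_1)).
rewrite coefZ coefM big_ord_recl big_ord1 /= subn0 subnn.
rewrite !mean_poly_coef1 !mean_poly_coef0 /=.
have e1 k : E (fun w => 1 * (L w ^+ k * Y w)) = E (fun w => Y w * L w ^+ k).
  by congr Rintegral; apply/funext => w; ring.
have e2 k : E (fun w => 1 * L w ^+ k) = E (fun w => L w ^+ k).
  by congr Rintegral; apply/funext => w; ring.
rewrite !e1 !e2.
have -> : E (fun w => Y w * L w ^+ 1) = E (fun w => Y w * L w).
  by congr Rintegral; apply/funext => w; ring.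
(* The recurrence of [L] itself reabsorbs E[L^2]; for [r = 0] both sides vanish because [L] is
   centered. *)
have {}IH1 : E (fun w => L w ^+ 2) * (r.+1%:R * E (fun w => Y w * L w ^+ r)) =
    r.+1%:R * E (fun w => Y w * L w) * E (fun w => L w ^+ r.+1).
  case: r IH1 {IH2} => [|r] IH1.
    rewrite IH1.
    have -> : E (fun w => L w ^+ 1) = 0.
      by under eq_fun do rewrite expr1; exact: Gmean.
    by rewrite !mul0r !mulr0.
  by rewrite IH1 (Grec _ r)//=; ring.
rewrite IH1 => h.
have r2 : r.+3%:R != 0 :> R by rewrite pnatr_eq0.
apply: (mulfI r2); rewrite h.
by rewrite -[r.+3%:R]natr1 -[r.+2%:R]natr1 -[r.+1%:R]natr1; ring.
Qed.

(** Induction on [l], for all [L]: in the identity for the shorter list with exponent [r + 1],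
    replacing [L] by [L + e x] and taking the coefficient of [e] converts one factor [L] into the
    new member [x]. The common factor [r + 1] cancels. *)
Lemma wick Y L l r : G Y -> G L -> (forall x, x \in l -> G x) ->
  E (fun w => Y w * (\prod_(y <- l) y w) * L w ^+ r) =
  E (fun w => contract Y l w * L w ^+ r) +
  r%:R * E (fun w => Y w * L w) * E (fun w => (\prod_(y <- l) y w) * L w ^+ r.-1).
Proof.
move=> GY; have [Glin Gam Gmean Grec] := gaussG.
elim: l L r => [|x l IHl] L r GL Gl.
  under [X in Rintegral _ _ X = _]eq_fun do rewrite big_nil mulr1.
  under [X in _ = _ + _ * Rintegral _ _ X]eq_fun do rewrite big_nil mul1r.
  rewrite gauss_mean_mul_exp//=.
  under [X in _ = Rintegral _ _ X + _]eq_fun do rewrite mul0r.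
  by rewrite mean_cst add0r.
have Gx : G x by apply: Gl; rewrite mem_head.
have Gl' y : y \in l -> G y by move=> yl; apply: Gl; rewrite in_cons yl orbT.
have mp := all_moments_prod Gl'; have mc := all_moments_contract Y Gl'.
have mY := Gam _ GY; have mL := Gam _ GL; have mx := Gam _ Gx.
set pr := (fun w => \prod_(y <- l) y w) in mp *.
have key : mean_poly (fun w => Y w * pr w) L x r.+1 =
    mean_poly (contract Y l) L x r.+1 +
    r.+1%:R *: (E (fun w => Y w * L w) *: mean_poly pr L x r +
                E (fun w => Y w * x w) *: ('X * mean_poly pr L x r)).
  apply: poly_ext => e.
  rewrite hornerD !hornerZ hornerD !hornerZ hornerM hornerX -!mean_polyE//;
    last exact: all_momentsM.
  rewrite IHl//; last exact: Glin.
  congr (_ + _); rewrite -mulrA; congr (_ * _).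
  have -> : E (fun w => Y w * (L w + e * x w)) =
      E (fun w => Y w * L w) + e * E (fun w => Y w * x w).
    rewrite -meanZ; last exact: all_momentsM.
    rewrite -meanD; [|exact: all_momentsM|exact/all_momentsZ/all_momentsM].
    by congr Rintegral; apply/funext => w; ring.
  by rewrite /=; ring.
move/(congr1 (fun q : {poly R} => q`_1)) : key.
rewrite coefD !coefZ coefD !coefZ coefXM /= !mean_poly_coef1 mean_poly_coef0 /=.
rewrite -mulrDr => /mulfI; rewrite pnatr_eq0 => /(_ isT) key.
transitivity (E (fun w => Y w * pr w * (L w ^+ r * x w))).
  by congr Rintegral; apply/funext => w; rewrite big_cons -/(pr w); ring.
rewrite key.
have -> : E (fun w => contract Y (x :: l) w * L w ^+ r) =
    E (fun w => contract Y l w * (L w ^+ r * x w)) +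
    E (fun w => Y w * x w) * E (fun w => pr w * L w ^+ r).
  rewrite -meanZ; last by apply: all_momentsM => //; exact: all_momentsX.
  rewrite -meanD; last 2 first.
  - by apply: all_momentsM => //; apply: all_momentsM => //; exact: all_momentsX.
  - by apply: all_momentsZ; apply: all_momentsM => //; exact: all_momentsX.
  by congr Rintegral; apply/funext => w /=; rewrite -/(pr w); ring.
have -> : E (fun w => (\prod_(y <- x :: l) y w) * L w ^+ r.-1) =
    E (fun w => pr w * (L w ^+ r.-1 * x w)).
  by congr Rintegral; apply/funext => w; rewrite big_cons -/(pr w); ring.
by ring.
Qed.

Lemma wick0 Y l : G Y -> (forall x, x \in l -> G x) ->
  E (fun w => Y w * (\prod_(y <- l) y w)) = E (contract Y l).
Proof.
move=> GY Gl; have := @wick Y Y l 0 GY GY Gl.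
rewrite !mul0r addr0.
under eq_fun do rewrite expr0 mulr1.
by under [X in _ = Rintegral _ _ X]eq_fun do rewrite expr0 mulr1.
Qed.

(* Stein's identity E[Y Z H] = E[(d_Y Z) H] + E[Z d_Y H] for products Z of
   members of [G], with [dH Y] playing the role of the derivative d_Y H. *)
Definition by_parts (H : T -> R) (dH : (T -> R) -> T -> R) : Prop :=
  [/\ all_moments P H, forall Y, G Y -> all_moments P (dH Y) &
   forall Y l, G Y -> (forall x, x \in l -> G x) ->
    E (fun w => Y w * (\prod_(y <- l) y w) * H w) =
    E (fun w => contract Y l w * H w) +
    E (fun w => (\prod_(y <- l) y w) * dH Y w)].

Lemma by_parts1 : by_parts (fun=> 1) (fun _ _ => 0).
Proof.
split=> [|Y GY|Y l GY Gl]; [exact: all_moments_cst|exact: all_moments_cst|].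
under [X in Rintegral _ _ X = _]eq_fun do rewrite mulr1.
under [X in _ = Rintegral _ _ X + _]eq_fun do rewrite mulr1.
under [X in _ = _ + Rintegral _ _ X]eq_fun do rewrite mulr0.
by rewrite mean_cst addr0 wick0.
Qed.

(** The identity for [x H] and the list [l] is the identity for [H] and the list [x :: l]; the first
    term of [contract Y (x :: l)] becomes the derivative of the factor [x]. *)
Lemma by_partsM x H dH : G x -> by_parts H dH ->
  by_parts (fun w => x w * H w)
    (fun Y w => E (fun u => Y u * x u) * H w + x w * dH Y w).
Proof.
move=> Gx [mH mdH HE]; have mx := gauss_all_moments Gx; split.
- exact: all_momentsM.
- move=> Y GY; apply: all_momentsD; first exact: all_momentsZ.
  by apply: all_momentsM => //; exact: mdH.
move=> Y l GY Gl.
have Gxl y : y \in x :: l -> G y by rewrite in_cons => /orP[/eqP->//|/Gl].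
have mp := all_moments_prod Gl; have mc := all_moments_contract Y Gl.
have mdHY := mdH _ GY.
have := HE Y (x :: l) GY Gxl; rewrite /=.
set pr := (fun w => \prod_(y <- l) y w) in mp *.
have -> : (fun w => Y w * (\prod_(y <- x :: l) y w) * H w) =
    (fun w => Y w * (\prod_(y <- l) y w) * (x w * H w)).
  by apply/funext => w; rewrite big_cons; ring.
move=> ->.
set a := E (fun u => Y u * x u).
have -> : E (fun w => (a * (\prod_(y <- l) y w) + x w * contract Y l w) * H w) =
    a * E (fun w => pr w * H w) + E (fun w => contract Y l w * (x w * H w)).
  rewrite -meanZ; last exact: all_momentsM.
  rewrite -meanD; last 2 first.
  - by apply/all_momentsZ/all_momentsM.
  - by apply: all_momentsM => //; exact: all_momentsM.
  by congr Rintegral; apply/funext => w; rewrite -/(pr w); ring.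
have -> : E (fun w => (\prod_(y <- l) y w) * (a * H w + x w * dH Y w)) =
    a * E (fun w => pr w * H w) + E (fun w => pr w * (x w * dH Y w)).
  rewrite -meanZ; last exact: all_momentsM.
  rewrite -meanD; last 2 first.
  - by apply/all_momentsZ/all_momentsM.
  - by apply: all_momentsM => //; exact: all_momentsM.
  by congr Rintegral; apply/funext => w; rewrite -/(pr w); ring.
have -> : E (fun w => (\prod_(y <- x :: l) y w) * dH Y w) =
    E (fun w => pr w * (x w * dH Y w)).
  by congr Rintegral; apply/funext => w; rewrite big_cons -/(pr w); ring.
by ring.
Qed.

Lemma by_partsD H dH K dK : by_parts H dH -> by_parts K dK ->
  by_parts (fun w => H w + K w) (fun Y w => dH Y w + dK Y w).
Proof.
move=> [mH mdH HE] [mK mdK KE]; split.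
- exact: all_momentsD.
- by move=> Y GY; apply: all_momentsD; [exact: mdH|exact: mdK].
move=> Y l GY Gl.
have mp := all_moments_prod Gl; have mc := all_moments_contract Y Gl.
have mY := gauss_all_moments GY; have mdHY := mdH _ GY; have mdKY := mdK _ GY.
under [X in Rintegral _ _ X = _]eq_fun do rewrite mulrDr.
under [X in _ = Rintegral _ _ X + _]eq_fun do rewrite mulrDr.
under [X in _ = _ + Rintegral _ _ X]eq_fun do rewrite mulrDr.
rewrite !meanD; [|exact: all_momentsM..|
  by do 2?[apply: all_momentsM => //]|by do 2?[apply: all_momentsM => //]].
by rewrite HE// KE//; ring.
Qed.

Lemma by_partsZ (c : R) H dH : by_parts H dH ->
  by_parts (fun w => c * H w) (fun Y w => c * dH Y w).
Proof.
move=> [mH mdH HE]; split; first exact: all_momentsZ.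
  by move=> Y GY; apply/all_momentsZ/mdH.
move=> Y l GY Gl.
have mp := all_moments_prod Gl; have mc := all_moments_contract Y Gl.
have mY := gauss_all_moments GY; have mdHY := mdH _ GY.
under [X in Rintegral _ _ X = _]eq_fun do rewrite mulrCA.
under [X in _ = Rintegral _ _ X + _]eq_fun do rewrite mulrCA.
under [X in _ = _ + Rintegral _ _ X]eq_fun do rewrite mulrCA.
rewrite !meanZ; [|exact: all_momentsM..|
  by do 2?[apply: all_momentsM => //]].
by rewrite HE//; ring.
Qed.

Lemma by_parts_sum (I : Type) (s : seq I) (H : I -> T -> R)
    (dH : I -> (T -> R) -> T -> R) : (forall i, by_parts (H i) (dH i)) ->
  by_parts (fun w => \sum_(i <- s) H i w) (fun Y w => \sum_(i <- s) dH i Y w).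
Proof.
move=> HdH; elim: s => [|i s IHs].
  under eq_fun do rewrite big_nil.
  under [X in by_parts _ X]eq_fun do under eq_fun do rewrite big_nil.
  have := by_partsZ 0 by_parts1.
  under eq_fun do rewrite mul0r.
  by under [X in by_parts _ X]eq_fun do under eq_fun do rewrite mul0r.
under eq_fun do rewrite big_cons.
under [X in by_parts _ X]eq_fun do under eq_fun do rewrite big_cons.
exact: by_partsD.
Qed.

End Wick.

(** * Moments of centered Gaussian quadratic forms *)

Section Schur.
Context (R : realFieldType) (n : nat) (K : 'M[R]_n) (lam : R).
Hypothesis lam_gt0 : 0 < lam.
Hypothesis Ksym : forall i j, K i j = K j i.
Hypothesis Krow : forall i, \sum_j `|K i j| <= lam.

Definition frob (A : 'M[R]_n) : R := \sum_i \sum_j A i j ^+ 2.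

Lemma frob_ge0 A : 0 <= frob A.
Proof. by apply: sumr_ge0 => i _; apply: sumr_ge0 => j _; exact: sqr_ge0. Qed.

(** Cauchy-Schwarz with weights |w_j|: after symmetrizing the double sum it reduces to 2 |b_i b_j|
    <= b_i^2 + b_j^2, term by term. *)
Lemma weighted_sqr_le (w b : 'I_n -> R) :
  (\sum_j w j * b j) ^+ 2 <= (\sum_j `|w j|) * \sum_j `|w j| * b j ^+ 2.
Proof.
rewrite expr2 !big_distrlr /= -subr_ge0 -sumrB.
set f := fun i j => `|w i| * (`|w j| * b j ^+ 2) - w i * b i * (w j * b j).
have -> : \sum_i (\sum_j `|w i| * (`|w j| * b j ^+ 2) -
    \sum_j w i * b i * (w j * b j)) = \sum_i \sum_j f i j.
  by apply: eq_bigr => i _; rewrite -sumrB.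
suff : 0 <= \sum_i \sum_j f i j + \sum_i \sum_j f i j.
  by rewrite -mulr2n pmulrn_lge0.
rewrite {2}exchange_big /= -big_split /=; apply: sumr_ge0 => i _.
rewrite -big_split /=; apply: sumr_ge0 => j _; rewrite /f.
have h1 : w i * w j * (b i * b j) <= `|w i| * `|w j| * `|b i * b j|.
  by rewrite -!normrM ler_norm.
have h2 : `|b i * b j| *+ 2 <= b i ^+ 2 + b j ^+ 2.
  rewrite normrM -[b i ^+ 2]real_normK ?num_real// -[b j ^+ 2]real_normK ?num_real//.
  by rewrite -subr_ge0 -mulr_natl; have := sqr_ge0 (`|b i| - `|b j|); lra.
have h3 : 0 <= `|w i| * `|w j| by rewrite mulr_ge0.
have := ler_wpM2l h3 h2; rewrite mulr2n; lra.
Qed.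

(** Schur's test: one factor [lam] comes from the row sums, the other from the column sums, which
    are row sums by symmetry. *)
Lemma frob_mulmx B : frob (K *m B) <= lam ^+ 2 * frob B.
Proof.
rewrite /frob.
apply: (@le_trans _ _ (\sum_i \sum_l lam * \sum_j `|K i j| * B j l ^+ 2)).
  apply: ler_sum => i _; apply: ler_sum => l _; rewrite mxE.
  apply: le_trans (weighted_sqr_le _ _) _; apply: ler_wpM2r => //.
  by apply: sumr_ge0 => j _; rewrite mulr_ge0 ?sqr_ge0.
under eq_bigr do rewrite -mulr_sumr exchange_big /=.
rewrite -mulr_sumr expr2 -mulrA; apply: ler_wpM2l; first exact: ltW.
rewrite exchange_big /= mulr_sumr; apply: ler_sum => j _.
under eq_bigr do rewrite -mulr_sumr.
rewrite -mulr_suml; apply: ler_wpM2r.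
  by apply: sumr_ge0 => l _; exact: sqr_ge0.
by under eq_bigr do rewrite Ksym.
Qed.

Definition kpow (p : nat) : 'M[R]_n := iter p (mulmx K) 1%:M.

Lemma frob_kpow p : frob (kpow p.+1) <= (lam ^+ p) ^+ 2 * frob K.
Proof.
elim: p => [|p IHp]; first by rewrite /kpow /= mulmx1 expr0 expr1n mul1r.
apply: (le_trans (frob_mulmx (kpow p.+1))).
rewrite [lam ^+ p.+1]exprS exprMn -[leRHS]mulrA.
by apply: ler_wpM2l => //; exact: sqr_ge0.
Qed.

(** Young's inequality with the weight [lam ^+ p], which balances the bound of [frob_kpow]: each
    half contributes [lam ^+ p * frob K / 2]. *)
Lemma trace_kpow p :
  `|\sum_i \sum_j kpow p.+1 i j * K i j| <= lam ^+ p * frob K.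
Proof.
have lp : 0 < lam ^+ p by rewrite exprn_gt0.
have h (x y : R) : `|x * y| <= (2 * lam ^+ p)^-1 * x ^+ 2 + (lam ^+ p / 2) * y ^+ 2.
  rewrite normrM -[x ^+ 2]real_normK ?num_real// -[y ^+ 2]real_normK ?num_real//.
  set u := `|x|; set v := `|y|; set t := lam ^+ p in lp *.
  rewrite -subr_ge0.
  have -> : (2 * t)^-1 * u ^+ 2 + t / 2 * v ^+ 2 - u * v =
     (2 * t)^-1 * (u - t * v) ^+ 2.
    by field; rewrite gt_eqF.
  by rewrite mulr_ge0 ?sqr_ge0// invr_ge0 mulr_ge0// ltW.
apply: (@le_trans _ _ (\sum_i \sum_j
    ((2 * lam ^+ p)^-1 * kpow p.+1 i j ^+ 2 + (lam ^+ p / 2) * K i j ^+ 2))).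
  apply: le_trans (ler_norm_sum _ _ _) _; apply: ler_sum => i _.
  by apply: le_trans (ler_norm_sum _ _ _) _; apply: ler_sum => j _; exact: h.
under eq_bigr do rewrite big_split /= -!mulr_sumr.
rewrite big_split /= -!mulr_sumr -/(frob _) -/(frob _).
have c0 : 0 <= (2 * lam ^+ p)^-1 by rewrite invr_ge0 mulr_ge0// ltW.
apply: (le_trans (lerD (ler_wpM2l c0 (frob_kpow p)) (lexx _))).
rewrite le_eqVlt; apply/orP; left; apply/eqP.
by field; rewrite gt_eqF.
Qed.

End Schur.

(* Here [m k] = E F^k, [t p] is the trace of K^(p+1) and [u k p] is the covariance
   of F^k with the quadratic form of matrix K^p; the terms with [p > 0] are
   smaller by factors [lam / sig]. *)
Lemma moment_recurrence_bound (R : realFieldType) (u : nat -> nat -> R)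
    (m t : nat -> R) (lam sig v : R) :
  0 < lam -> lam <= sig -> sig ^+ 2 = 2 * v ->
  (forall p, u 0 p = 0) ->
  (forall k p, u k.+1 p = 2 * k.+1%:R * (u k p.+1 + t p.+1 * m k)) ->
  m 0 = 1 -> (forall k, m k.+1 = u k 0) ->
  (forall p, `|t p.+1| <= lam ^+ p * v) -> t 1 = v ->
  forall k, `|m k.+2 - k.+1%:R * sig ^+ 2 * m k| <=
            (2 * k.+1%:R * (3 ^+ k * k`!%:R)) * lam * sig ^+ k.+1.
Proof.
move=> l0 ls sv u0 uS m0 mS tb t1.
have s0 : 0 < sig by exact: lt_le_trans ls.
(* In the recurrence for [u k.+1 p] the term in [u] contributes [B k] and the term in [t]
   contributes [B k / 2], so that [B k.+1] has to be 2 (k+1) (1 + 1/2) [B k]. *)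
pose B k : R := 3 ^+ k * k`!%:R.
have B0 k : 0 <= B k by rewrite mulr_ge0// exprn_ge0.
have key k : (forall p, `|u k p| <= B k * (lam ^+ p * sig ^+ k.+1)) /\
             `|m k| <= B k * sig ^+ k.
  elim: k => [|k [IHu IHm]].
    split=> [p|]; last by rewrite m0 normr1 /B fact0 !expr0 !mulr1.
    by rewrite u0 normr0 !mulr_ge0// ?exprn_ge0// ltW.
  have lp p : 0 <= lam ^+ p by rewrite exprn_ge0// ltW.
  have sp p : 0 <= sig ^+ p by rewrite exprn_ge0// ltW.
  have BS : B k.+1 = 3 * k.+1%:R * B k.
    by rewrite /B factS natrM exprS; ring.
  split=> [p|].
    rewrite uS normrM ger0_norm ?mulr_ge0//.
    have -> : B k.+1 * (lam ^+ p * sig ^+ k.+2) =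
        2 * k.+1%:R * (3 / 2 * B k * (lam ^+ p * sig ^+ k.+2)).
      by rewrite BS; field.
    apply: ler_wpM2l; first by rewrite mulr_ge0.
    apply: le_trans (ler_normD _ _) _; rewrite normrM.
    have h1 : `|u k p.+1| <= B k * (lam ^+ p * sig ^+ k.+2).
      apply: le_trans (IHu _) _; apply: ler_wpM2l => //.
      rewrite [lam ^+ p.+1]exprSr [sig ^+ k.+2]exprS -mulrA.
      by apply: ler_wpM2l => //; exact: ler_wpM2r.
    have h2 : `|t p.+1| * `|m k| <= (lam ^+ p * v) * (B k * sig ^+ k).
      exact: ler_pM.
    have e : (lam ^+ p * v) * (B k * sig ^+ k) =
        2^-1 * (B k * (lam ^+ p * sig ^+ k.+2)).
      have -> : v = sig ^+ 2 / 2 by rewrite sv; field.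
      by rewrite !exprS; field.
    rewrite e in h2; lra.
  rewrite mS; apply: le_trans (IHu 0%N) _; rewrite expr0 mul1r.
  apply: ler_wpM2r => //; rewrite BS -[leLHS]mul1r; apply: ler_wpM2r => //.
  have : 1 <= k.+1%:R :> R by rewrite ler1n.
  lra.
move=> k; rewrite mS uS t1 sv.
have -> : 2 * k.+1%:R * (u k 1%N + v * m k) - k.+1%:R * (2 * v) * m k =
  2 * k.+1%:R * u k 1%N by ring.
rewrite normrM ger0_norm ?mulr_ge0// -!mulrA; do 2 apply: ler_wpM2l => //.
(* Here the factor [lam] of the bound on [u k 1] is kept, whereas the induction traded one [lam] for
   a [sig] at each step. *)
have [/(_ 1%N) + _] := key k; rewrite expr1 => h; apply: (le_trans h).
by rewrite /B -!mulrA.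
Qed.

Section QuadraticForm.
Context d (T : measurableType d) (R : realType) (P : probability T R).
Local Notation E Z := (Rintegral P [set: T] Z).
Variable G : (T -> R) -> Prop.
Hypothesis gaussG : gaussian_family P G.
Variables (n : nat) (X : 'I_n -> T -> R).
Hypothesis GX : forall i, G (X i).

Definition cov_mx : 'M[R]_n := \matrix_(i, j) E (fun w => X i w * X j w).
Local Notation K := cov_mx.

Definition qform (A : 'M[R]_n) (w : T) : R :=
  \sum_i \sum_j A i j * (X i w * X j w).

Definition csum_sqr (w : T) : R := \sum_i X i w ^+ 2 - \sum_i K i i.
Local Notation F := csum_sqr.

Let aX i : all_moments P (X i). Proof. exact: (gauss_all_moments gaussG). Qed.

Lemma cov_mx_sym i j : K i j = K j i.
Proof. by rewrite !mxE; congr Rintegral; apply/funext => w; rewrite mulrC. Qed.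

Lemma all_moments_csum_sqr : all_moments P F.
Proof.
apply: all_momentsB; last exact: all_moments_cst.
by apply: all_moments_sum => i; exact: all_momentsX.
Qed.

Let aF k : all_moments P (fun w => F w ^+ k).
Proof. exact/all_momentsX/all_moments_csum_sqr. Qed.

Lemma by_parts_csum_sqr H dH : by_parts P G H dH ->
  by_parts P G (fun w => F w * H w)
    (fun Y w => (2 * \sum_i E (fun u => Y u * X i u) * X i w) * H w + F w * dH Y w).
Proof.
move=> HdH.
have h i := by_partsM gaussG (GX i) (by_partsM gaussG (GX i) HdH).
have := by_partsD gaussG (by_parts_sum gaussG (index_enum 'I_n) h)
  (by_partsZ gaussG (- \sum_i K i i) HdH).
congr (by_parts _ _ _ _).
  apply/funext => w; rewrite /F mulrBl mulNr; congr (_ + _).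
  by rewrite mulr_suml; apply: eq_bigr => i _; ring.
apply/funext => Y; apply/funext => w; rewrite /F mulrBl mulNr addrA; congr (_ - _).
rewrite mulr_sumr !mulr_suml -big_split /=.
by apply: eq_bigr => i _; ring.
Qed.

Lemma by_parts_csum_sqrX k :
  by_parts P G (fun w => F w ^+ k)
    (fun Y w => k%:R * ((2 * \sum_i E (fun u => Y u * X i u) * X i w) * F w ^+ k.-1)).
Proof.
elim: k => [|k IHk].
  have := by_parts1 gaussG; congr (by_parts _ _ _ _).
  by apply/funext => Y; apply/funext => w; rewrite mul0r.
have := by_parts_csum_sqr IHk; congr (by_parts _ _ _ _).
  by apply/funext => w; rewrite exprS.
apply/funext => Y; apply/funext => w; rewrite -[k.+1%:R]natr1 /=.
case: k {IHk} => [|k]; first by rewrite mul0r mulr0 addr0 add0r mul1r.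
by rewrite /= exprS; ring.
Qed.

Lemma mean_mul_csum_sqr i j k :
  E (fun w => X i w * X j w * F w ^+ k) = K i j * E (fun w => F w ^+ k) +
  2 * k%:R * \sum_l K i l * E (fun w => X l w * X j w * F w ^+ k.-1).
Proof.
have [_ _ /(_ (X i) [:: X j] (GX i))] := by_parts_csum_sqrX k.
have Gj x : x \in [:: X j] -> G x by rewrite inE => /eqP ->.
move=> /(_ Gj) /=.
under [X in Rintegral _ _ X = _]eq_fun do rewrite big_seq1.
move=> ->; congr (_ + _).
  under [X in Rintegral _ _ X = _]eq_fun do rewrite big_nil mulr0 addr0 mulr1.
  by rewrite meanZ// mxE.
rewrite mulr_sumr.
under [RHS]eq_bigr => l _.
  rewrite mulrA -meanZ; last by apply: all_momentsM => //; exact: all_momentsM.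
  over.
rewrite -mean_sum; last first.
  by move=> l; apply/all_momentsZ; apply: all_momentsM => //; exact: all_momentsM.
congr Rintegral; apply/funext => w; rewrite big_seq1.
rewrite mulr_sumr !mulr_suml !mulr_sumr; apply: eq_bigr => l _.
by rewrite mxE; ring.
Qed.

Lemma mean_qform A : E (qform A) = \sum_i \sum_j A i j * K i j.
Proof.
rewrite /qform mean_sum; last first.
  by move=> i; apply: all_moments_sum => j; exact/all_momentsZ/all_momentsM.
apply: eq_bigr => i _; rewrite mean_sum; last first.
  by move=> j; exact/all_momentsZ/all_momentsM.
by apply: eq_bigr => j _; rewrite meanZ ?mxE//; exact: all_momentsM.
Qed.

Lemma mean_qform_csum_sqr A k :
  E (fun w => qform A w * F w ^+ k) =
  E (qform A) * E (fun w => F w ^+ k) +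
  2 * k%:R * E (fun w => qform (K *m A) w * F w ^+ k.-1).
Proof.
have gen B q : E (fun w => qform B w * F w ^+ q) =
    \sum_i \sum_j B i j * E (fun w => X i w * X j w * F w ^+ q).
  have m1 i j : all_moments P (fun w => B i j * (X i w * X j w * F w ^+ q)).
    by apply/all_momentsZ/all_momentsM => //; exact: all_momentsM.
  under [RHS]eq_bigr => i _.
    under eq_bigr => j _.
      rewrite -meanZ; last by apply: all_momentsM => //; exact: all_momentsM.
      over.
    rewrite -mean_sum//; over.
  rewrite -mean_sum; last by move=> i; exact: all_moments_sum.
  congr Rintegral; apply/funext => w; rewrite mulr_suml; apply: eq_bigr => i _.
  by rewrite mulr_suml; apply: eq_bigr => j _; ring.
rewrite !gen mean_qform.
under eq_bigr => i _ do under eq_bigr => j _ do rewrite mean_mul_csum_sqr mulrDr.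
under eq_bigr => i _ do rewrite big_split /=.
rewrite big_split /=; congr (_ + _).
  rewrite mulr_suml; apply: eq_bigr => i _; rewrite mulr_suml.
  by apply: eq_bigr => j _; ring.
rewrite exchange_big [in RHS]exchange_big mulr_sumr /=; apply: eq_bigr => j _.
under [in RHS]eq_bigr => i _ do rewrite mxE mulr_suml.
rewrite [in RHS]exchange_big mulr_sumr /=; apply: eq_bigr => i _.
rewrite mulrCA; congr (_ * _); rewrite mulr_sumr; apply: eq_bigr => l _.
by rewrite cov_mx_sym; ring.
Qed.

Lemma qform1 : qform 1%:M = (fun w => F w + \sum_i K i i).
Proof.
apply/funext => w; rewrite /F subrK /qform; apply: eq_bigr => i _.
rewrite (bigD1 i)//= big1 ?addr0; last first.
  by move=> j ji; rewrite mxE eq_sym (negbTE ji) mul0r.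
by rewrite mxE eqxx mul1r expr2.
Qed.

Lemma mean_csum_sqr : E F = 0.
Proof.
rewrite meanB; [|by apply: all_moments_sum => i; exact: all_momentsX|exact: all_moments_cst].
rewrite mean_cst mean_sum; last by move=> i; exact: all_momentsX.
by apply/eqP; rewrite subr_eq0; apply/eqP; apply: eq_bigr => i _; rewrite mxE.
Qed.

Lemma mean_csum_sqr_exp k (lam sig : R) : 0 < lam ->
  (forall i, \sum_j `|K i j| <= lam) ->
  lam ^+ 2 <= 2 * frob K -> sig = Num.sqrt (2 * frob K) ->
  `|E (fun w => F w ^+ k.+2) - k.+1%:R * sig ^+ 2 * E (fun w => F w ^+ k)| <=
  (2 * k.+1%:R * (3 ^+ k * k`!%:R)) * lam * sig ^+ k.+1.
Proof.
move=> l0 Krow lK sigE.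
have v0 : 0 <= 2 * frob K by rewrite mulr_ge0 ?frob_ge0.
pose m k := E (fun w => F w ^+ k).
pose t p := E (qform (kpow K p)).
pose u k p := E (fun w => qform (kpow K p) w * F w ^+ k) - t p * m k.
apply: (@moment_recurrence_bound _ u m t lam sig (frob K)) => //.
- rewrite sigE [lam](_ : _ = Num.sqrt (lam ^+ 2)); first exact: ler_wsqrtr.
  by rewrite sqrtr_sqr ger0_norm// ltW.
- by rewrite sigE sqr_sqrtr.
- move=> p; rewrite /u /m /t.
  under eq_fun do rewrite expr0 mulr1.
  by under [X in _ * Rintegral _ _ X]eq_fun do rewrite expr0;
    rewrite mean_cst mulr1 subrr.
- move=> q p; rewrite /u mean_qform_csum_sqr /= -/(t p) -/(m q.+1) addrAC subrr add0r.
  by rewrite -/(kpow K p.+1) -/(t p.+1) subrK.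
- by rewrite /m; under eq_fun do rewrite expr0; rewrite mean_cst.
(* The quadratic form of the identity is F plus a constant, so its covariance with F^q is E
   F^(q+1). *)
- move=> q; rewrite /u /t /m /kpow /=.
  rewrite qform1; have aF1 := all_moments_csum_sqr; have ac c := all_moments_cst P c.
  rewrite meanD// mean_csum_sqr add0r mean_cst.
  under [X in Rintegral _ _ X - _]eq_fun do rewrite mulrDl -exprS.
  by rewrite meanD// ?meanZ ?addrK//; exact: all_momentsZ.
- move=> p; rewrite /t mean_qform; apply: trace_kpow => //; exact: cov_mx_sym.
- rewrite /t mean_qform /kpow /= mulmx1 /frob.
  by apply: eq_bigr => i _; apply: eq_bigr => j _; rewrite expr2.
Qed.

End QuadraticForm.

(** * Densities and derivatives *)

Section Density.
Context d (T : measurableType d) (R : realType).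
Variables (mu nu : {measure set T -> \bar R}) (g : T -> R).
Hypothesis mg : measurable_fun [set: T] g.
Hypothesis g0 : forall x, 0 <= g x.
Hypothesis nuE : forall A, measurable A -> nu A = (\int[mu]_(x in A) (g x)%:E)%E.

Let integral_density_nnsfun (f : {nnsfun T >-> R}) :
  (\int[nu]_x (f x)%:E = \int[mu]_x ((f x)%:E * (g x)%:E))%E.
Proof.
under [LHS]eq_integral do rewrite fimfunE -fsumEFin//.
rewrite [LHS]ge0_integral_fsum//; last 2 first.
  - by move=> r; exact/measurable_EFinP/measurableT_comp.
  - by move=> n x _; rewrite EFinM nnfun_muleindic_ge0.
under [RHS]eq_integral.
  move=> x xD; rewrite fimfunE -fsumEFin// muleC ge0_mule_fsumr; last first.
    by move=> r; rewrite EFinM nnfun_muleindic_ge0.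
  over.
rewrite [RHS]ge0_integral_fsum//; last 2 first.
  - move=> r; apply: emeasurable_funM; first exact/measurable_EFinP.
    by apply/measurable_EFinP; apply: measurableT_comp.
  - move=> n x _; rewrite EFinM mule_ge0//; last by rewrite nnfun_muleindic_ge0.
    by rewrite lee_fin.
apply: eq_fsbigr => r _.
rewrite integralZl_indic_nnsfun// integral_indic// setIT nuE; last first.
  exact: measurable_sfunP.
have [r0|r0] := ltP r 0.
  have -> : f @^-1` [set r] = set0.
    apply/preimage10 => -[x _ fx]; have : 0 <= f x by [].
    by rewrite fx leNgt r0.
  rewrite integral_set0 mule0; under eq_integral do rewrite indic0 mulr0 mule0.
  by rewrite integral0.
rewrite -ge0_integralZl//; last 2 first.
- exact/measurable_EFinP/measurable_funTS.
- by move=> x _; rewrite lee_fin.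
rewrite [LHS]integral_mkcond/=; apply: eq_integral => x _.
rewrite patchE indicE; case: ifPn => xE; last by rewrite mulr0 mule0.
by rewrite mulr1 muleC.
Qed.

Lemma ge0_integral_density (f : T -> \bar R) :
  measurable_fun [set: T] f -> (forall x, 0 <= f x)%E ->
  (\int[nu]_x f x = \int[mu]_x (f x * (g x)%:E))%E.
Proof.
move=> mf f0.
pose f_ := nnsfun_approx measurableT mf.
transitivity (lim (\int[nu]_x (f_ n x)%:E @[n --> \oo])%E).
  rewrite -monotone_convergence//=.
  - apply: eq_integral => ? /[!inE] xD; apply/esym/cvg_lim => //=.
    exact: cvg_nnsfun_approx.
  - by move=> n; exact/measurable_EFinP/measurable_funTS.
  - by move=> n ? _; rewrite lee_fin.
  - by move=> ? _ ? ? mn; rewrite lee_fin; exact/lefP/nd_nnsfun_approx.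
rewrite (_ : (fun n => _) = (fun n => \int[mu]_x ((f_ n x)%:E * (g x)%:E))%E); last first.
  by apply/funext => n; exact: integral_density_nnsfun.
rewrite -monotone_convergence//=.
- apply: eq_integral => x /[!inE] xD; apply/cvg_lim => //.
  apply: cvgeZr => //; exact: cvg_nnsfun_approx.
- move=> n; apply: emeasurable_funM; last exact/measurable_EFinP.
  exact/measurable_EFinP/measurable_funTS.
- by move=> n x _; rewrite mule_ge0// lee_fin.
- move=> x _ i j ij; apply: lee_wpmul2r; rewrite ?lee_fin//.
  exact/lefP/nd_nnsfun_approx.
Qed.

Lemma integrable_density (f : T -> R) : measurable_fun [set: T] f ->
  mu.-integrable [set: T] (EFin \o (fun x => f x * g x)) ->
  nu.-integrable [set: T] (EFin \o f).
Proof.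
move=> mf /integrableP[_ fgoo]; apply/integrableP; split; first exact/measurable_EFinP.
rewrite ge0_integral_density//; last first.
  by apply: measurableT_comp => //; exact/measurable_EFinP.
apply: le_lt_trans fgoo; rewrite le_eqVlt; apply/orP; left; apply/eqP.
by apply: eq_integral => x _; rewrite /= normrM EFinM [X in (_ * X%:E)%E]ger0_norm.
Qed.

Lemma integral_density (f : T -> R) : measurable_fun [set: T] f ->
  (\int[nu]_x (f x)%:E = \int[mu]_x (f x * g x)%:E)%E.
Proof.
move=> mf; rewrite integralE [RHS]integralE.
have mfE : measurable_fun [set: T] (EFin \o f) by exact/measurable_EFinP.
congr (_ - _)%E.
- rewrite ge0_integral_density//; last exact: measurable_funepos.
  by apply: eq_integral => x _; rewrite !funeposE EFinM maxe_pMl ?lee_fin// mul0e.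
- rewrite ge0_integral_density//; last exact: measurable_funeneg.
  apply: eq_integral => x _.
  by rewrite !funenegE EFinM maxe_pMl ?lee_fin// mul0e mulNe.
Qed.

End Density.

Section Derive.
Context (R : realType).
Implicit Types (f g : R -> R) (x a b : R).

Lemma is_derive1_cst x a : is_derive x 1 (fun=> a) 0.
Proof. exact: is_derive_cst. Qed.

Lemma is_derive1_id x : is_derive x 1 (fun y => y) 1.
Proof. exact: is_derive_id. Qed.

Lemma is_derive1D f g x a b : is_derive x 1 f a -> is_derive x 1 g b ->
  is_derive x 1 (fun y => f y + g y) (a + b).
Proof. by move=> fa gb; exact: is_deriveD. Qed.

Lemma is_derive1N f x a : is_derive x 1 f a -> is_derive x 1 (fun y => - f y) (- a).
Proof. by move=> fa; exact: is_deriveN. Qed.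

Lemma is_derive1B f g x a b : is_derive x 1 f a -> is_derive x 1 g b ->
  is_derive x 1 (fun y => f y - g y) (a - b).
Proof. by move=> fa gb; exact: is_deriveB. Qed.

Lemma is_derive1M f g x a b : is_derive x 1 f a -> is_derive x 1 g b ->
  is_derive x 1 (fun y => f y * g y) (f x * b + g x * a).
Proof. by move=> fa gb; exact: is_deriveM. Qed.

Lemma is_derive1Z f x a c : is_derive x 1 f a -> is_derive x 1 (fun y => c * f y) (c * a).
Proof.
move=> fa; apply: (is_derive_eq (is_derive1M (is_derive1_cst x c) fa)).
by rewrite mulr0 addr0.
Qed.

Lemma is_derive1X f x a n : is_derive x 1 f a ->
  is_derive x 1 (fun y => f y ^+ n) (n%:R * f x ^+ n.-1 * a).
Proof.
move=> fa; elim: n => [|n IHn].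
  by rewrite !mul0r; under eq_fun do rewrite expr0; exact: is_derive1_cst.
under eq_fun do rewrite exprS.
apply: (is_derive_eq (is_derive1M fa IHn)).
rewrite -[n.+1%:R]natr1 /=; case: n {IHn} => [|n] /=; first by rewrite expr0; ring.
by rewrite exprS; ring.
Qed.

Lemma is_derive1_compose f g x a b : is_derive (g x) 1 f a -> is_derive x 1 g b ->
  is_derive x 1 (fun y => f (g y)) (a * b).
Proof. by move=> fa gb; exact: is_derive1_comp. Qed.

Lemma is_derive1_continuous f x a : is_derive x 1 f a -> {for x, continuous f}.
Proof.
by move=> fa; apply/differentiable_continuous/derivable1_diffP; exact: ex_derive.
Qed.

Lemma is_derive1_sum (I : Type) (s : seq I) (f : I -> R -> R) (a : I -> R) x :
  (forall i, is_derive x 1 (f i) (a i)) ->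
  is_derive x 1 (fun y => \sum_(i <- s) f i y) (\sum_(i <- s) a i).
Proof.
move=> fa; elim: s => [|i s IHs].
  by rewrite big_nil; under eq_fun do rewrite big_nil; exact: is_derive1_cst.
by rewrite big_cons; under eq_fun do rewrite big_cons; exact: is_derive1D.
Qed.

Lemma continuous_FTC2_is_derive (F f : R -> R) a b : a < b ->
  (forall x, is_derive x 1 F (f x)) -> continuous f ->
  (\int[lebesgue_measure]_(x in `[a, b]) (f x)%:E = (F b - F a)%:E)%E.
Proof.
move=> ab dF cf; have cF : continuous F by move=> x; apply: is_derive1_continuous (dF x).
rewrite (@continuous_FTC2 _ f F)//.
- exact: continuous_subspaceT.
- split=> [x _||]; first exact: ex_derive.
    by apply: cvg_at_right_filter; exact: cF.
  by apply: cvg_at_left_filter; exact: cF.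
- by move=> x _; rewrite derive1E; exact: derive_val.
Qed.

End Derive.

(** * Moments of the normal distribution *)

Section NormalMoments.
Context (R : realType) (m s : R).
Hypothesis s_gt0 : 0 < s.
Local Notation mu := (@lebesgue_measure R).
Local Notation pdf := (normal_pdf m s).

Let sn0 : s != 0. Proof. by rewrite gt_eqF. Qed.

Lemma is_derive1_normal_pdf (x : R) : is_derive x 1 pdf (- (x - m) / s ^+ 2 * pdf x).
Proof.
rewrite normal_pdfE//.
have h : is_derive x 1 (fun y => - (y - m) ^+ 2 / (s ^+ 2 *+ 2)) (- (x - m) / s ^+ 2).
  have h1 := is_derive1Z (- (s ^+ 2 *+ 2)^-1)
    (is_derive1X 2 (is_derive1B (is_derive1_id x) (is_derive1_cst x m))).
  have -> : (fun y => - (y - m) ^+ 2 / (s ^+ 2 *+ 2)) =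
    (fun y => - (s ^+ 2 *+ 2)^-1 * (y - m) ^+ 2) by apply/funext => y; ring.
  by apply: (is_derive_eq h1); rewrite /=; field.
have := is_derive1Z (normal_peak s) (is_derive1_compose (is_derive_expR _) h).
by move=> h2; apply: (is_derive_eq h2); rewrite /normal_fun; ring.
Qed.

Lemma exp_le_expR (u : R) k : 0 <= u -> u ^+ k <= k`!%:R * expR u.
Proof.
move=> u0; case: k => [|k].
  by rewrite expr0 fact0 mul1r (le_trans _ (expR_ge1Dx u))// lerDl.
have := expR_ge1Dxn k u0 => h.
rewrite mulrC -ler_pdivrMr ?ltr0n ?fact_gt0//.
by apply: le_trans h; rewrite lerDr.
Qed.

(** With u = (x - m)^2 / (4 s^2) the density is proportional to exp(-u) exp(-u). One factor absorbs
    the power of |x - m|, the other is the normal density with doubled variance, which is integrable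
    and bounded. *)
Lemma normal_pdf_moment_le k : exists B : R, 0 <= B /\ forall x,
  `|x - m| ^+ k * pdf x <= B * normal_pdf m (s * Num.sqrt 2) x.
Proof.
have s2 : s * Num.sqrt 2 != 0 by rewrite mulf_neq0// gt_eqF ?sqrtr_gt0.
have p0 := normal_peak_gt0 s2.
pose C : R := (1 + (4 * s ^+ 2) ^+ k * k`!%:R).
have C0 : 0 <= C by rewrite addr_ge0// mulr_ge0// exprn_ge0// mulr_ge0 ?sqr_ge0.
exists (C * normal_peak s / normal_peak (s * Num.sqrt 2)); split.
  by rewrite !mulr_ge0 ?invr_ge0 ?normal_peak_ge0.
move=> x; rewrite !normal_pdfE//.
have -> : C * normal_peak s / normal_peak (s * Num.sqrt 2) *
  (normal_peak (s * Num.sqrt 2) * normal_fun m (s * Num.sqrt 2) x) =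
  normal_peak s * (C * normal_fun m (s * Num.sqrt 2) x).
  by field; rewrite gt_eqF.
rewrite mulrCA ler_wpM2l ?normal_peak_ge0//.
pose u := (x - m) ^+ 2 / (4 * s ^+ 2).
have u0 : 0 <= u by rewrite mulr_ge0 ?sqr_ge0// invr_ge0 mulr_ge0 ?sqr_ge0.
have -> : normal_fun m s x = expR (- u) * expR (- u).
  rewrite /normal_fun -expRD; congr expR; rewrite /u; by field.
have -> : normal_fun m (s * Num.sqrt 2) x = expR (- u).
  rewrite /normal_fun exprMn sqr_sqrtr//; congr expR; rewrite /u; by field.
rewrite mulrA ler_wpM2r ?expR_ge0// expRN ler_pdivrMr ?expR_gt0//.
have h1 : `|x - m| ^+ k <= 1 + u ^+ k * (4 * s ^+ 2) ^+ k.
  have -> : u ^+ k * (4 * s ^+ 2) ^+ k = (`|x - m| ^+ k) ^+ 2.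
    rewrite -exprMn exprAC real_normK ?num_real//; congr (_ ^+ _); rewrite /u.
    by field.
  set t := `|x - m| ^+ k; have := sqr_ge0 (t - 1); have := sqr_ge0 t; lra.
apply: (le_trans h1);
  rewrite (_ : C * expR u = expR u + (4 * s ^+ 2) ^+ k * k`!%:R * expR u); last first.
  by rewrite /C; ring.
apply: lerD.
  by rewrite (le_trans _ (expR_ge1Dx u))// lerDl.
have c0 : 0 <= (4 * s ^+ 2) ^+ k by rewrite exprn_ge0// mulr_ge0// sqr_ge0.
rewrite mulrC -mulrA; apply: ler_wpM2l => //.
exact: exp_le_expR.
Qed.

Lemma integrable_normal_moment k :
  mu.-integrable [set: R] (EFin \o (fun x => (x - m) ^+ k * pdf x)).
Proof.
have [B [B0 HB]] := normal_pdf_moment_le k.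
have iB : mu.-integrable [set: R]
    (EFin \o (fun x => B * normal_pdf m (s * Num.sqrt 2) x)).
  have := integrableZl measurableT B (integrable_normal_pdf m (s * Num.sqrt 2)).
  by apply: eq_integrable => // x _; rewrite /= EFinM.
apply: le_integrable iB => //.
  apply/measurable_EFinP; apply: measurable_funM; last exact: measurable_normal_pdf.
  by apply: measurable_funX; apply: measurable_funB.
move=> x _ /=; rewrite lee_fin normrM normrX [`|pdf x|]ger0_norm ?normal_pdf_ge0//.
by apply: le_trans (HB x) _; exact: ler_norm.
Qed.

Local Notation J k := (\int[mu]_x ((x - m) ^+ k * pdf x)).

(** Integration by parts: the difference [f] of the two integrands is the derivative of [F], which
    vanishes at both ends. The improper integral is reached by dominated convergence from the
    intervals [m - (n+1), m + (n+1)]. *)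
Lemma normal_moment_rec k : J k.+1 = s ^+ 2 * k%:R * J k.-1.
Proof.
pose f x := (x - m) ^+ k.+1 * pdf x - s ^+ 2 * k%:R * ((x - m) ^+ k.-1 * pdf x).
pose F x := - s ^+ 2 * ((x - m) ^+ k * pdf x).
have dF (x : R) : is_derive x 1 F (f x).
  have h := is_derive1Z (- s ^+ 2) (is_derive1M
    (is_derive1X k (is_derive1B (is_derive1_id x) (is_derive1_cst x m)))
    (is_derive1_normal_pdf x)).
  apply: (is_derive_eq h); rewrite /f [(x - m) ^+ k.+1]exprS; by field.
have cpdf : continuous pdf.
  by move=> x; apply: is_derive1_continuous (is_derive1_normal_pdf x).
have cX j : continuous (fun x : R => (x - m) ^+ j).
  by move=> x; apply: is_derive1_continuous
     (is_derive1X j (is_derive1B (is_derive1_id x) (is_derive1_cst x m))).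
have cf : continuous f.
  move=> x; rewrite /continuous_at /f; apply: cvgB.
    by apply: cvgM; [exact: cX|exact: cpdf].
  apply: cvgM; first exact: cvg_cst.
  by apply: cvgM; [exact: cX|exact: cpdf].
have i1 := integrable_normal_moment k.+1.
have i2 := integrable_normal_moment k.-1.
have i2' : mu.-integrable [set: R]
    (EFin \o (fun x => s ^+ 2 * k%:R * ((x - m) ^+ k.-1 * pdf x))).
  have := integrableZl measurableT (s ^+ 2 * k%:R) i2.
  by apply: eq_integrable => // x _; rewrite /= EFinM.
have if_ : mu.-integrable [set: R] (EFin \o f).
  have := integrableB measurableT i1 i2'.
  by apply: eq_integrable => // x _; rewrite /= EFinB.
suff : \int[mu]_x f x = 0.
  rewrite /f RintegralB// RintegralZl// => /eqP.
  by rewrite subr_eq0 => /eqP.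
pose g (n : nat) x := f x * \1_(`[m - n.+1%:R, m + n.+1%:R]) x.
have gE n : (\int[mu]_x (g n x)%:E = (F (m + n.+1%:R) - F (m - n.+1%:R))%:E)%E.
  rewrite -(@continuous_FTC2_is_derive _ F f)//; last first.
    by rewrite ltrD2l (@lt_trans _ _ 0)// ?oppr_lt0 ltr0n.
  rewrite [RHS]integral_mkcond/=; apply: eq_integral => x _.
  rewrite patchE /g indicE; case: ifPn => _; by rewrite ?mulr1 ?mulr0.
have [] := @dominated_convergence _ _ _ mu [set: R] measurableT
    (fun n => EFin \o g n) (EFin \o f) (abse \o (EFin \o f)).
- move=> n; apply/measurable_EFinP; apply: measurable_funM; last exact: measurable_indic.
  exact: continuous_measurable_fun.
- by apply/measurable_EFinP; exact: continuous_measurable_fun.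
- apply: aeW => x _ /=; apply: cvg_EFin; first by near=> n.
  rewrite /comp /=; apply: cvg_near_cst; near=> n; apply/eqP => /=.
  rewrite /g indicE mem_set ?mulr1//= in_itv/=.
  have xn : `|x - m| <= n.+1%:R.
    apply: (@le_trans _ _ n%:R); last by rewrite ler_nat.
    by near: n; exact: nbhs_infty_ger.
  by move: xn; rewrite ler_norml => /andP[h1 h2]; apply/andP; split; lra.
- exact: integrable_abse.
- apply: aeW => n x _ /=; rewrite lee_fin /g normrM indicE.
  by case: (_ \in _); rewrite /= ?normr1 ?mulr1// normr0 mulr0.
move=> _ _ cvI.
have cv0 : (F (m + n.+1%:R) - F (m - n.+1%:R))%:E @[n --> \oo] --> 0%:E.
  apply: cvg_EFin; first by near=> n.
  rewrite /comp /=.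
  (* One power more than occurs in [F]: at distance n + 1 from [m] it gives |F| a factor 1 / (n +
     1). *)
  have [B [B0 HB]] := normal_pdf_moment_le k.+1.
  pose A := 2 * s ^+ 2 * (B * normal_peak (s * Num.sqrt 2)).
  have s2 : s * Num.sqrt 2 != 0 by rewrite mulf_neq0// gt_eqF ?sqrtr_gt0.
  have Fb (y : R) (n : nat) : `|y - m| = n.+1%:R -> `|F y| <= A / 2 * n.+1%:R^-1.
    move=> yn; rewrite /F normrM normrN [`|s ^+ 2|]ger0_norm ?sqr_ge0// /A.
    rewrite normrM normrX yn [`|pdf y|]ger0_norm ?normal_pdf_ge0//.
    have := HB y; rewrite yn exprS => h.
    have h2 : n.+1%:R * (n.+1%:R ^+ k * pdf y) <= B * normal_peak (s * Num.sqrt 2).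
      by rewrite mulrA; apply: (le_trans h); rewrite ler_wpM2l// normal_pdf_ub.
    have id2 (a b c : R) : 2 * a * b / 2 * c = a * (b * c) by field.
    by rewrite id2 ler_wpM2l ?sqr_ge0// ler_pdivlMr ?ltr0n// mulrC.
  apply: norm_cvg0.
  apply: (@squeeze_cvgr _ _ _ _ (fun=> 0) (fun n : nat => A * n.+1%:R^-1)).
  - apply: nearW => n; rewrite normr_ge0 /=; apply: (le_trans (ler_normB _ _)).
    have h1 : `|F (m + n.+1%:R)| <= A / 2 * n.+1%:R^-1.
      by apply: Fb; rewrite addrC addKr normr_nat.
    have h2 : `|F (m - n.+1%:R)| <= A / 2 * n.+1%:R^-1.
      by apply: Fb; rewrite addrC addKr normrN normr_nat.
    apply: (le_trans (lerD h1 h2)).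
    by rewrite -mulrDl -splitr.
  - exact: cvg_cst.
  - rewrite -[X in _ --> X](mulr0 A); apply: cvgM; first exact: cvg_cst.
    exact: cvg_harmonic.
have fE : (\int[mu]_x (f x)%:E = 0%:E)%E.
  apply: cvg_unique cvI _ => //.
  by rewrite (_ : (fun n => _) = (fun n => (F (m + n.+1%:R) - F (m - n.+1%:R))%:E)%E)//;
    apply/funext => n; exact: gE.
by rewrite /Rintegral fE.
Unshelve. all: by end_near. Qed.

End NormalMoments.

(** * Gaussian processes *)

Section GaussianLaw.
Context d (T : measurableType d) (R : realType) (P : probability T R).
Local Notation E Z := (Rintegral P [set: T] Z).
Local Notation mu := (@lebesgue_measure R).

Lemma normal_law_moments (Z : {mfun T >-> R}) (m s : R) : 0 < s ->
  (forall A, measurable A -> pushforward P Z A = normal_prob m s A) ->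
  forall k,
    P.-integrable [set: T] (EFin \o (fun w => (Z w - m) ^+ k)) /\
    E (fun w => (Z w - m) ^+ k) = \int[mu]_x ((x - m) ^+ k * normal_pdf m s x).
Proof.
move=> s0 ZN k.
have mfk : measurable_fun [set: R] (fun x : R => (x - m) ^+ k).
  by apply: measurable_funX; apply: measurable_funB.
have mp := measurable_normal_pdf m s; have p0 := normal_pdf_ge0 m s.
(* [normal_prob] lives on [measurableTypeR R], so [Z] is repackaged as a measurable function with
   this codomain. *)
have mZ : @measurable_fun _ _ T (measurableTypeR R) [set: T] Z.
  exact: (@measurable_funPT _ _ _ _ Z).
pose Y : {mfun T >-> measurableTypeR R} := @mfun_Sub _ _ T (measurableTypeR R) Z (mem_set mZ).
have YZ : (Y : T -> R) = Z by rewrite /Y mfun_valP.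
have YN A : measurable A -> distribution P Y A = normal_prob m s A.
  by move=> mA; rewrite -ZN// /distribution YZ.
have ik : (distribution P Y).-integrable [set: R] (EFin \o (fun x => (x - m) ^+ k)).
  apply: (@integrable_density _ _ _ mu (distribution P Y) _ mp p0 YN) => //.
  exact: integrable_normal_moment.
have ikP : P.-integrable [set: T] (EFin \o (fun w => (Z w - m) ^+ k)).
  move/integrableP : ik => [_ ik]; apply/integrableP; split.
    apply/measurable_EFinP; apply: measurable_funX.
    by apply: measurable_funB => //; exact: measurable_funPT.
  apply: le_lt_trans ik; rewrite ge0_integral_distribution//.
  by apply: measurableT_comp => //; apply/measurable_EFinP.
split=> //; rewrite /Rintegral; congr fine.
rewrite -(@integral_density _ _ _ mu (distribution P Y) _ mp p0 YN)//.
by rewrite integral_distribution//; exact/measurable_EFinP.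
Qed.

Lemma all_moments_of_exp (Z : T -> R) : measurable_fun [set: T] Z ->
  (forall k, P.-integrable [set: T] (EFin \o (fun w => Z w ^+ k))) -> all_moments P Z.
Proof.
move=> mZ iZ; split=> // k; have := integrable_norm (iZ k).
by apply: eq_integrable => // w _; rewrite /= normrX.
Qed.

Lemma gaussian_law_all_moments (Z : {mfun T >-> R}) :
  gaussian_law (pushforward P Z) -> all_moments P Z.
Proof.
move=> [m [[s [s0 ZN]]|ZD]].
  have h := normal_law_moments s0 ZN.
  have : all_moments P (fun w => Z w - m).
    apply: all_moments_of_exp => [|k]; last by case: (h k).
    by apply: measurable_funB => //; exact: measurable_funPT.
  move=> /all_momentsD /(_ (all_moments_cst P m)).
  by under eq_fun do rewrite subrK.
have aeZ : {ae P, forall w, Z w = m}.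
  have mA : measurable (Z @^-1` (~` [set m])).
    rewrite -[X in measurable X]setTI; apply: (@measurable_funPT _ _ _ _ Z) => //.
    exact: (measurableC (measurable_set1 m)).
  exists (Z @^-1` (~` [set m])); split => //.
  have := ZD (~` [set m]) (measurableC (measurable_set1 m)).
  by rewrite /pushforward => ->; rewrite diracE memNset//=; exact.
split; first exact: measurable_funPT.
move=> k; apply/integrableP; split.
  by apply/measurable_EFinP; apply: measurable_funX; apply: measurableT_comp => //.
have -> : (\int[P]_x `|(EFin \o (fun w => `|Z w| ^+ k)%R) x| =
           \int[P]_x (Num.norm (Num.norm m ^+ k))%:E)%E.
  apply: ae_eq_integral => //.
  - apply: measurableT_comp => //; apply/measurable_EFinP; apply: measurable_funX.
    exact: measurableT_comp.
  - by apply: filterS aeZ => w /= -> _.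
by rewrite integral_cst//= probability_setT mule1 ltry.
Qed.

Lemma gaussian_law_moments (Z : {mfun T >-> R}) k :
  gaussian_law (pushforward P Z) -> E Z = 0 ->
  E (fun w => Z w ^+ k.+2) =
  k.+1%:R * E (fun w => Z w ^+ 2) * E (fun w => Z w ^+ k).
Proof.
move=> gZ EZ; have aZ := gaussian_law_all_moments gZ.
case: gZ => m [[s [s0 ZN]]|ZD].
  have h := normal_law_moments s0 ZN.
  have m0 : m = 0.
    have [_] := h 1%N; rewrite (normal_moment_rec m s0 0) mulr0 mul0r.
    under eq_Rintegral do rewrite expr1.
    by rewrite meanB//; [rewrite EZ mean_cst sub0r => /eqP; rewrite oppr_eq0 => /eqP|
      exact: all_moments_cst].
  have hk j : E (fun w => Z w ^+ j) = \int[mu]_x ((x - m) ^+ j * normal_pdf m s x).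
    have [_ <-] := h j.
    by apply: eq_Rintegral => w _; rewrite m0 subr0.
  have J0 : \int[mu]_x ((x - m) ^+ 0 * normal_pdf m s x) = 1.
    under eq_Rintegral do rewrite expr0 mul1r.
    by rewrite /Rintegral integral_normal_pdf.
  rewrite !hk !(normal_moment_rec m s0) /= J0.
  by ring.
have aeZ : {ae P, forall w, Z w = m}.
  have mA : measurable (Z @^-1` (~` [set m])).
    rewrite -[X in measurable X]setTI; apply: (@measurable_funPT _ _ _ _ Z) => //.
    exact: (measurableC (measurable_set1 m)).
  exists (Z @^-1` (~` [set m])); split => //.
  have := ZD (~` [set m]) (measurableC (measurable_set1 m)).
  by rewrite /pushforward => ->; rewrite diracE memNset//=; exact.
have EX j : E (fun w => Z w ^+ j) = m ^+ j.
  rewrite -[RHS](@mean_cst _ _ _ P) /Rintegral; congr fine.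
  apply: ae_eq_integral => //.
  - by apply/measurable_EFinP; apply: measurable_funX; exact: measurable_funPT.
  - by apply: filterS aeZ => w /= -> _.
have m0 : m = 0.
  by rewrite -EZ -[LHS]expr1 -EX; apply: eq_Rintegral => w _; rewrite expr1.
by rewrite !EX m0 !exprS !mul0r mulr0 mul0r.
Qed.

End GaussianLaw.

Section GaussianProcess.
Context d (T : measurableType d) (R : realType) (P : probability T R).
Variable X : R -> {RV P >-> R}.
Hypotheses (gX : gaussian_process X) (cX : centered X).
Local Notation E Z := (Rintegral P [set: T] Z).

Definition lincomb (Z : T -> R) : Prop :=
  exists (s : seq (R * R)), Z = (fun w => \sum_(p <- s) p.1 * X p.2 w).

Lemma measurable_lincomb Z : lincomb Z -> measurable_fun [set: T] Z.
Proof.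
move=> [s ->]; apply: measurable_fun_sum => p.
by apply: measurable_funM => //; exact: measurable_funPT.
Qed.

Lemma lincomb_gaussian Z : lincomb Z -> gaussian_law (pushforward P Z).
Proof.
move=> [s ->].
have := @gX (size s) (fun i => (tnth (in_tuple s) i).2) (fun i => (tnth (in_tuple s) i).1).
congr (gaussian_law (pushforward P _)); apply/funext => w.
by rewrite [RHS]big_tnth.
Qed.

Lemma gaussian_process_all_moments t : all_moments P (X t).
Proof.
apply: gaussian_law_all_moments.
have := @lincomb_gaussian (fun w => \sum_(p <- [:: (1, t)]) p.1 * X p.2 w).
have -> : (fun w => \sum_(p <- [:: (1, t)]) p.1 * X p.2 w) = X t.
  by apply/funext => w; rewrite big_seq1 mul1r.
by apply; exists [:: (1, t)]; apply/funext => w; rewrite big_seq1 mul1r.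
Qed.

Lemma mean_lincomb Z : lincomb Z -> E Z = 0.
Proof.
move=> [s ->]; rewrite mean_sum; last first.
  by move=> p; exact/all_momentsZ/gaussian_process_all_moments.
apply: big1 => p _; rewrite meanZ; last exact: gaussian_process_all_moments.
by have := cX p.2; rewrite unlock /Rintegral => ->; rewrite mulr0.
Qed.

Lemma gaussian_family_lincomb : gaussian_family P lincomb.
Proof.
have mfunE (Z : T -> R) : measurable_fun [set: T] Z ->
    exists Y : {mfun T >-> R}, Z = Y.
  by move=> mZ; exists (mfun_Sub (mem_set mZ)); rewrite mfun_valP.
split.
- move=> c _ _ [s ->] [t ->]; exists (s ++ [seq (c * p.1, p.2) | p <- t]).
  apply/funext => w; rewrite big_cat big_map /= mulr_sumr; congr (_ + _).
  by apply: eq_bigr => p _; rewrite mulrA.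
- move=> Z lZ; have [Y ZY] := mfunE _ (measurable_lincomb lZ).
  rewrite ZY; apply: gaussian_law_all_moments; rewrite -ZY.
  exact: lincomb_gaussian.
- exact: mean_lincomb.
- move=> Z k lZ; have [Y ZY] := mfunE _ (measurable_lincomb lZ).
  have := lincomb_gaussian lZ; have := mean_lincomb lZ; rewrite ZY => EY gY.
  exact: gaussian_law_moments.
Qed.

End GaussianProcess.

(** * Taylor bounds and trigonometric step functions *)

Section Taylor.
Context (R : realType).
Implicit Types (g : nat -> R -> R) (x y z B : R).

Lemma is_derive1_ge0_le (f df : R -> R) x y : x <= y ->
  (forall z, x <= z <= y -> is_derive z 1 f (df z)) ->
  (forall z, x <= z <= y -> 0 <= df z) -> f x <= f y.
Proof.
move=> xy fdf df0.
have [||c] := @MVT_segment _ f df x y xy.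
- by move=> z; rewrite in_itv/= => /andP[/ltW xz /ltW zy]; apply: fdf; rewrite xz.
- apply: derivable_within_continuous => z; rewrite in_itv/= => zxy.
  by have := fdf _ zxy => h; exact: ex_derive.
rewrite in_itv/= => cxy h; rewrite -subr_ge0 h mulr_ge0 ?subr_ge0//.
exact: df0.
Qed.

Lemma is_derive1_taylor_term (a x z : R) k :
  is_derive z 1 (fun z => a * (z - x) ^+ k.+1 / k.+1`!%:R) (a * (z - x) ^+ k / k`!%:R).
Proof.
have h := is_derive1Z (a / k.+1`!%:R)
  (is_derive1X k.+1 (is_derive1B (is_derive1_id z) (is_derive1_cst z x))).
have -> : (fun z => a * (z - x) ^+ k.+1 / k.+1`!%:R) =
    (fun z => a / k.+1`!%:R * (z - x) ^+ k.+1) by apply/funext => u; ring.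
apply: (is_derive_eq h); rewrite factS natrM /=.
have k0 : k`!%:R != 0 :> R by rewrite pnatr_eq0 -lt0n fact_gt0.
have k1 : k.+1%:R != 0 :> R by rewrite pnatr_eq0.
move: k0 k1; move: (k`!%:R) (k.+1%:R) => f c k0 k1.
by field; rewrite k0 k1.
Qed.

(** The remainder [r] and the bound [b] both vanish at [x], and |r'| <= b' is the induction
    hypothesis for the shifted family; hence [b + r] and [b - r] are nondecreasing. The successive
    derivatives are an abstract family [g], which may be given by different expressions at different
    orders, as in [residr]. *)
Lemma taylor_right g m x y B : x <= y ->
  (forall i z, (i < m)%N -> x <= z <= y -> is_derive z 1 (g i) (g i.+1 z)) ->
  (forall z, x <= z <= y -> `|g m z| <= B) ->
  `|g 0%N y - \sum_(k < m) g k x * (y - x) ^+ k / k`!%:R| <=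
  B * (y - x) ^+ m / m`!%:R.
Proof.
elim: m g y => [|m IHm] g y xy gd gB.
  by rewrite big_ord0 subr0 expr0 fact0 mulr1 divr1; apply: gB; rewrite xy lexx.
pose r z := g 0%N z - \sum_(k < m.+1) g k x * (z - x) ^+ k / k`!%:R.
pose dr z := g 1%N z - \sum_(k < m) g k.+1 x * (z - x) ^+ k / k`!%:R.
pose b z := B * (z - x) ^+ m.+1 / m.+1`!%:R.
pose db z := B * (z - x) ^+ m / m`!%:R.
have rd z : x <= z <= y -> is_derive z 1 r (dr z).
  move=> zxy; rewrite /r; under eq_fun do rewrite big_ord_recl.
  apply: is_derive1B; first exact: gd.
  rewrite -[X in is_derive _ _ _ X]add0r; apply: is_derive1D.
    by under eq_fun do rewrite expr0; exact: is_derive1_cst.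
  by apply: is_derive1_sum => k; exact: is_derive1_taylor_term.
have bd z : is_derive z 1 b (db z) by exact: is_derive1_taylor_term.
have drB z : x <= z <= y -> `|dr z| <= db z.
  move=> /andP[xz zy]; apply: (IHm (fun i => g i.+1)) => // [i u im|u] /andP[xu uz].
    by apply: gd => //; rewrite xu (le_trans uz).
  by apply: gB; rewrite xu (le_trans uz).
have r0 : r x = 0.
  rewrite /r big_ord_recl expr0 mulr1 divr1 big1 ?addr0 ?subrr// => i _.
  by rewrite ?subrr expr0n mulr0 mul0r.
have b0 : b x = 0 by rewrite /b subrr expr0n mulr0 mul0r.
rewrite -/(r y) -/(b y) ler_norml; apply/andP; split.
- have : b x + r x <= b y + r y.
    apply: (@is_derive1_ge0_le (fun z => b z + r z) (fun z => db z + dr z)) => // z zxy.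
      exact: (is_derive1D (bd z) (rd z zxy)).
    by have := drB _ zxy; rewrite ler_norml => /andP[]; lra.
  by rewrite r0 b0; lra.
- have : b x - r x <= b y - r y.
    apply: (@is_derive1_ge0_le (fun z => b z - r z) (fun z => db z - dr z)) => // z zxy.
      exact: (is_derive1B (bd z) (rd z zxy)).
    by have := drB _ zxy; rewrite ler_norml => /andP[]; lra.
  by rewrite r0 b0; lra.
Qed.

(** The condition [0 <= (z - x) * (y - x)] puts [z] on the same side of [x] as [y], so the two
    conditions together describe the segment between [x] and [y]. The case y < x follows by
    reflection. *)
Lemma taylor_bound g m x y B :
  (forall i z, (i < m)%N -> `|z - x| <= `|y - x| -> 0 <= (z - x) * (y - x) ->
     is_derive z 1 (g i) (g i.+1 z)) ->
  (forall z, `|z - x| <= `|y - x| -> 0 <= (z - x) * (y - x) -> `|g m z| <= B) ->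
  `|g 0%N y - \sum_(k < m) g k x * (y - x) ^+ k / k`!%:R| <=
  B * `|y - x| ^+ m / m`!%:R.
Proof.
move=> gd gB; have [xy|/ltW yx] := leP x y.
  rewrite [X in X ^+ m]ger0_norm ?subr_ge0//.
  have h z : x <= z <= y -> `|z - x| <= `|y - x| /\ 0 <= (z - x) * (y - x).
    move=> /andP[xz zy]; rewrite !ger0_norm ?subr_ge0// mulr_ge0 ?subr_ge0//.
    by split=> //; rewrite lerD2r.
  by apply: taylor_right => // [i z im|z] /h[h1 h2]; [exact: gd|exact: gB].
pose f i z := (-1) ^+ i * g i (- z).
have h z : - x <= z <= - y -> `|- z - x| <= `|y - x| /\ 0 <= (- z - x) * (y - x).
  move=> /andP[xz zy]; rewrite !ler0_norm; [|lra..]; split; first lra.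
  by rewrite mulr_le0//; lra.
have := @taylor_right f m (- x) (- y) B.
rewrite lerN2 => /(_ yx).
have -> : f 0%N (- y) = g 0%N y by rewrite /f expr0 mul1r opprK.
have -> : - y - - x = `|y - x| by rewrite ler0_norm ?subr_le0//; lra.
have -> : \sum_(k < m) f k (- x) * `|y - x| ^+ k / k`!%:R =
    \sum_(k < m) g k x * (y - x) ^+ k / k`!%:R.
  apply: eq_bigr => k _; congr (_ / _); rewrite /f opprK ler0_norm ?subr_le0//.
  rewrite [in RHS](_ : y - x = -1 * - (y - x)); last by ring.
  by rewrite exprMn; ring.
apply=> [i z im|z] /h[h1 h2].
  have hd : is_derive z 1 (fun z => - z) (-1 : R).
    exact: is_derive1N (is_derive1_id z).
  have := is_derive1Z ((-1) ^+ i) (is_derive1_compose (gd _ _ im h1 h2) hd).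
  by move=> h3; apply: (is_derive_eq h3); rewrite /f exprS; ring.
by rewrite /f normrM normrX normrN1 expr1n mul1r; exact: gB.
Qed.

Definition cos_derivs (t c : R) (i : nat) (y : R) : R :=
  t ^+ i * cos (t * y + c + i%:R * (pi / 2)).

Lemma is_derive1_cos_derivs t c i y :
  is_derive y 1 (cos_derivs t c i) (cos_derivs t c i.+1 y).
Proof.
have h1 : is_derive y 1 (fun y => t * y + c + i%:R * (pi / 2)) (t * 1 + 0 + 0).
  exact: (is_derive1D (is_derive1D (is_derive1Z t (is_derive1_id y))
    (is_derive1_cst y c)) (is_derive1_cst y _)).
have h := is_derive1Z (t ^+ i) (is_derive1_compose (is_derive_cos _) h1).
apply: (is_derive_eq h).
rewrite /cos_derivs.
have -> : t * y + c + i.+1%:R * (pi / 2) = t * y + c + i%:R * (pi / 2) + pi / 2.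
  by rewrite -[i.+1%:R]natr1; ring.
by rewrite cosDpihalf exprS; ring.
Qed.

Lemma cos_taylor t c K y :
  `|cos (t * y + c) - \sum_(k < K) cos_derivs t c k 0 * y ^+ k / k`!%:R| <=
  `|t| ^+ K * `|y| ^+ K / K`!%:R.
Proof.
have := @taylor_bound (cos_derivs t c) K 0 y (`|t| ^+ K).
rewrite subr0 /cos_derivs expr0 mul1r mul0r addr0; apply.
  by move=> i z _ _ _; exact: is_derive1_cos_derivs.
move=> z _ _; rewrite normrM normrX ler_piMr ?exprn_ge0//; exact: cos_max.
Qed.

End Taylor.

Section StepPolynomial.
Context (R : realType).

Lemma bernoulli_ineq (v : R) N : v <= 1 -> 1 - N%:R * v <= (1 - v) ^+ N.
Proof.
move=> v1; have [v0|/ltW v0] := leP 0 v; last first.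
  elim: N => [|N IHN]; first by rewrite mul0r subr0 expr0.
  rewrite exprS -natr1; apply: (le_trans _ (ler_wpM2l _ IHN)); last lra.
  have : 0 <= N%:R * v ^+ 2 by rewrite mulr_ge0// sqr_ge0.
  by move=> h; rewrite -subr_ge0 (le_trans h)// le_eqVlt; apply/orP; left; apply/eqP; ring.
elim: N => [|N IHN]; first by rewrite mul0r subr0 expr0.
rewrite exprS -natr1; apply: (le_trans _ (ler_wpM2l _ IHN)); last lra.
have : 0 <= N%:R * v ^+ 2 by rewrite mulr_ge0// sqr_ge0.
by move=> h; rewrite -subr_ge0 (le_trans h)// le_eqVlt; apply/orP; left; apply/eqP; ring.
Qed.

(* Bernoulli's inequality applied to (1 - u^m)^(2^m), as in Brosowski and
   Deutsch's proof of the Stone-Weierstrass theorem. *)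
Lemma step_polynomial (sig eps : R) : 0 < sig -> sig <= 1 / 2 -> 0 < eps ->
  exists m : nat, forall u : R, 0 <= u <= 1 ->
    [/\ 0 <= (1 - u ^+ m) ^+ (2 ^ m) <= 1,
        u <= 1 / 2 - sig -> 1 - eps <= (1 - u ^+ m) ^+ (2 ^ m) &
        1 / 2 + sig <= u -> (1 - u ^+ m) ^+ (2 ^ m) <= eps].
Proof.
move=> s0 s1 e0.
(* The exponent 2^m makes 2^m u^m = (2u)^m. Below 1/2 - sig this is at most z1^m, and Bernoulli
   bounds the loss. Above 1/2 + sig it is at least z2^(-m), and (1 - v)^N (1 + N v) <= (1 - v^2)^N
   <= 1 bounds the value by z2^m. *)
pose z1 : R := 1 - 2 * sig; pose z2 : R := (1 + 2 * sig)^-1.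
have z20 : 0 < z2 by rewrite invr_gt0; lra.
have z1n : `|z1| < 1 by rewrite ger0_norm /z1; lra.
have z2n : `|z2| < 1 by rewrite gtr0_norm// invf_lt1; lra.
have [m [m1 m2]] : exists m : nat, z1 ^+ m < eps /\ z2 ^+ m < eps.
  have c1 := cvg_expr z1n; have c2 := cvg_expr z2n.
  have e1 : \forall m \near \oo, z1 ^+ m < eps by apply: (cvgr_lt _ c1).
  have e2 : \forall m \near \oo, z2 ^+ m < eps by apply: (cvgr_lt _ c2).
  by have [N _ /(_ N (leqnn _))] := filterI e1 e2; exists N.
exists m => u /andP[u0 u1].
have v0 : 0 <= u ^+ m by rewrite exprn_ge0.
have v1 : u ^+ m <= 1 by rewrite exprn_ile1.
split.
- by rewrite exprn_ge0 ?subr_ge0//= exprn_ile1 ?subr_ge0//; lra.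
- move=> us; apply: le_trans (bernoulli_ineq _ v1).
  have : (2 ^ m)%:R * u ^+ m <= z1 ^+ m.
    rewrite natrX -exprMn; apply: lerXn2r; rewrite ?nnegrE; rewrite /z1; lra.
  lra.
- move=> us; apply: (@le_trans _ _ (z2 ^+ m)); last exact: ltW.
  have h1 : 1 + (2 ^ m)%:R * u ^+ m <= (1 + u ^+ m) ^+ (2 ^ m).
    have := @bernoulli_ineq (- u ^+ m) (2 ^ m).
    by rewrite opprK mulrN opprK; apply; lra.
  have h2 : (1 + 2 * sig) ^+ m <= (2 ^ m)%:R * u ^+ m.
    rewrite natrX -exprMn; apply: lerXn2r; rewrite ?nnegrE; lra.
  have p0 : 0 < (1 + 2 * sig) ^+ m by rewrite exprn_gt0//; lra.
  rewrite /z2 exprVn -[leRHS]mul1r ler_pdivlMr//.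
  apply: (@le_trans _ _ ((1 - u ^+ m) ^+ (2 ^ m) * (1 + u ^+ m) ^+ (2 ^ m))).
    by rewrite ler_wpM2l ?exprn_ge0 ?subr_ge0//; lra.
  rewrite -exprMn exprn_ile1//; first by rewrite mulr_ge0//; lra.
  have := sqr_ge0 (u ^+ m); set v := u ^+ m; nra.
Qed.

(** A trigonometric polynomial close to the indicator of y <= x on the window |y - x| < A, except
    within [eta] of [x]. Periodicity spoils the approximation outside the window, where the term (y
    - x)^2 / A^2 >= 1 pays for it; its mean is controlled as in Chebyshev's inequality. *)
Lemma trig_step (x eta eps A : R) : 0 < eta -> 0 < eps -> eta <= A ->
  exists (q : {poly R}) (t c : R), forall y : R,
    [/\ 0 <= q.[cos (t * y + c)] <= 1,
        (y <= x - eta)%R%:R <= q.[cos (t * y + c)] + eps + (y - x) ^+ 2 / A ^+ 2 &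
        q.[cos (t * y + c)] <= (y <= x + eta)%R%:R + eps + (y - x) ^+ 2 / A ^+ 2].
Proof.
move=> h0 e0 hA; have A0 : 0 < A by apply: lt_le_trans hA.
pose t := pi / 2 / A.
have t0 : 0 < t by rewrite !divr_gt0 ?pi_gt0.
have tA : t * A = pi / 2 by rewrite /t divfK ?gt_eqF.
have th : 0 < t * eta <= pi / 2 by rewrite mulr_gt0//= -tA ler_pM2l.
have p2 : 0 < (pi : R) / 2 by rewrite divr_gt0 ?pi_gt0.
have sinm (u v : R) : - (pi / 2) <= u <= pi / 2 -> - (pi / 2) <= v <= pi / 2 ->
    u <= v -> sin u <= sin v.
  move=> hu hv; rewrite le_eqVlt => /predU1P[->//|uv].
  by apply/ltW; rewrite ltr_sin// in_itv/=.
(* For u = (1 + sin (t (y - x))) / 2 this is the distance from u to 1/2 at |y - x| = eta; since t A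
   = pi / 2, the sine is increasing on the window. *)
pose sig := sin (t * eta) / 2.
have s0 : 0 < sig.
  rewrite divr_gt0// sin_gt0_pi//; move: th => /andP[-> h]; rewrite /=; lra.
have s1 : sig <= 1 / 2 by have := sin_le1 (t * eta); rewrite /sig; lra.
have [m hm] := step_polynomial s0 s1 e0.
exists ((1 - (2^-1 *: (1 + 'X)) ^+ m) ^+ (2 ^ m)), t, (- t * x - pi / 2) => y.
have -> : t * y + (- t * x - pi / 2) = t * (y - x) - pi / 2 by ring.
rewrite cosBpihalf.
set w := sin (t * (y - x)); pose u := 2^-1 * (1 + w).
have -> : ((1 - (2^-1 *: (1 + 'X)) ^+ m) ^+ (2 ^ m)).[w] = (1 - u ^+ m) ^+ (2 ^ m).
  by rewrite horner_exp !hornerE /u.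
have w1 : -1 <= w <= 1 by rewrite sin_geN1 sin_le1.
have u01 : 0 <= u <= 1 by rewrite /u; move: w1 => /andP[? ?]; apply/andP; split; lra.
have [g01 gl gr] := hm _ u01.
set g := (1 - u ^+ m) ^+ (2 ^ m) in g01 gl gr *.
have [[g0 g1] b0] : (0 <= g /\ g <= 1) /\ 0 <= (y - x) ^+ 2 / A ^+ 2.
  by split; [apply/andP|rewrite divr_ge0 ?sqr_ge0].
split=> //.
  have [yx|_] := leP y (x - eta); last by rewrite /=; lra.
  have [yA|yA] := leP A `|y - x|.
    have : 1 <= (y - x) ^+ 2 / A ^+ 2.
      rewrite ler_pdivlMr ?exprn_gt0// mul1r -[leRHS]real_normK ?num_real//.
      by apply: lerXn2r; rewrite ?nnegrE// ltW.
    by rewrite /=; lra.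
  have : u <= 1 / 2 - sig.
    suff : w <= - sin (t * eta) by rewrite /u /sig; lra.
    rewrite -sinN; apply: sinm.
    - move: yA; rewrite ltr_norml => /andP[y1 y2].
      by rewrite -tA -mulrN !ler_pM2l//; apply/andP; split; lra.
    - by move: th => /andP[? ?]; apply/andP; split; lra.
    - by rewrite -mulrN ler_pM2l//; lra.
  by move=> /gl; rewrite /=; lra.
have [_|yx] := leP y (x + eta); first by rewrite /=; lra.
have [yA|yA] := leP A `|y - x|.
  have : 1 <= (y - x) ^+ 2 / A ^+ 2.
    rewrite ler_pdivlMr ?exprn_gt0// mul1r -[leRHS]real_normK ?num_real//.
    by apply: lerXn2r; rewrite ?nnegrE// ltW.
  by rewrite /=; lra.
have : 1 / 2 + sig <= u.
  suff : sin (t * eta) <= w by rewrite /u /sig; lra.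
  apply: sinm.
  - by move: th => /andP[? ?]; apply/andP; split; lra.
  - move: yA; rewrite ltr_norml => /andP[y1 y2].
    by rewrite -tA -mulrN !ler_pM2l//; apply/andP; split; lra.
  - by rewrite ler_pM2l//; lra.
by move=> /gr; rewrite /=; lra.
Qed.

End StepPolynomial.

(** * The method of moments *)

Lemma cvg_sumr (R : realType) (I : Type) (s : seq I) (T : Type) (F : set_system T)
    (f : I -> T -> R) (l : I -> R) : Filter F ->
  (forall i, f i n @[n --> F] --> l i) ->
  \sum_(i <- s) f i n @[n --> F] --> \sum_(i <- s) l i.
Proof.
move=> FF fl; elim: s => [|i s IHs].
  by under eq_fun do rewrite big_nil; rewrite big_nil; exact: cvg_cst.
by under eq_fun do rewrite big_cons; rewrite big_cons; exact: cvgD.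
Qed.

Section MethodOfMoments.
Context d (T : measurableType d) (R : realType) (P : probability T R).
Context d' (T' : measurableType d') (Q : probability T' R).
Variables (F : nat -> T -> R) (N : T' -> R).
Hypothesis aF : forall n, all_moments P (F n).
Hypothesis aN : all_moments Q N.
Local Notation EP Z := (Rintegral P [set: T] Z).
Local Notation EQ Z := (Rintegral Q [set: T'] Z).
Hypothesis cvF : forall k,
  EP (fun w => F n w ^+ k) @[n --> \oo] --> EQ (fun w => N w ^+ k).
Hypothesis bN : forall k, EQ (fun w => N w ^+ (2 * k)) * k`!%:R <= (2 * k)`!%:R.

Lemma measurable_cos_affine (t c : R) d0 (T0 : measurableType d0) (Z : T0 -> R) :
  measurable_fun [set: T0] Z ->
  measurable_fun [set: T0] (fun w => cos (t * Z w + c)).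
Proof.
move=> mZ; apply: measurableT_comp.
  by apply: continuous_measurable_fun; exact: continuous_cos.
by apply: measurable_funD => //; exact: measurable_funM.
Qed.

Lemma all_moments_cos (t c : R) d0 (T0 : measurableType d0) (P0 : probability T0 R)
    (Z : T0 -> R) : all_moments P0 Z -> all_moments P0 (fun w => cos (t * Z w + c)).
Proof.
move=> [mZ _]; apply: (@all_moments_bounded _ _ _ _ _ 1); first exact: measurable_cos_affine.
by move=> w; exact: cos_max.
Qed.

(** The order is even so that the remainder is a moment of [Z] without absolute value. *)
Lemma mean_cos_taylor (t c : R) K d0 (T0 : measurableType d0) (P0 : probability T0 R)
    (Z : T0 -> R) : all_moments P0 Z ->
  `|Rintegral P0 [set: T0] (fun w => cos (t * Z w + c)) -
    \sum_(k < 2 * K) (cos_derivs t c k 0 / k`!%:R) *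
      Rintegral P0 [set: T0] (fun w => Z w ^+ k)| <=
  t ^+ (2 * K) / (2 * K)`!%:R * Rintegral P0 [set: T0] (fun w => Z w ^+ (2 * K)).
Proof.
move=> aZ; have aX k := all_momentsX k aZ; have ac := all_moments_cos t c aZ.
have asum : all_moments P0 (fun w => \sum_(k < 2 * K) (cos_derivs t c k 0 / k`!%:R) * Z w ^+ k).
  by apply: all_moments_sum => k; exact: all_momentsZ.
under eq_bigr do rewrite -meanZ//.
rewrite -mean_sum; last by move=> k; exact: all_momentsZ.
rewrite -meanB// -meanZ//.
apply: le_trans; first by apply: mean_norm; exact: all_momentsB.
apply: mean_le; [exact/all_moments_norm/all_momentsB|exact: all_momentsZ|].
move=> w; have := cos_taylor t c (2 * K) (Z w).
under eq_bigr do rewrite mulrAC.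
rewrite !exprM !real_normK ?num_real// -!exprM => h; apply: (le_trans h).
by rewrite mulrAC.
Qed.

(** By [bN] the Taylor remainder of order 2K for the limit is at most t^(2K) / K!, which is small
    for some [K]. For this fixed [K] the remainder for [F n] and the Taylor polynomials involve
    finitely many moments, which converge. *)
Lemma cvg_mean_cos (t c : R) :
  EP (fun w => cos (t * F n w + c)) @[n --> \oo] --> EQ (fun w => cos (t * N w + c)).
Proof.
apply/cvgrPdist_lt => e e0.
have [K hK] : exists K, t ^+ (2 * K) / K`!%:R < e / 4.
  have := @cvg_exp_coeff R (t ^+ 2) => h.
  have : \forall n \near \oo, exp_coeff (t ^+ 2) n < e / 4.
    by apply: (cvgr_lt _ h); lra.
  move=> [K _ /(_ K (leqnn _))]; rewrite /exp_coeff /= -exprM => h2.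
  by exists K.
pose a k := cos_derivs t c k 0 / k`!%:R.
pose r : R := t ^+ (2 * K) / (2 * K)`!%:R.
have r0 : 0 <= r by rewrite divr_ge0// exprM exprn_ge0// sqr_ge0.
have rN : r * EQ (fun w => N w ^+ (2 * K)) < e / 4.
  apply: le_lt_trans hK; rewrite /r -mulrA ler_wpM2l//.
    by rewrite exprM exprn_ge0// sqr_ge0.
  by rewrite ler_pdivrMl ?ltr0n ?fact_gt0// ler_pdivlMr ?ltr0n ?fact_gt0.
have c1 : \forall n \near \oo, r * EP (fun w => F n w ^+ (2 * K)) < e / 4.
  apply: (cvgr_lt (r * EQ (fun w => N w ^+ (2 * K)))) => //.
  by apply: cvgM; [exact: cvg_cst|exact: cvF].
have c2 : \forall n \near \oo,
    `|\sum_(k < 2 * K) a k * EQ (fun w => N w ^+ k) -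
      \sum_(k < 2 * K) a k * EP (fun w => F n w ^+ k)| < e / 4.
  apply: (@cvgr_dist_lt _ _ _ _ _
    (fun n => \sum_(k < 2 * K) a k * EP (fun w => F n w ^+ k))); last lra.
  apply: cvg_sumr => k.
  by apply: cvgM; [exact: cvg_cst|exact: cvF].
near=> n.
have h1 := @mean_cos_taylor t c K _ _ P _ (aF n).
have h2 := @mean_cos_taylor t c K _ _ Q _ aN.
have h3 : r * EP (fun w => F n w ^+ (2 * K)) < e / 4 by near: n.
have h4 : `|\sum_(k < 2 * K) a k * EQ (fun w => N w ^+ k) -
      \sum_(k < 2 * K) a k * EP (fun w => F n w ^+ k)| < e / 4 by near: n.
move: h1 h2 h3 h4 rN; rewrite -/r.
set x1 := EP _; set x2 := EQ _; set s1 := \sum_(k < _) _; set s2 := \sum_(k < _) _.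
set u1 := _ * EP _; set u2 := _ * EQ _ => h1 h2 h3 h4 rN.
have -> : x2 - x1 = (x2 - s2) + (s2 - s1) - (x1 - s1) by ring.
apply: (le_lt_trans (ler_normB _ _)).
apply: (@le_lt_trans _ _ (`|x2 - s2| + `|s2 - s1| + `|x1 - s1|)).
  by rewrite lerD2r ler_normD.
lra.
Unshelve. all: by end_near. Qed.

(** The extra factor cos (u th) closes the induction: cos th cos (u th) is the half-sum of cos ((u +
    1) th) and cos ((u - 1) th). Powers of the cosine are the case [u = 0]. *)
Lemma cvg_mean_cosX (t c : R) k (u : R) :
  EP (fun w => cos (t * F n w + c) ^+ k * cos (u * (t * F n w + c))) @[n --> \oo] -->
  EQ (fun w => cos (t * N w + c) ^+ k * cos (u * (t * N w + c))).
Proof.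
elim: k u => [|k IHk] u.
  have e d0 (T0 : measurableType d0) (P0 : probability T0 R) (Z : T0 -> R) :
      Rintegral P0 setT (fun w => cos (t * Z w + c) ^+ 0 * cos (u * (t * Z w + c))) =
      Rintegral P0 setT (fun w => cos ((u * t) * Z w + u * c)).
    by congr Rintegral; apply/funext => w; rewrite expr0 mul1r; congr cos; ring.
  rewrite e (_ : (fun n => _) = (fun n => EP (fun w => cos (u * t * F n w + u * c)))).
    exact: cvg_mean_cos.
  by apply/funext => n; exact: e.
have e d0 (T0 : measurableType d0) (P0 : probability T0 R) (Z : T0 -> R) : all_moments P0 Z ->
    Rintegral P0 setT (fun w => cos (t * Z w + c) ^+ k.+1 * cos (u * (t * Z w + c))) =
    2^-1 * Rintegral P0 setT (fun w => cos (t * Z w + c) ^+ k * cos ((u + 1) * (t * Z w + c))) +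
    2^-1 * Rintegral P0 setT (fun w => cos (t * Z w + c) ^+ k * cos ((u - 1) * (t * Z w + c))).
  move=> aZ.
  have h v : all_moments P0 (fun w => cos (t * Z w + c) ^+ k * cos (v * (t * Z w + c))).
    apply: all_momentsM; first exact/all_momentsX/all_moments_cos.
    have := all_moments_cos (v * t) (v * c) aZ.
    by congr all_moments; apply/funext => w; congr cos; ring.
  rewrite -!meanZ// -meanD; [|exact: all_momentsZ..].
  congr Rintegral; apply/funext => w; move: (t * Z w + c) => th.
  by rewrite mulrDl mulrBl mul1r cosD cosB exprS; field.
rewrite e// (_ : (fun n => _) = (fun n =>
    2^-1 * EP (fun w => cos (t * F n w + c) ^+ k * cos ((u + 1) * (t * F n w + c))) +
    2^-1 * EP (fun w => cos (t * F n w + c) ^+ k * cos ((u - 1) * (t * F n w + c))))).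
  by apply: cvgD; (apply: cvgM; [exact: cvg_cst|exact: IHk]).
by apply/funext => n; exact: e.
Qed.

Lemma all_moments_trig (q : {poly R}) (t c : R) d0 (T0 : measurableType d0)
  (P0 : probability T0 R) (Z : T0 -> R) : all_moments P0 Z ->
  all_moments P0 (fun w => q.[cos (t * Z w + c)]).
Proof.
move=> aZ; under eq_fun do rewrite horner_coef.
apply: all_moments_sum => i; exact/all_momentsZ/all_momentsX/all_moments_cos.
Qed.

Lemma cvg_mean_trig (q : {poly R}) (t c : R) :
  EP (fun w => q.[cos (t * F n w + c)]) @[n --> \oo] --> EQ (fun w => q.[cos (t * N w + c)]).
Proof.
have e d0 (T0 : measurableType d0) (P0 : probability T0 R) (Z : T0 -> R) : all_moments P0 Z ->
    Rintegral P0 setT (fun w => q.[cos (t * Z w + c)]) =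
    \sum_(i < size q) q`_i *
      Rintegral P0 setT (fun w => cos (t * Z w + c) ^+ i * cos (0 * (t * Z w + c))).
  move=> aZ.
  under eq_fun do rewrite horner_coef.
  rewrite mean_sum; last by move=> i; exact/all_momentsZ/all_momentsX/all_moments_cos.
  apply: eq_bigr => i _; rewrite meanZ; last exact/all_momentsX/all_moments_cos.
  congr (_ * _); congr Rintegral; apply/funext => w.
  by rewrite mul0r cos0 mulr1.
rewrite e// (_ : (fun n => _) = (fun n => \sum_(i < size q) q`_i *
      EP (fun w => cos (t * F n w + c) ^+ i * cos (0 * (t * F n w + c))))).
  apply: cvg_sumr => i; apply: cvgM; first exact: cvg_cst.
  exact: cvg_mean_cosX.
by apply/funext => n; exact: e.
Qed.

Lemma all_moments_sqr_dist (x : R) d0 (T0 : measurableType d0)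
  (P0 : probability T0 R) (Z : T0 -> R) : all_moments P0 Z ->
  all_moments P0 (fun w => (Z w - x) ^+ 2).
Proof. by move=> aZ; apply/all_momentsX/all_momentsB => //; exact: all_moments_cst. Qed.

Lemma mean_sqr_dist (x : R) d0 (T0 : measurableType d0)
  (P0 : probability T0 R) (Z : T0 -> R) : all_moments P0 Z ->
  Rintegral P0 setT (fun w => (Z w - x) ^+ 2) =
  Rintegral P0 setT (fun w => Z w ^+ 2) - 2 * x * Rintegral P0 setT (fun w => Z w ^+ 1) + x ^+ 2.
Proof.
move=> aZ; have aX k := all_momentsX k aZ.
rewrite -meanZ// -meanB//; last exact: all_momentsZ.
rewrite -[X in _ = _ + X](@mean_cst _ _ _ P0) -meanD; last exact: all_moments_cst.
  by congr Rintegral; apply/funext => w; ring.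
by apply: all_momentsB => //; exact: all_momentsZ.
Qed.

Lemma cvg_mean_sqr_dist (x : R) :
  EP (fun w => (F n w - x) ^+ 2) @[n --> \oo] --> EQ (fun w => (N w - x) ^+ 2).
Proof.
rewrite mean_sqr_dist// (_ : (fun n => _) = (fun n =>
   EP (fun w => F n w ^+ 2) - 2 * x * EP (fun w => F n w ^+ 1) + x ^+ 2)).
  apply: cvgD; last exact: cvg_cst.
  apply: cvgB; first exact: cvF.
  by apply: cvgM; [exact: cvg_cst|exact: cvF].
by apply/funext => n; exact: mean_sqr_dist.
Qed.

Lemma mean_le_indic d0 (T0 : measurableType d0) (P0 : probability T0 R)
    (Y : T0 -> R) (x : R) : measurable_fun setT Y ->
  all_moments P0 (fun w => (Y w <= x)%R%:R : R) /\
  Rintegral P0 setT (fun w => (Y w <= x)%R%:R : R) = fine (P0 [set w | Y w <= x]).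
Proof.
move=> mY.
have mS : measurable [set w | Y w <= x].
  have := mY measurableT `]-oo, x]%classic (measurable_itv _); rewrite setTI.
  by congr measurable; apply/seteqP; split => w /=; rewrite in_itv.
have -> : (fun w => (Y w <= x)%R%:R : R) = \1_[set w | Y w <= x].
  by apply/funext => w; rewrite indicE mem_setE.
by split; [exact: all_moments_indic|exact: mean_indic].
Qed.

(** Steps centered at [x + eta / 2] and [x - eta / 2], each with margin [eta / 2], lie up to small
    errors between the indicators of the half-lines to be compared. Each inequality collects five
    errors of [eps / 8]: two from the steps, two from the quadratic terms and one from the
    convergence of means. *)
Lemma moments_cvg_half_line (x eta eps : R) : 0 < eta -> 0 < eps ->
  \forall n \near \oo,
    fine (P [set w | F n w <= x]) <= fine (Q [set w | N w <= x + eta]) + eps /\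
    fine (Q [set w | N w <= x - eta]) - eps <= fine (P [set w | F n w <= x]).
Proof.
move=> eta0 eps0.
have aux (y : R) : exists A : R, eta / 2 <= A /\
    EQ (fun w => (N w - y) ^+ 2) / A ^+ 2 < eps / 8.
  pose v := EQ (fun w => (N w - y) ^+ 2).
  have v0 : 0 <= v by exact: mean_sqr_ge0.
  exists (eta / 2 + 1 + 8 * (v + 1) / eps).
  have p : 0 <= 8 * (v + 1) / eps by rewrite divr_ge0 ?ltW//; lra.
  split; first lra.
  set B := 8 * (v + 1) / eps in p *.
  have BE : eps * B = 8 * (v + 1) by rewrite /B mulrC divfK ?gt_eqF.
  have A1 : 1 + B <= eta / 2 + 1 + B by lra.
  set A := eta / 2 + 1 + B in A1 *.
  have A2 : B <= A ^+ 2.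
    have : (1 + B) ^+ 2 <= A ^+ 2 by apply: lerXn2r; rewrite ?nnegrE; lra.
    by apply: le_trans; have := sqr_ge0 B; lra.
  rewrite ltr_pdivrMr; last by rewrite exprn_gt0//; lra.
  have := ler_wpM2l (ltW eps0) A2; rewrite BE -/v; lra.
have e8 : 0 < eps / 8 by lra.
have h2 : 0 < eta / 2 by lra.
have [A [hA vA]] := aux (x + eta / 2).
have [B [hB vB]] := aux (x - eta / 2).
have [q1 [t1 [c1 H1]]] := trig_step (x + eta / 2) h2 e8 hA.
have [q2 [t2 [c2 H2]]] := trig_step (x - eta / 2) h2 e8 hB.
have A0 : 0 < A by lra. have B0 : 0 < B by lra.
have near1 : \forall n \near \oo,
    EP (fun w => q1.[cos (t1 * F n w + c1)]) < EQ (fun w => q1.[cos (t1 * N w + c1)]) + eps / 8.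
  by apply: (cvgr_lt _ (@cvg_mean_trig q1 t1 c1)); lra.
have near2 : \forall n \near \oo,
    EQ (fun w => q2.[cos (t2 * N w + c2)]) - eps / 8 < EP (fun w => q2.[cos (t2 * F n w + c2)]).
  by apply: (cvgr_gt _ (@cvg_mean_trig q2 t2 c2)); lra.
have near3 : \forall n \near \oo,
    EP (fun w => (F n w - (x + eta / 2)) ^+ 2) / A ^+ 2 < eps / 8.
  apply: (cvgr_lt (EQ (fun w => (N w - (x + eta / 2)) ^+ 2) / A ^+ 2)) => //.
  by apply: cvgM; [exact: cvg_mean_sqr_dist|exact: cvg_cst].
have near4 : \forall n \near \oo,
    EP (fun w => (F n w - (x - eta / 2)) ^+ 2) / B ^+ 2 < eps / 8.
  apply: (cvgr_lt (EQ (fun w => (N w - (x - eta / 2)) ^+ 2) / B ^+ 2)) => //.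
  by apply: cvgM; [exact: cvg_mean_sqr_dist|exact: cvg_cst].
have up d0 (T0 : measurableType d0) (P0 : probability T0 R) (Z : T0 -> R)
    (q : {poly R}) (t c y z : R) (D : R) : all_moments P0 Z ->
    (forall u, (u <= z)%R%:R <= q.[cos (t * u + c)] + eps / 8 + (u - y) ^+ 2 / D ^+ 2) ->
    fine (P0 [set w | Z w <= z]) <= Rintegral P0 setT (fun w => q.[cos (t * Z w + c)]) + eps / 8 +
      Rintegral P0 setT (fun w => (Z w - y) ^+ 2) / D ^+ 2.
  move=> aZ H.
  have [a1 <-] := @mean_le_indic _ _ P0 Z z aZ.1.
  have a2 := all_moments_trig q t c aZ.
  have a3 := all_moments_cst P0 (eps / 8).
  have a4 := all_momentsZ (D ^- 2) (all_moments_sqr_dist y aZ).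
  rewrite -[X in _ + X + _](@mean_cst _ _ _ P0) [X in _ + X]mulrC -meanZ;
    last exact: all_moments_sqr_dist.
  rewrite -meanD// -meanD//; last exact: all_momentsD.
  apply: mean_le => //; first by apply: all_momentsD => //; exact: all_momentsD.
  by move=> w; rewrite [D ^- 2 * _]mulrC; exact: H.
have lo d0 (T0 : measurableType d0) (P0 : probability T0 R) (Z : T0 -> R)
    (q : {poly R}) (t c y z : R) (D : R) : all_moments P0 Z ->
    (forall u, q.[cos (t * u + c)] <= (u <= z)%R%:R + eps / 8 + (u - y) ^+ 2 / D ^+ 2) ->
    Rintegral P0 setT (fun w => q.[cos (t * Z w + c)]) <= fine (P0 [set w | Z w <= z]) + eps / 8 +
      Rintegral P0 setT (fun w => (Z w - y) ^+ 2) / D ^+ 2.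
  move=> aZ H.
  have [a1 <-] := @mean_le_indic _ _ P0 Z z aZ.1.
  have a2 := all_moments_trig q t c aZ.
  have a3 := all_moments_cst P0 (eps / 8).
  have a4 := all_momentsZ (D ^- 2) (all_moments_sqr_dist y aZ).
  rewrite -[X in _ + X + _](@mean_cst _ _ _ P0) [X in _ + X]mulrC -meanZ;
    last exact: all_moments_sqr_dist.
  rewrite -meanD// -meanD//; last exact: all_momentsD.
  apply: mean_le => //; first by apply: all_momentsD => //; exact: all_momentsD.
  by move=> w; rewrite [D ^- 2 * _]mulrC; exact: H.
near=> n.
have n1 : EP (fun w => q1.[cos (t1 * F n w + c1)]) <
    EQ (fun w => q1.[cos (t1 * N w + c1)]) + eps / 8 by near: n.
have n2 : EQ (fun w => q2.[cos (t2 * N w + c2)]) - eps / 8 <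
    EP (fun w => q2.[cos (t2 * F n w + c2)]) by near: n.
have n3 : EP (fun w => (F n w - (x + eta / 2)) ^+ 2) / A ^+ 2 < eps / 8 by near: n.
have n4 : EP (fun w => (F n w - (x - eta / 2)) ^+ 2) / B ^+ 2 < eps / 8 by near: n.
have e1 : x + eta / 2 + eta / 2 = x + eta by field.
have e2 : x - eta / 2 - eta / 2 = x - eta by field.
split.
- have U := @up _ _ P (F n) q1 t1 c1 (x + eta / 2) x A (aF n).
  have L := @lo _ _ Q N q1 t1 c1 (x + eta / 2) (x + eta) A aN.
  have {}U := U (fun u => ltac:(by have [_ + _] := H1 u; rewrite addrK)).
  have {}L := L (fun u => ltac:(by have [_ _ +] := H1 u; rewrite e1)).
  lra.
- have U := @up _ _ Q N q2 t2 c2 (x - eta / 2) (x - eta) B aN.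
  have L := @lo _ _ P (F n) q2 t2 c2 (x - eta / 2) x B (aF n).
  have {}U := U (fun u => ltac:(by have [_ + _] := H2 u; rewrite e2)).
  have {}L := L (fun u => ltac:(by have [_ _ +] := H2 u; rewrite subrK)).
  lra.
Unshelve. all: by end_near. Qed.

End MethodOfMoments.

Fact norm_two_thirds_lt (R : realFieldType) (eta : R) : 0 < eta -> `|2 / 3 * eta| < eta.
Proof. by move=> eta0; rewrite ger0_norm; lra. Qed.

Fact dist_squeeze (R : realFieldType) (x y a b u v e : R) :
  `|x - a| <= e / 2 -> `|x - b| <= e / 2 ->
  y <= u -> u <= a + e / 2 -> b - e / 2 <= v -> v <= y -> `|x - y| <= e.
Proof.
rewrite !ler_norml => /andP[? ?] /andP[? ?] ? ? ? ?.
by apply/andP; split; lra.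
Qed.

(** * Moments of the standard normal law *)

Section StandardNormal.
Context (R : realType).

Definition std_normal : probability (measurableTypeR R) R := normal_prob (0 : R) 1.
Local Notation EN k := (Rintegral std_normal [set: measurableTypeR R] (fun x => x ^+ k)).

Let mpdf := measurable_normal_pdf (0 : R) 1.
Let pdf0 := normal_pdf_ge0 (0 : R) 1.
Let NE (A : set (measurableTypeR R)) : measurable A ->
  std_normal A = (\int[lebesgue_measure]_(x in A) (normal_pdf 0 1 x)%:E)%E.
Proof. by []. Qed.

Lemma all_moments_std_normal : all_moments std_normal (fun x : measurableTypeR R => x).
Proof.
split=> // k.
have ik : std_normal.-integrable [set: measurableTypeR R] (EFin \o (fun x : R => x ^+ k)).
  apply: (@integrable_density _ _ _ (@lebesgue_measure R) std_normal _ mpdf pdf0 NE) => //.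
  have := @integrable_normal_moment R 0 1 ltr01 k.
  by apply: eq_integrable => // x _; rewrite /= subr0.
have := integrable_norm ik.
by apply: eq_integrable => // w _; rewrite /= normrX.
Qed.

Lemma std_normal_momentE k :
  EN k = \int[lebesgue_measure]_x ((x - 0) ^+ k * normal_pdf (0 : R) 1 x).
Proof.
rewrite /Rintegral; congr fine.
rewrite (@integral_density _ _ _ (@lebesgue_measure R) std_normal _ mpdf pdf0 NE); last first.
  by apply: measurable_funX.
by apply: eq_integral => x _; rewrite subr0.
Qed.

Lemma std_normal_moment0 : EN 0 = 1.
Proof. by under eq_fun do rewrite expr0; exact: mean_cst. Qed.

Lemma std_normal_moment1 : EN 1 = 0.
Proof. by rewrite std_normal_momentE (@normal_moment_rec R 0 1 ltr01 0) mulr0 mul0r. Qed.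

Lemma std_normal_momentSS k : EN k.+2 = k.+1%:R * EN k.
Proof.
by rewrite !std_normal_momentE (@normal_moment_rec R 0 1 ltr01 k.+1) expr1n mul1r.
Qed.

(** The even moments are (2k)! / (2^k k!), well below the bound required for convergence of the
    Taylor series of the cosine in mean. *)
Lemma std_normal_moment_le k : EN (2 * k) * k`!%:R <= (2 * k)`!%:R.
Proof.
elim: k => [|k IHk]; first by rewrite muln0 std_normal_moment0 mul1r.
rewrite mulnS std_normal_momentSS !factS !natrM.
have -> : (2 * k).+1%:R * EN (2 * k) * (k.+1%:R * k`!%:R) =
  k.+1%:R * ((2 * k).+1%:R * (EN (2 * k) * k`!%:R)) by ring.
apply: ler_pM => //; last by rewrite ler_wpM2l.
  rewrite !mulr_ge0//; apply: Rintegral_ge0 => x _.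
  by rewrite exprM exprn_ge0// sqr_ge0.
by rewrite ler_nat; lia.
Qed.

End StandardNormal.

(** * Central limit theorem from the moment recurrence *)

Section CLT.
Context d (T : measurableType d) (R : realType) (P : probability T R).
Variables (F : nat -> T -> R) (b : nat -> R).
Hypothesis aF : forall n, all_moments P (F n).
Local Notation E Z := (Rintegral P [set: T] Z).
Hypothesis F1 : E (fun w => F n w ^+ 1) @[n --> \oo] --> (0 : R).
Hypothesis FSS : forall k,
  E (fun w => F n w ^+ k.+2) - k.+1%:R * E (fun w => F n w ^+ k) @[n --> \oo] --> (0 : R).
Hypothesis b0 : b @ \oo --> (0 : R).

Lemma cvg_normal_moments k :
  E (fun w => F n w ^+ k) @[n --> \oo] -->
  Rintegral (std_normal R) [set: measurableTypeR R] (fun x => x ^+ k).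
Proof.
suff: (E (fun w => F n w ^+ k) @[n --> \oo] -->
  Rintegral (std_normal R) [set: measurableTypeR R] (fun x => x ^+ k)) /\
  (E (fun w => F n w ^+ k.+1) @[n --> \oo] -->
  Rintegral (std_normal R) [set: measurableTypeR R] (fun x => x ^+ k.+1)) by case.
elim: k => [|k [IH1 IH2]].
  split; last by rewrite std_normal_moment1.
  rewrite std_normal_moment0; under eq_fun do under eq_fun do rewrite expr0.
  by under eq_fun do rewrite mean_cst; exact: cvg_cst.
split=> //; rewrite std_normal_momentSS.
rewrite -[X in _ --> X]add0r (_ : (fun n => _) = (fun n =>
  (E (fun w => F n w ^+ k.+2) - k.+1%:R * E (fun w => F n w ^+ k)) +
  k.+1%:R * E (fun w => F n w ^+ k))); last first.
  by apply/funext => n; rewrite subrK.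
by apply: cvgD => //; apply: cvgM => //; exact: cvg_cst.
Qed.

(** A Slutsky argument for the deterministic shift [b n]: it is absorbed by moving the threshold.
    The decomposition is asked only for large [n], since the standardization may degenerate
    before. *)
Lemma cvg_in_distribution_normal (Z : nat -> {RV P >-> R}) :
  (\forall n \near \oo, forall w, Z n w = F n w + b n) ->
  cvg_in_distribution Z (normal_prob 0 1).
Proof.
move=> ZE x cx.
pose Q := std_normal R; pose Phi y := fine (Q `]-oo, y]%classic).
have QE y : Q [set w : measurableTypeR R | (w : R) <= y] = (Phi y)%:E.
  rewrite /Phi fineK ?fin_num_measure//.
have Qfin y : (Q `]-oo, y]%classic) \is a fin_num by rewrite fin_num_measure.
have cPhi : {for x, continuous Phi}.
  by apply: fine_cvg; rewrite fineK.
have cdfE n : cdf (Z n) x = (fine (cdf (Z n) x))%:E.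
  by rewrite fineK// fin_num_measure.
rewrite -(fineK (Qfin x)) (_ : (fun n => _) = (fun n => (fine (cdf (Z n) x))%:E)); last first.
  by apply/funext => n; rewrite -cdfE.
apply: cvg_EFin; first by near=> n.
rewrite /comp /=.
apply/cvgrPdist_le => e e0.
have e2 : 0 < e / 2 by rewrite divr_gt0.
move/cvgrPdist_le : cPhi => /(_ _ e2) /nbhs_ballP[eta /= eta0 Heta].
have {}Heta y : `|x - y| < eta -> `|Phi x - Phi y| <= e / 2 by exact: Heta.
(* One third of [eta] for the shift [b n], one third for the comparison of half-lines: the
   thresholds stay within 2/3 eta of [x], where [Phi] varies by at most [e / 2]. *)
have eta3 : 0 < eta / 3 by rewrite divr_gt0.
have H1 := @moments_cvg_half_line _ _ _ P _ _ Q F _ aF (all_moments_std_normal R)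
  cvg_normal_moments (@std_normal_moment_le R) (x + eta / 3) _ _ eta3 e2.
have H2 := @moments_cvg_half_line _ _ _ P _ _ Q F _ aF (all_moments_std_normal R)
  cvg_normal_moments (@std_normal_moment_le R) (x - eta / 3) _ _ eta3 e2.
have Hb : \forall n \near \oo, `|b n| <= eta / 3.
  by move/cvgrPdist_le : b0 => /(_ _ eta3); under eq_near do rewrite sub0r normrN.
near=> n.
have [h1 _] : fine (P [set w | F n w <= x + eta / 3]) <=
     fine (Q [set w | w <= x + eta / 3 + eta / 3]) + e / 2 /\
   fine (Q [set w | w <= x + eta / 3 - eta / 3]) - e / 2 <=
     fine (P [set w | F n w <= x + eta / 3]) by near: n.
have [_ h2] : fine (P [set w | F n w <= x - eta / 3]) <=
     fine (Q [set w | w <= x - eta / 3 + eta / 3]) + e / 2 /\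
   fine (Q [set w | w <= x - eta / 3 - eta / 3]) - e / 2 <=
     fine (P [set w | F n w <= x - eta / 3]) by near: n.
have bn : `|b n| <= eta / 3 by near: n.
have Zn : forall w, Z n w = F n w + b n by near: n.
rewrite !QE /= in h1 h2.
have p1 : `|Phi x - Phi (x + eta / 3 + eta / 3)| <= e / 2.
  apply: Heta; rewrite (_ : x - _ = - (2 / 3 * eta)); last by field.
  by rewrite normrN; exact: norm_two_thirds_lt.
have p2 : `|Phi x - Phi (x - eta / 3 - eta / 3)| <= e / 2.
  apply: Heta; rewrite (_ : x - _ = 2 / 3 * eta); last by field.
  exact: norm_two_thirds_lt.
have mS y : measurable [set w | F n w <= y].
  have := (aF n).1 measurableT `]-oo, y]%classic (measurable_itv _); rewrite setTI.
  by congr measurable; apply/seteqP; split => w /=; rewrite in_itv.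
have mono (A B : set T) : measurable A -> measurable B -> A `<=` B ->
    fine (P A) <= fine (P B).
  move=> mA mB AB; apply: fine_le; rewrite ?fin_num_measure//.
  by apply: le_measure; rewrite ?inE.
have mZ : measurable [set w | F n w + b n <= x].
  have := mS (x - b n); congr measurable; apply/seteqP.
  by split => w /=; rewrite lerBrDr.
have cE : fine (cdf (Z n) x) = fine (P [set w | F n w + b n <= x]).
  rewrite /cdf /distribution /pushforward; congr (fine (P _)).
  by apply/seteqP; split => w /=; rewrite in_itv/= Zn.
rewrite cE.
move: bn; rewrite ler_norml => /andP[b1 b2].
have q1 : fine (P [set w | F n w + b n <= x]) <= fine (P [set w | F n w <= x + eta / 3]).
  by apply: mono => // w /=; rewrite -lerBrDr => /le_trans; apply; rewrite lerD2l lerNl.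
have q2 : fine (P [set w | F n w <= x - eta / 3]) <= fine (P [set w | F n w + b n <= x]).
  by apply: mono => // w /= h; rewrite -lerBrDr (le_trans h)// lerD2l lerN2.
rewrite -/(Phi x).
exact: (dist_squeeze p1 p2 q1 h1 h2 q2).
Unshelve. all: by end_near. Qed.

End CLT.

(** * Second-order differences *)

Section Differences.
Context (R : realType) (a : seq R).
Local Notation L := (size a).
Implicit Types (x y z dl B : R).

(** The finite difference attached to a^{2*}, that is the sum of a^{2*}_j f(x + j dl), unfolded into
    the double sum that defines a^{2*}. *)
Definition sdiff (f : R -> R) (x dl : R) : R :=
  \sum_(k < L) \sum_(l < L) a`_k * a`_l * f (x + (k%:R - l%:R) * dl).

Definition dmoment (m : nat) : R :=
  \sum_(k < L) \sum_(l < L) a`_k * a`_l * (k%:R - l%:R) ^+ m.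

Definition asum : R := \sum_(k < L) `|a`_k|.

Lemma dmomentE m : dmoment m =
  \sum_(i < m.+1) 'C(m, i)%:R * (-1) ^+ i * (moment a (m - i) * moment a i).
Proof.
rewrite /dmoment.
under eq_bigr => k _ do under eq_bigr => l _ do rewrite exprDn mulr_sumr.
under eq_bigr => k _ do rewrite exchange_big /=.
rewrite exchange_big /=; apply: eq_bigr => i _.
rewrite /moment big_distrlr /= mulr_sumr; apply: eq_bigr => k _.
rewrite mulr_sumr; apply: eq_bigr => l _.
rewrite -[_ *+ 'C(m, i)]mulr_natl (exprNn l%:R i).
by move: (k%:R ^+ (m - i)) (l%:R ^+ i) ((-1) ^+ i) ('C(m, i)%:R) => x y z u; ring.
Qed.

Variable M : nat.
Hypothesis aM : is_order a M.

(** The sequence a^{2*} has order 2M: by the binomial formula its moment of order m is a combination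
    of products of moments of orders i and m - i, one of which is below M. *)
Lemma dmoment_eq0 m : (m < 2 * M)%N -> dmoment m = 0.
Proof.
move=> mM; rewrite dmomentE; apply: big1 => i _; case: aM => h _.
have [iM|Mi] := ltnP i M; first by rewrite (h i)// !mulr0.
by rewrite (h (m - i)%N) ?mul0r ?mulr0//; have := ltn_ord i; lia.
Qed.

(** In degree 2M the single surviving product is the square of the moment of order M. *)
Lemma dmoment_neq0 : dmoment (2 * M) != 0.
Proof.
have hM : (M < (2 * M).+1)%N by lia.
rewrite dmomentE (bigD1 (Ordinal hM))//= big1 => [|i /eqP iM]; last first.
  case: aM => h _; have [iM'|Mi] := ltnP i M; first by rewrite (h i)// !mulr0.
  rewrite (h (2 * M - i)%N) ?mul0r ?mulr0//.
  have : i <> M :> nat by move=> e; apply: iM; exact: val_inj.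
  by have := ltn_ord i; lia.
rewrite addr0 (_ : (2 * M - M)%N = M); last by lia.
by rewrite !mulf_neq0 ?aM.2// ?signr_eq0// pnatr_eq0 -lt0n bin_gt0; lia.
Qed.

Lemma eq_sdiff (f g : R -> R) x dl :
  (forall k l, (k < L)%N -> (l < L)%N ->
     f (x + (k%:R - l%:R) * dl) = g (x + (k%:R - l%:R) * dl)) ->
  sdiff f x dl = sdiff g x dl.
Proof.
by move=> fg; apply: eq_bigr => k _; apply: eq_bigr => l _; rewrite fg.
Qed.

Lemma sdiffD (f g : R -> R) x dl :
  sdiff (fun y => f y + g y) x dl = sdiff f x dl + sdiff g x dl.
Proof.
rewrite /sdiff -big_split; apply: eq_bigr => k _; rewrite -big_split.
by apply: eq_bigr => l _; rewrite mulrDr.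
Qed.

Lemma sdiffZ (c : R) (f : R -> R) x dl : sdiff (fun y => c * f y) x dl = c * sdiff f x dl.
Proof.
rewrite /sdiff mulr_sumr; apply: eq_bigr => k _; rewrite mulr_sumr.
by apply: eq_bigr => l _; rewrite mulrCA.
Qed.

Lemma sdiff_sum (I : Type) (s : seq I) (f : I -> R -> R) x dl :
  sdiff (fun y => \sum_(i <- s) f i y) x dl = \sum_(i <- s) sdiff (f i) x dl.
Proof.
elim: s => [|i s IHs].
  rewrite big_nil /sdiff big1// => k _; rewrite big1// => l _.
  by rewrite big_nil mulr0.
rewrite big_cons -IHs -sdiffD.
by apply: eq_sdiff => k l _ _; rewrite big_cons.
Qed.

Lemma sdiff_monomial i x dl : (i < 2 * M)%N -> sdiff (fun y => y ^+ i) x dl = 0.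
Proof.
move=> iM; rewrite /sdiff.
under eq_bigr => k _ do under eq_bigr => l _ do rewrite exprDn mulr_sumr.
under eq_bigr => k _ do rewrite exchange_big /=.
rewrite exchange_big /= big1// => j _.
transitivity (x ^+ (i - j) * dl ^+ j *+ 'C(i, j) * dmoment j); last first.
  by rewrite dmoment_eq0 ?mulr0//; have := ltn_ord j; lia.
rewrite /dmoment mulr_sumr; apply: eq_bigr => k _.
rewrite mulr_sumr; apply: eq_bigr => l _.
rewrite exprMn -[X in _ * X = _]mulr_natl -[X in _ = X * _]mulr_natl.
by move: (x ^+ (i - j)) (dl ^+ j) ('C(i, j)%:R) (_ ^+ j) => u v w z; ring.
Qed.

Lemma sdiff_le (f : R -> R) x dl B :
  (forall k l, (k < L)%N -> (l < L)%N -> `|f (x + (k%:R - l%:R) * dl)| <= B) ->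
  `|sdiff f x dl| <= asum ^+ 2 * B.
Proof.
move=> fB; rewrite expr2 /asum big_distrlr /= mulr_suml.
apply: le_trans (ler_norm_sum _ _ _) _; apply: ler_sum => k _.
rewrite mulr_suml; apply: le_trans (ler_norm_sum _ _ _) _; apply: ler_sum => l _.
by rewrite !normrM ler_wpM2l ?mulr_ge0//; exact: fB.
Qed.

Lemma dist_natr_le k l : (k < L)%N -> (l < L)%N -> `|k%:R - l%:R| <= L.-1%:R :> R.
Proof.
move=> kL lL; rewrite ler_norml; apply/andP; split.
  by rewrite -subr_ge0 opprK addrAC -natrD -natrB ?ler0n//; lia.
by rewrite lerBlDr -natrD ler_nat; lia.
Qed.

Lemma sdiff_taylor (g : nat -> R -> R) q x dl B : 0 < dl ->
  (forall i z, (i < q)%N -> `|z - x| <= L.-1%:R * dl -> is_derive z 1 (g i) (g i.+1 z)) ->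
  (forall z, `|z - x| <= L.-1%:R * dl -> `|g q z| <= B) ->
  `|sdiff (g 0%N) x dl - \sum_(i < q) g i x * dl ^+ i / i`!%:R * dmoment i| <=
  asum ^+ 2 * (B * (L.-1%:R * dl) ^+ q / q`!%:R).
Proof.
move=> dl0 gd gB.
have -> : \sum_(i < q) g i x * dl ^+ i / i`!%:R * dmoment i =
    sdiff (fun y => \sum_(i < q) g i x * (y - x) ^+ i / i`!%:R) x dl.
  rewrite sdiff_sum; apply: eq_bigr => i _.
  rewrite /dmoment /sdiff mulr_sumr; apply: eq_bigr => k _.
  rewrite mulr_sumr; apply: eq_bigr => l _.
  rewrite (_ : x + _ - x = (k%:R - l%:R) * dl); last by ring.
  by rewrite exprMn; move: (dl ^+ i) (_ ^+ i) (_^-1) => u v w; ring.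
rewrite -mulN1r -sdiffZ -sdiffD; apply: sdiff_le => k l kL lL.
rewrite mulN1r.
set y := x + _.
have yx : `|y - x| <= L.-1%:R * dl.
  rewrite /y addrC addKr normrM (gtr0_norm dl0) ler_pM2r//.
  exact: dist_natr_le.
apply: le_trans (@taylor_bound _ g q x y B _ _) _.
- by move=> i z iq zy _; apply: gd => //; exact: le_trans zy _.
- by move=> z zy _; apply: gB; exact: le_trans zy _.
have B0 : 0 <= B by apply: le_trans (gB y yx).
rewrite ler_wpM2r ?invr_ge0// ler_wpM2l//.
by apply: lerXn2r; rewrite ?nnegrE// mulr_ge0// ltW.
Qed.

Lemma sdiff_taylor_le (g : nat -> R -> R) q x dl B : 0 < dl -> (q <= 2 * M)%N ->
  (forall i z, (i < q)%N -> `|z - x| <= L.-1%:R * dl -> is_derive z 1 (g i) (g i.+1 z)) ->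
  (forall z, `|z - x| <= L.-1%:R * dl -> `|g q z| <= B) ->
  `|sdiff (g 0%N) x dl| <= asum ^+ 2 * (B * (L.-1%:R * dl) ^+ q / q`!%:R).
Proof.
move=> dl0 qM gd gB; have := sdiff_taylor dl0 gd gB.
rewrite big1 ?subr0// => i _.
by rewrite dmoment_eq0 ?mulr0// (leq_trans (ltn_ord i)).
Qed.

Lemma sdiff_scale_pow (p x dl : R) : 0 <= dl ->
  sdiff (fun y => `|y| `^ p) (x * dl) dl = dl `^ p * sdiff (fun y => `|y| `^ p) x 1.
Proof.
move=> dl0; rewrite /sdiff mulr_sumr; apply: eq_bigr => k _.
rewrite mulr_sumr; apply: eq_bigr => l _.
rewrite mulr1 -mulrDl normrM (ger0_norm dl0) powRM//; ring.
Qed.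

End Differences.

(** * Derivatives of the power function |z|^p *)

Section PowerFamily.
Context (R : realType) (p : R).

Implicit Types (x y z : R).

Definition ffactr (i : nat) : R := \prod_(j < i) (p - j%:R).

Lemma ffactrS i : ffactr i.+1 = ffactr i * (p - i%:R).
Proof. by rewrite /ffactr big_ord_recr. Qed.

(** The i-th derivative of |z|^p, with the falling factorial of [p] as coefficient; the power of the
    sign covers both half-lines in one formula. *)
Definition sgpow (i : nat) (z : R) : R := ffactr i * (Num.sg z ^+ i * `|z| `^ (p - i%:R)).

Lemma is_derive1_powR_pos (q z : R) : 0 < z ->
  is_derive z 1 (fun y => y `^ q) (q * z `^ (q - 1)).
Proof. by move=> z0; exact: is_derive1_powR. Qed.

Lemma near_eq_is_derive1 (f g : R -> R) (x df : R) :
  (\forall y \near x, f y = g y) -> is_derive x 1 f df -> is_derive x 1 g df.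
Proof. exact: near_eq_is_derive. Qed.

Lemma is_derive1_sgpow_pos i z : 0 < z -> is_derive z 1 (sgpow i) (sgpow i.+1 z).
Proof.
move=> z0.
have h := is_derive1Z (ffactr i) (@is_derive1_powR_pos (p - i%:R) z z0).
have : is_derive z 1 (fun y => ffactr i * y `^ (p - i%:R)) (sgpow i.+1 z).
  apply: (is_derive_eq h); rewrite /sgpow ffactrS gtr0_sg// gtr0_norm// expr1n mul1r.
  by rewrite -natr1 opprD addrA -mulrA.
apply: near_eq_is_derive1.
near=> y; have y0 : 0 < y by near: y; exact: lt_nbhsr.
by rewrite /sgpow gtr0_sg// gtr0_norm// expr1n mul1r.
Unshelve. all: by end_near. Qed.

Lemma sgpowN i z : sgpow i (- z) = (-1) ^+ i * sgpow i z.
Proof. by rewrite /sgpow sgrN normrN -[- Num.sg z]mulN1r exprMn; ring. Qed.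

Lemma is_derive1_sgpow_neg i z : z < 0 -> is_derive z 1 (sgpow i) (sgpow i.+1 z).
Proof.
move=> z0.
have z1 : 0 < - z by rewrite oppr_gt0.
have h := is_derive1Z ((-1) ^+ i) (is_derive1_compose (is_derive1_sgpow_pos i z1)
  (is_derive1N (is_derive1_id z))).
have -> : sgpow i = (fun y => (-1) ^+ i * sgpow i (- y)).
  by apply/funext => y; rewrite sgpowN mulrA -expr2 sqrr_sign mul1r.
apply: (is_derive_eq h); rewrite sgpowN exprS.
have := sqrr_sign R i; rewrite expr2 => e.
rewrite [RHS](_ : _ = (-1) ^+ i * (-1) ^+ i * sgpow i.+1 z); last by rewrite e mul1r.
by ring.
Qed.

(** Caratheodory's criterion: the slope at 0 is again a signed power, of exponent p - i - 1 > 0,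
    hence continuous at 0 with value 0. *)
Lemma is_derive1_sgpow0 i : 1 < p - i%:R -> is_derive (0 : R) 1 (sgpow i) (sgpow i.+1 0).
Proof.
move=> pi; apply/is_derive1_caratheodory.
exists (fun z => ffactr i * (Num.sg z ^+ i.+1 * `|z| `^ (p - i.+1%:R))).
have pi1 : 0 < p - i.+1%:R by rewrite -natr1; lra.
have s0 : sgpow i 0 = 0.
  by rewrite /sgpow normr0 powR0 ?mulr0//; rewrite gt_eqF//; lra.
have sS0 : sgpow i.+1 0 = 0 by rewrite /sgpow normr0 powR0 ?mulr0// gt_eqF.
split.
- move=> z; rewrite s0 !subr0 /sgpow.
  have -> : p - i%:R = 1 + (p - i.+1%:R) by rewrite -natr1; ring.
  have [->|zn0] := eqVneq z 0.
    by rewrite normr0 powR0 ?mulr0//; rewrite gt_eqF//; lra.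
  rewrite (@powRD _ `|z| 1); last by rewrite normr_eq0 zn0 implybT.
  rewrite powRr1// exprS.
  rewrite [X in _ = _ * X](numEsg z).
  have e : Num.sg z * Num.sg z = 1 by rewrite -expr2 sqr_sg zn0.
  transitivity ((Num.sg z * Num.sg z) *
    (ffactr i * (Num.sg z ^+ i * (`|z| * `|z| `^ (p - i.+1%:R))))).
    by rewrite e mul1r.
  by ring.
- rewrite /prop_for /continuous_at /= normr0 powR0 ?gt_eqF// !mulr0.
  apply: norm_cvg0.
  have c1 : `|ffactr i| * `|z| `^ (p - i.+1%:R) @[z --> (0 : R)] --> (0 : R).
    rewrite -[X in _ --> X](mulr0 `|ffactr i|); apply: cvgM; first exact: cvg_cst.
    apply/cvgrPdist_lt => e e0.
    near=> z.
    rewrite sub0r normrN ger0_norm ?powR_ge0//.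
    have ze : `|z| < e `^ ((p - i.+1%:R)^-1).
      near: z; have := @nbhs0_lt R R (e `^ ((p - i.+1%:R)^-1)); apply.
      by rewrite powR_gt0.
    apply: (@lt_le_trans _ _ ((e `^ ((p - i.+1%:R)^-1)) `^ (p - i.+1%:R))).
      by apply: gt0_ltr_powR; rewrite ?nnegrE ?powR_ge0.
    by rewrite -powRrM mulVf ?gt_eqF// powRr1// ltW.
  apply: (@squeeze_cvgr _ _ _ _ (fun=> 0) (fun z => `|ffactr i| * `|z| `^ (p - i.+1%:R))) => //.
  - apply: nearW => z; rewrite normr_ge0 /= normrM ler_wpM2l// normrM normrX.
    rewrite [X in _ * X]ger0_norm ?powR_ge0// ler_piMl ?powR_ge0//.
    by rewrite exprn_ile1// normr_sg; case: (_ != 0).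
  - exact: cvg_cst.
- by rewrite sS0 normr0 powR0 ?mulr0// gt_eqF.
Unshelve. all: by end_near. Qed.

Lemma is_derive1_sgpow i z : 1 < p - i%:R -> is_derive z 1 (sgpow i) (sgpow i.+1 z).
Proof.
move=> pi; have [z0|z0|->] := ltgtP z 0.
- exact: is_derive1_sgpow_neg.
- exact: is_derive1_sgpow_pos.
- exact: is_derive1_sgpow0.
Qed.

Lemma sgpow_0 z : sgpow 0 z = `|z| `^ p.
Proof. by rewrite /sgpow /ffactr big_ord0 expr0 !mul1r subr0. Qed.

End PowerFamily.

(** * Differences of the semi-variogram *)

Lemma littleo_bound (R : realType) (r f : R -> R) : r =o_ (0 : R) f ->
  forall eps : R, 0 < eps ->
  exists rho : R, 0 < rho /\ forall z : R, `|z| < rho -> `|r z| <= eps * `|f z|.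
Proof.
move=> ro eps e0.
have /eqoP h := ro.
have [rho /= rho0 H] := (nbhs_ballP _ _).1 (h _ e0).
exists rho; split=> // z zr; apply: H.
by rewrite /ball /= sub0r normrN.
Qed.

Lemma ler_powR_npos (R : realType) (q u v : R) : q <= 0 -> 0 < u -> u <= v ->
  v `^ q <= u `^ q.
Proof.
move=> q0 u0 uv; have v0 := lt_le_trans u0 uv.
rewrite -[q]opprK !(powRN _ (- q)) lef_pV2 ?posrE ?powR_gt0//.
by apply: ge0_ler_powR => //; rewrite ?nnegrE ?oppr_ge0// ltW.
Qed.

Lemma dist_shift_bound (R : realType) (L k : nat) (dl z : R) : 0 < dl -> (0 < L <= k)%N ->
  `|z - k%:R * dl| <= L.-1%:R * dl ->
  0 < (k - L.-1)%:R * dl <= z /\ z <= (k + L.-1)%:R * dl.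
Proof.
move=> dl0 /andP[L0 Lk]; rewrite ler_norml => /andP[h1 h2].
rewrite natrB ?natrD; last by lia.
have kl : L.-1%:R < k%:R :> R by rewrite ltr_nat; lia.
rewrite mulrBl mulrDl; split; last lra.
by apply/andP; split; [rewrite -mulrBl mulr_gt0// subr_gt0|lra].
Qed.

Section PowerDifferences.
Context (R : realType) (a : seq R) (M : nat) (p : R).
Hypothesis aM : is_order a M.
Hypothesis L_gt0 : (0 < size a)%N.
Local Notation L := (size a).
Local Notation W := (fun y : R => `|y| `^ p).

Let eqW (x : R) : sdiff a W x 1 = sdiff a (sgpow p 0) x 1.
Proof. by apply: eq_sdiff => i j _ _; rewrite sgpow_0. Qed.

Let W_derive (k i : nat) (z : R) : (L <= k)%N ->
  `|z - k%:R| <= L.-1%:R * 1 -> is_derive z 1 (sgpow p i) (sgpow p i.+1 z).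
Proof.
move=> Lk; rewrite -[k%:R]mulr1 => /(@dist_shift_bound _ _ _ _ _ ltr01) [].
  by rewrite L_gt0.
by move=> /andP[z0 z1] _; apply: is_derive1_sgpow_pos; exact: lt_le_trans z1.
Qed.

Let W_bound (k q : nat) (z : R) : p <= q%:R -> (L <= k)%N ->
  `|z - k%:R| <= L.-1%:R * 1 ->
  `|sgpow p q z| <= `|ffactr p q| * (k - L.-1)%:R `^ (p - q%:R).
Proof.
move=> pq Lk; rewrite -[k%:R in X in X -> _]mulr1 => /(@dist_shift_bound _ _ _ _ _ ltr01) [].
  by rewrite L_gt0.
rewrite !mulr1 => /andP[z0 z1] _; have zp : 0 < z := lt_le_trans z0 z1.
rewrite /sgpow gtr0_sg// expr1n mul1r normrM (gtr0_norm zp) ler_wpM2l//.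
by rewrite ger0_norm ?powR_ge0//; apply: ler_powR_npos => //; rewrite subr_le0.
Qed.

Lemma sdiff_pow_le (k : nat) : p <= (2 * M)%:R -> (L <= k)%N ->
  `|sdiff a W k%:R 1| <= asum a ^+ 2 *
   (`|ffactr p (2 * M)| * (k - L.-1)%:R `^ (p - (2 * M)%:R) *
    (L.-1%:R * 1) ^+ (2 * M) / (2 * M)`!%:R).
Proof.
move=> pM Lk; rewrite eqW.
apply: (@sdiff_taylor_le _ a _ aM (sgpow p) (2 * M) k%:R 1 _ ltr01 (leqnn _)).
  by move=> i z _; exact: W_derive.
by move=> z; exact: W_bound.
Qed.

(* For a non-integer exponent the leading term of the Taylor expansion of order
   [2 M] dominates as [k] tends to infinity. *)
Lemma sdiff_pow_neq0 : p <= (2 * M)%:R -> ffactr p (2 * M) != 0 ->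
  exists k : nat, sdiff a W k%:R 1 != 0.
Proof.
move=> pM f0.
apply: contrapT => h0.
have {}h0 k : sdiff a W k%:R 1 = 0.
  by apply: contrapT => /eqP hk; apply: h0; exists k.
have m0 := dmoment_neq0 aM.
pose c := `|ffactr p (2 * M) / (2 * M)`!%:R * dmoment a (2 * M)|.
have c0 : 0 < c.
  by rewrite normr_gt0 !mulf_neq0// invr_eq0 pnatr_eq0 -lt0n fact_gt0.
pose e := asum a ^+ 2 * (`|ffactr p (2 * M).+1| * (L.-1%:R * 1) ^+ (2 * M).+1 / (2 * M).+1`!%:R).
have e0 : 0 <= e.
  by rewrite mulr_ge0 ?sqr_ge0// mulr_ge0// mulr_ge0// exprn_ge0// mulr_ge0.
(* If all differences vanished, the term of degree 2M of the Taylor expansion at [k] would be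
   bounded by the remainder, which is smaller by a factor of order 1/k. *)
have key (k : nat) : (L <= k)%N ->
    c * k%:R `^ (p - (2 * M)%:R) <= e * (k - L.-1)%:R `^ (p - (2 * M).+1%:R).
  move=> Lk.
  have kp : 0 < k%:R :> R by rewrite ltr0n; lia.
  have pM1 : p <= (2 * M).+1%:R by apply: le_trans pM _; rewrite ler_nat.
  have := @sdiff_taylor _ a (sgpow p) (2 * M).+1 k%:R 1
    (`|ffactr p (2 * M).+1| * (k - L.-1)%:R `^ (p - (2 * M).+1%:R)) ltr01
    (fun i z _ => @W_derive k i z Lk) (fun z => @W_bound k _ z pM1 Lk).
  rewrite -eqW h0 sub0r normrN big_ord_recr /= big1 ?add0r; last first.
    by move=> i _; rewrite (dmoment_eq0 aM)// mulr0.
  rewrite expr1n mulr1 /sgpow gtr0_sg// expr1n mul1r (gtr0_norm kp).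
  have -> : ffactr p (2 * M) * k%:R `^ (p - (2 * M)%:R) / (2 * M)`!%:R * dmoment a (2 * M) =
      (ffactr p (2 * M) / (2 * M)`!%:R * dmoment a (2 * M)) * k%:R `^ (p - (2 * M)%:R).
    by move: (_^-1) (_ `^ _) => u v; ring.
  rewrite normrM -/c [`|_ `^ _|]ger0_norm ?powR_ge0// => h; apply: (le_trans h).
  rewrite le_eqVlt; apply/orP; left; apply/eqP; rewrite /e.
  by move: (_^-1) (_ `^ _) (_ ^+ (2 * M).+1) => u v w; ring.
pose m := (2 * M)%:R - p.
have m_ge0 : 0 <= m by rewrite subr_ge0.
(* With j = k - L + 1 and j + L - 1 <= j L, the comparison of powers becomes linear in [j], which
   contradicts the Archimedean property. *)
have key2 (j : nat) : (0 < j)%N -> c * j%:R <= e * L%:R `^ m.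
  move=> j0; have := key (j + L.-1)%N; rewrite addnK.
  have /[swap] /[apply] : (L <= j + L.-1)%N by lia.
  have jp : 0 < j%:R :> R by rewrite ltr0n.
  have kp : 0 < (j + L.-1)%:R :> R by rewrite ltr0n; lia.
  have -> : p - (2 * M).+1%:R = - m - 1 by rewrite /m -natr1; ring.
  have -> : p - (2 * M)%:R = - m by rewrite /m; ring.
  have -> : j%:R `^ (- m - 1) = (j%:R `^ m)^-1 / j%:R :> R.
    have jn : (m + 1 == 0) ==> (j%:R != 0 :> R) by rewrite (gt_eqF jp) implybT.
    by rewrite -opprD powRN (powRD jn) powRr1 ?invfM// ltW.
  rewrite powRN.
  have jm : 0 < j%:R `^ m by rewrite powR_gt0.
  have km : 0 < (j + L.-1)%:R `^ m by rewrite powR_gt0.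
  have kj : (j + L.-1)%:R `^ m <= j%:R `^ m * L%:R `^ m.
    rewrite -powRM//; apply: ge0_ler_powR; rewrite ?nnegrE ?mulr_ge0//.
    by rewrite -natrM ler_nat -{2}(prednK L_gt0) mulnS leq_add2l leq_pmull.
  rewrite ler_pdivrMr// => h.
  have -> : c * j%:R = j%:R * c by rewrite mulrC.
  apply: (le_trans (ler_wpM2l (ltW jp) h)).
  set u := j%:R in jp jm kj *; set v := _ `^ m in km kj *.
  rewrite (_ : u * (e * ((u `^ m)^-1 / u) * v) = e * (v / u `^ m)); last first.
    by field; rewrite !gt_eqF.
  by rewrite ler_wpM2l// ler_pdivrMr// mulrC.
have [j hj] : exists j : nat, e * L%:R `^ m / c < j%:R.
  exists (Num.bound (e * L%:R `^ m / c)); apply: archi_boundP.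
  by rewrite divr_ge0 ?(ltW c0)// mulr_ge0// powR_ge0.
have j0 : (0 < j)%N.
  rewrite -(ltr0n R); apply: le_lt_trans hj.
  by rewrite divr_ge0 ?(ltW c0)// mulr_ge0// powR_ge0.
have := key2 _ j0; rewrite leNgt; apply/negP; rewrite negbK.
by move: hj; rewrite ltr_pdivrMr// [_ * c]mulrC.
Qed.

(* For an odd integer exponent [|k + j| ^ p] is polynomial as long as no argument
   is negative; [L - 2] is the first index for which exactly one of them is. *)
Lemma sdiff_pow_odd_neq0 (q : nat) : p = q%:R -> odd q -> (q < 2 * M)%N ->
  trimmed a -> (1 < L)%N -> sdiff a W (L - 2)%:R 1 != 0.
Proof.
move=> pq oq qM [a0 aL] L1.
(* For an integer y >= -1 and odd q, |y|^q equals y^q except at y = -1, where it exceeds it by 2.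
   The polynomial part is annihilated. *)
have -> : sdiff a W (L - 2)%:R 1 =
    sdiff a (fun y => y ^+ q) (L - 2)%:R 1 +
    sdiff a (fun y => (y == -1)%:R * 2) (L - 2)%:R 1.
  rewrite -sdiffD; apply: eq_sdiff => k l kL lL.
  rewrite mulr1 pq powR_mulrn//.
  set y := (L - 2)%:R + _.
  have yE : y = ((L - 2)%:Z + k%:Z - l%:Z)%:~R :> R.
    by rewrite /y rmorphB rmorphD /= !pmulrn addrA.
  have [y0|y0] := leP 0 y.
    by rewrite ger0_norm// (_ : (y == -1) = false) ?mul0r ?addr0//; lra.
  have -> : y = -1.
    rewrite yE in y0 *; move: y0; rewrite ltrz0 => y0.
    have -> : (L - 2)%:Z + k%:Z - l%:Z = -1 by lia.
    by rewrite rmorphN1.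
  rewrite eqxx normrN1 expr1n -signr_odd oq /= expr1; ring.
rewrite (sdiff_monomial aM)// add0r /sdiff.
have L0' : (0 < L)%N by lia.
have LL' : (L.-1 < L)%N by lia.
(* The argument (L - 2) + k - l equals -1 only for k = 0 and l = L - 1, so the first and last
   coefficients of [a] decide. *)
rewrite (bigD1 (Ordinal L0'))//= (bigD1 (Ordinal LL'))//=.
rewrite big1 => [|l /eqP lL]; last first.
  rewrite mulr1 (_ : (_ == -1) = false) ?mul0r ?mulr0//.
  apply/negP => /eqP h; apply: lL; apply: val_inj => /=.
  have : (L - 2)%:R + 1 = l%:R :> R by lra.
  by rewrite natr1 => /eqP; rewrite eqr_nat => /eqP; lia.
rewrite big1 => [|k /eqP k0]; last first.
  apply: big1 => l _; rewrite mulr1 (_ : (_ == -1) = false) ?mul0r ?mulr0//.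
  apply/negP => /eqP h; apply: k0; apply: val_inj => /=.
  have : (L - 2)%:R + k%:R + 1 = l%:R :> R by lra.
  rewrite -natrD natr1 => /eqP; rewrite eqr_nat => /eqP.
  by have := ltn_ord l; lia.
rewrite !addr0 mulr1 sub0r (_ : (_ == -1) = true); last first.
  apply/eqP; rewrite (_ : L.-1 = (L - 2).+1); last by lia.
  by rewrite -natr1; ring.
by rewrite mul1r !mulf_neq0// pnatr_eq0.
Qed.

End PowerDifferences.

Section Semivariogram.
Context (R : realType) (V r : R -> R) (D : nat) (C s : R).
Hypothesis s_gt0 : 0 < s.
Hypothesis V_smooth : smooth_on [set x | 0 < x] V.
Hypothesis V_derivable : times_derivable (2 * D)%N V.
Hypothesis V_expansion : forall h : R,
  derive1n (2 * D)%N V h =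
  derive1n (2 * D)%N V 0 + C * (-1) ^+ D * `|h| `^ s + r h.

Let p : R := (2 * D)%N%:R + s.
Let v0 : R := derive1n (2 * D)%N V 0.

(** The constant for which the 2D-th derivative of kappa |z|^p is |z|^s. *)
Definition kappa : R := (ffactr p (2 * D))^-1.

Lemma ffactr_gt0 : 0 < ffactr p (2 * D).
Proof.
apply: prodr_gt0 => j _; rewrite subr_gt0 /p.
have h : j%:R <= (2 * D)%:R :> R by rewrite ler_nat ltnW.
by apply: le_lt_trans h _; rewrite ltrDl.
Qed.

Lemma kappa_gt0 : 0 < kappa. Proof. by rewrite invr_gt0 ffactr_gt0. Qed.

(* The [i]-th derivative of [V] minus its singular part C (-1)^D kappa |z|^p and
   a multiple of z^(2D); for [i = 2D] this is the remainder [r]. *)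
Definition resid (i : nat) (z : R) : R :=
  derive1n i V z - C * (-1) ^+ D * kappa * sgpow p i z -
  v0 * (z ^+ (2 * D - i) / (2 * D - i)`!%:R).

Lemma resid_top z : resid (2 * D) z = r z.
Proof.
rewrite /resid subnn expr0 fact0 V_expansion -/v0.
have -> : sgpow p (2 * D) z = ffactr p (2 * D) * `|z| `^ s.
  rewrite /sgpow (_ : p - _ = s); last by rewrite /p; ring.
  have [->|z0] := eqVneq z 0; first by rewrite normr0 powR0 ?mulr0 ?gt_eqF.
  by rewrite exprM sqr_sg z0 expr1n mul1r.
have := ffactr_gt0 => f0; rewrite /kappa; set f := ffactr _ _ in f0 *.
by rewrite divr1 mulr1; field; rewrite gt_eqF.
Qed.

Lemma is_derive1_derive1n i (f : R -> R) (z : R) : derivable (derive1n i f) z 1 ->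
  is_derive z 1 (derive1n i f) (derive1n i.+1 f z).
Proof. by move=> h; rewrite derive1nS derive1E; exact: derivableP. Qed.

Lemma is_derive1_resid_poly i (z : R) : (i < 2 * D)%N ->
  is_derive z 1 (fun z => v0 * (z ^+ (2 * D - i) / (2 * D - i)`!%:R))
    (v0 * (z ^+ (2 * D - i.+1) / (2 * D - i.+1)`!%:R)).
Proof.
move=> iD; rewrite (_ : (2 * D - i)%N = (2 * D - i.+1).+1); last by lia.
have := is_derive1_taylor_term v0 0 z (2 * D - i.+1); rewrite subr0 => h.
by have := h; under eq_fun do rewrite subr0 -mulrA; rewrite -mulrA.
Qed.

Lemma is_derive1_resid i (z : R) : (i < 2 * D)%N ->
  is_derive z 1 (resid i) (resid i.+1 z).
Proof.
move=> iD; apply: is_derive1B; last exact: is_derive1_resid_poly.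
apply: is_derive1B; first by apply: is_derive1_derive1n; exact: V_derivable.
apply: is_derive1Z; apply: is_derive1_sgpow.
have h : i.+1%:R <= (2 * D)%:R :> R by rewrite ler_nat.
by rewrite ltrBrDr addrC natr1; apply: le_lt_trans h _; rewrite ltrDl.
Qed.

(** The remainder [r] inherits its smoothness from [V]: on the open half-line it coincides with an
    explicit smooth combination, and equality near a point passes to derivatives. *)
Lemma derive1n_r_pos j (z : R) : 0 < z ->
  is_derive z 1 (derive1n j r) (derive1n j.+1 r z) /\
  derive1n j r z = derive1n (2 * D + j) V z -
    C * (-1) ^+ D * kappa * sgpow p (2 * D + j) z - (j == 0%N)%:R * v0.
Proof.
pose h j z := derive1n (2 * D + j) V z -
    C * (-1) ^+ D * kappa * sgpow p (2 * D + j) z - (j == 0%N)%:R * v0.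
have hd i (y : R) : 0 < y -> is_derive y 1 (h i) (h i.+1 y).
  move=> y0; rewrite /h addnS.
  have e : derive1n (2 * D + i).+1 V y - C * (-1) ^+ D * kappa * sgpow p (2 * D + i).+1 y -
    (i.+1 == 0%N)%:R * v0 = derive1n (2 * D + i).+1 V y -
    C * (-1) ^+ D * kappa * sgpow p (2 * D + i).+1 y - 0 by rewrite mul0r.
  have hc : is_derive y 1 (fun=> (i == 0%N)%:R * v0) 0 by exact: is_derive1_cst.
  rewrite e; apply: is_derive1B hc.
  apply: is_derive1B; first by apply: is_derive1_derive1n; exact: V_smooth.
  exact/is_derive1Z/is_derive1_sgpow_pos.
have main i : forall y : R, 0 < y -> derive1n i r y = h i y.
  elim: i => [|i IHi] y y0.
    have := resid_top y; rewrite /resid subnn expr0 fact0 divr1 mulr1 derive1n0 => <-.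
    by rewrite /h addn0 mul1r.
  rewrite derive1nS derive1E.
  have nr : \forall w \near y, h i w = derive1n i r w.
    near=> w; rewrite IHi//; near: w; exact: lt_nbhsr.
  have hh := near_eq_is_derive1 nr (hd i y y0).
  exact: derive_val.
move=> z0; split; last exact: main.
rewrite main//.
have nr : \forall w \near z, h j w = derive1n j r w.
  near=> w; rewrite main//; near: w; exact: lt_nbhsr.
exact: near_eq_is_derive1 nr (hd j z z0).
Unshelve. all: by end_near. Qed.

(** Continues the derivatives of [resid 0] beyond order 2D by those of [r], on which the hypotheses
    bear; the two agree at order 2D. *)
Definition residr (i : nat) : R -> R :=
  if (i <= 2 * D)%N then resid i else derive1n (i - 2 * D) r.

Lemma is_derive1_residr i (z : R) : 0 < z -> is_derive z 1 (residr i) (residr i.+1 z).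
Proof.
move=> z0; rewrite /residr; have [iD|Di] := ltnP i (2 * D).
  by rewrite ltnW//; exact: is_derive1_resid.
have [d1 _] := derive1n_r_pos (i - 2 * D) z0.
have [iD|iD] := leqP i (2 * D); last by rewrite subSn.
have iE : i = (2 * D)%N by apply/eqP; rewrite eqn_leq iD.
have -> : resid i = r by apply/funext => y; rewrite iE resid_top.
by move: d1; rewrite subSn// iE subnn.
Qed.

Section Differences.
Variables (a : seq R) (M : nat).
Hypothesis aM : is_order a M.
Hypothesis DM : (D < M)%N.
Hypothesis L_gt0 : (0 < size a)%N.
Local Notation L := (size a).

(** The monomial of degree 2D that is removed in [resid] is annihilated since D < M. *)
Lemma sdiff_semivariogram x dl :
  sdiff a V x dl = C * (-1) ^+ D * kappa * sdiff a (fun y => `|y| `^ p) x dl +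
    sdiff a (resid 0) x dl.
Proof.
have -> : sdiff a V x dl = sdiff a (fun y => C * (-1) ^+ D * kappa * `|y| `^ p +
    (resid 0 y + v0 / (2 * D)`!%:R * y ^+ (2 * D))) x dl.
  apply: eq_sdiff => k l _ _; move: (_ + _) => y.
  rewrite /resid derive1n0 subn0 sgpow_0; move: (_^-1) (_ `^ _) => u v; ring.
rewrite !sdiffD !sdiffZ (sdiff_monomial aM) ?mulr0 ?addr0//.
by rewrite ltn_pmul2l.
Qed.

(** Taylor expansion at the origin to order 2D, where the derivative is [r] itself. No positivity of
    the arguments enters, so small lags, whose arguments cross 0, are covered. *)
Lemma sdiff_resid_near0 (k : nat) (dl rho eps t : R) : 0 < dl -> 0 <= eps -> 0 <= t ->
  (k + L)%:R * dl < rho -> (forall z, `|z| < rho -> `|r z| <= eps * `|z| `^ t) ->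
  `|sdiff a (resid 0) (k%:R * dl) dl| <=
  asum a ^+ 2 * (eps * ((k + L)%:R * dl) `^ t * ((k + L)%:R * dl) ^+ (2 * D)).
Proof.
move=> dl0 e0 t0 kL rb.
set X := (k + L)%:R * dl in kL *.
have X0 : 0 <= X by rewrite mulr_ge0// ltW.
pose T y := \sum_(i < 2 * D) resid i 0 / i`!%:R * y ^+ i.
have -> : sdiff a (resid 0) (k%:R * dl) dl = sdiff a (fun y => resid 0 y - T y) (k%:R * dl) dl.
  rewrite sdiffD (_ : sdiff a (fun y => - T y) _ _ = 0) ?addr0//.
  under [X in sdiff _ X]eq_fun do rewrite -mulN1r.
  rewrite sdiffZ sdiff_sum big1 ?mulr0// => i _.
  rewrite sdiffZ (sdiff_monomial aM) ?mulr0//.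
  by apply: ltn_trans (ltn_ord i) _; rewrite ltn_pmul2l.
apply: sdiff_le => i j iL jL.
set y := k%:R * dl + (i%:R - j%:R) * dl.
have yX : `|y| <= X.
  rewrite /y -mulrDl normrM (gtr0_norm dl0) /X ler_pM2r//.
  apply: le_trans (ler_normD _ _) _; rewrite normr_nat natrD lerD2l.
  by apply: le_trans (dist_natr_le iL jL) _; rewrite ler_nat leq_pred.
have := @taylor_bound _ resid (2 * D) 0 y (eps * X `^ t); rewrite subr0 /T.
under eq_bigr do rewrite mulrAC.
move=> h; apply: le_trans (h _ _) _ => {h}.
- by move=> l z lD _ _; exact: is_derive1_resid.
- move=> z; rewrite subr0 => zy _; rewrite resid_top.
  have zX : `|z| <= X by exact: le_trans yX.
  apply: le_trans (rb z _) _; first exact: le_lt_trans kL.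
  by rewrite ler_wpM2l//; apply: ge0_ler_powR; rewrite ?nnegrE.
rewrite ler_pdivrMr ?ltr0n ?fact_gt0//.
have B0 : 0 <= eps * X `^ t by rewrite mulr_ge0// powR_ge0.
apply: (@le_trans _ _ (eps * X `^ t * X ^+ (2 * D))).
  by rewrite ler_wpM2l//; apply: lerXn2r; rewrite ?nnegrE.
have f1 : 1 <= (2 * D)`!%:R :> R by rewrite ler1n fact_gt0.
by apply: ler_peMr => //; apply: mulr_ge0 => //; apply: exprn_ge0.
Qed.

(** For lags at least L every argument stays positive, which allows a Taylor expansion at k dl to
    order 2D + d. As beta <= 0, the top derivative is largest at the leftmost argument, (k - L + 1)
    dl. *)
Lemma sdiff_resid_far (k d : nat) (dl beta K : R) : 0 < dl -> (L <= k)%N -> (0 < d)%N ->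
  (2 * D + d <= 2 * M)%N -> beta <= 0 ->
  (forall z, 0 < z <= (k + L.-1)%:R * dl -> `|derive1n d r z| <= K * `|z| `^ beta) ->
  `|sdiff a (resid 0) (k%:R * dl) dl| <=
  asum a ^+ 2 * (K * ((k - L.-1)%:R * dl) `^ beta * (L.-1%:R * dl) ^+ (2 * D + d) /
    (2 * D + d)`!%:R).
Proof.
move=> dl0 Lk d0 dM b0 rb.
have Lk' : (0 < L <= k)%N by rewrite L_gt0.
have X0 : 0 < (k - L.-1)%:R * dl by rewrite mulr_gt0// ltr0n; lia.
have K0 : 0 <= K.
  have x0 : 0 < k%:R * dl by rewrite mulr_gt0// ltr0n; lia.
  have := rb (k%:R * dl); rewrite x0 ler_pM2r// ler_nat leq_addr => /(_ isT) h.
  rewrite -(@pmulr_lge0 _ (`|k%:R * dl| `^ beta)); last by rewrite powR_gt0 ?normr_gt0 ?gt_eqF.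
  by apply: le_trans h.
rewrite (_ : resid 0 = residr 0)//.
apply: (sdiff_taylor_le aM) => //.
- move=> i z _ /(dist_shift_bound dl0 Lk') [/andP[z0 z1] _].
  by apply: is_derive1_residr; exact: lt_le_trans z1.
- move=> z /(dist_shift_bound dl0 Lk') [/andP[z0 z1] z2].
  have zp := lt_le_trans z0 z1.
  rewrite /residr (_ : (2 * D + d <= 2 * D)%N = false); last by lia.
  rewrite addKn; apply: le_trans (rb z _) _; first by rewrite zp.
  by rewrite gtr0_norm// ler_wpM2l//; exact: ler_powR_npos.
Qed.

End Differences.
End Semivariogram.

(** * The normalizing constant *)

Section RfunAutoconv.
Context (R : realType).

Lemma continuous_norm_powR (s : R) : 0 < s -> continuous (fun x : R => `|x| `^ s).
Proof.
move=> s0 x; have [->|x0] := eqVneq x 0; last first.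
  have xp : 0 < `|x| by rewrite normr_gt0.
  have h : continuous_at `|x| (fun y : R => `|y| `^ s).
    have := is_derive1_continuous (@is_derive1_sgpow_pos _ s 0 _ xp).
    by rewrite (_ : sgpow s 0 = (fun y : R => `|y| `^ s))//; apply/funext => y; rewrite sgpow_0.
  rewrite (_ : (fun y : R => `|y| `^ s) = (fun y : R => `|y| `^ s) \o (fun y => `|y|)).
    by apply: continuous_comp => //; exact: norm_continuous.
  by apply/funext => y /=; rewrite normr_id.
apply/cvgrPdist_lt => e e0; rewrite normr0 powR0 ?gt_eqF//.
near=> y; rewrite sub0r normrN ger0_norm ?powR_ge0//.
have ye : `|y| < e `^ s^-1.
  near: y; apply/nbhs_ballP; exists (e `^ s^-1) => /=; first by rewrite powR_gt0.
  by move=> y; rewrite /ball /= sub0r normrN.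
have {1}-> : e = (e `^ s^-1) `^ s.
  by rewrite -powRrM mulVf ?gt_eqF// powRr1// ltW.
by apply: gt0_ltr_powR; rewrite // nnegrE ?powR_ge0.
Unshelve. all: by end_near. Qed.

Lemma continuous_beta_density (q : nat) (s : R) : 0 < s ->
  continuous (fun x : R => (1 - x) ^+ q / q`!%:R * `|x| `^ s).
Proof.
move=> s0 x; apply: (@continuousM R R (fun x => (1 - x) ^+ q / q`!%:R) (fun x => `|x| `^ s));
  last exact: continuous_norm_powR.
apply: is_derive1_continuous; under eq_fun do rewrite mulrC.
exact: (is_derive1Z _ (is_derive1X q
    (is_derive1B (is_derive1_cst x 1) (is_derive1_id x)))).
Qed.

(* The antiderivative is the Taylor polynomial [sum_k (1 - x)^k/k! w^(k) x] at
   the point [1] of [w = x ^ (s + q + 1)], which vanishes at [0]. *)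
Lemma Rintegral_beta (q : nat) (s : R) : odd q -> 0 < s ->
  \int[lebesgue_measure]_(x in `[0, 1])
    ((1 - x) ^+ q / q`!%:R * `|x| `^ s) = (ffactr (q.+1%:R + s) q.+1)^-1.
Proof.
move=> oq s0; set p := q.+1%:R + s.
have fp : 0 < ffactr p q.+1.
  apply: prodr_gt0 => j _; rewrite subr_gt0 /p.
  have h : j%:R <= q.+1%:R :> R by rewrite ler_nat ltnW.
  by apply: le_lt_trans h _; rewrite ltrDl.
pose G m (x : R) := \sum_(k < m) ((1 - x) ^+ k / k`!%:R) * sgpow p k x.
pose g (x : R) := (1 - x) ^+ q / q`!%:R * `|x| `^ s.
have dtop x : (1 - x) ^+ q / q`!%:R * sgpow p q.+1 x = ffactr p q.+1 * g x.
  rewrite /sgpow /g (_ : p - q.+1%:R = s); last by rewrite /p; ring.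
  have -> : Num.sg x ^+ q.+1 * `|x| `^ s = `|x| `^ s.
    have [->|x0] := eqVneq x 0; first by rewrite normr0 powR0 ?mulr0 ?gt_eqF.
    rewrite -(odd_double_half q.+1) /= oq /= add0n -mul2n exprM sqr_sg x0.
    by rewrite expr1n mul1r.
  by rewrite mulrCA.
have dG m (x : R) : (m <= q)%N ->
    is_derive x 1 (G m.+1) ((1 - x) ^+ m / m`!%:R * sgpow p m.+1 x).
  have ds k : (k <= q)%N -> is_derive x 1 (sgpow p k) (sgpow p k.+1 x).
    move=> kq; apply: is_derive1_sgpow; rewrite /p -natr1.
    have h : k%:R <= q%:R :> R by rewrite ler_nat.
    lra.
  elim: m => [|m IHm] mq; rewrite /G.
    under eq_fun do rewrite big_ord1 expr0 fact0 divr1 mul1r.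
    by rewrite expr0 fact0 divr1 mul1r; exact: ds.
  under eq_fun do rewrite big_ord_recr /=.
  have d1 : is_derive x 1 (fun x => (1 - x) ^+ m.+1 / m.+1`!%:R) (- ((1 - x) ^+ m / m`!%:R)).
    under eq_fun do rewrite mulrC.
    apply: (is_derive_eq (is_derive1Z _ (is_derive1X m.+1
      (is_derive1B (is_derive1_cst x 1) (is_derive1_id x))))).
    rewrite factS natrM sub0r /=.
    have f0 : m`!%:R != 0 :> R by rewrite pnatr_eq0 -lt0n fact_gt0.
    have n0 : m.+1%:R != 0 :> R by rewrite pnatr_eq0.
    move: ((1 - x) ^+ m) f0 n0; move: (m.+1%:R) (m`!%:R) => u v w v0 u0; field.
    by rewrite u0 v0.
  apply: (is_derive_eq (is_derive1D (IHm (ltnW mq)) (is_derive1M d1 (ds _ mq)))).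
  by move: (_ / _) (_ / _) (sgpow _ _ _) (sgpow _ _ _) => u v w t; ring.
have G0 : G q.+1 0 = 0.
  apply: big1 => k _; rewrite /sgpow normr0 powR0 ?mulr0// gt_eqF// /p subr_gt0.
  have h : k%:R <= q.+1%:R :> R by rewrite ler_nat ltnW.
  by apply: le_lt_trans h _; rewrite ltrDl.
have G1 : G q.+1 1 = 1.
  rewrite /G big_ord_recl big1 ?addr0; last by move=> k _; rewrite subrr expr0n /= mul0r mul0r.
  by rewrite expr0 fact0 divr1 mul1r sgpow_0 normr1 powR1.
rewrite -/g /Rintegral (_ : (\int[_]_(x in _) _)%E = (ffactr p q.+1)^-1%:E)//.
have cg : continuous g by exact: continuous_beta_density.
have dF (x : R) : is_derive x 1 (fun x => (ffactr p q.+1)^-1 * G q.+1 x) (g x).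
  apply: (is_derive_eq (is_derive1Z _ (dG q x (leqnn _)))).
  by rewrite dtop mulKf ?gt_eqF.
by have -> := continuous_FTC2_is_derive ltr01 dF cg; rewrite G0 G1 mulr0 mulr1 subr0.
Qed.

(** All differences k - l lie in the window of integers from -L to L - 1, to which the sum over the
    integers is restricted before exchanging sums. *)
Lemma fsbig_autoconv (a : seq R) (h : int -> R) :
  \sum_(j \in [set: int]) autoconv a j * h j =
  \sum_(k < size a) \sum_(l < size a) a`_k * a`_l * h (k%:Z - l%:Z).
Proof.
pose L := size a.
pose r := [seq i%:Z - L%:Z | i <- iota 0 (2 * L)].
have ur : uniq r by rewrite map_inj_uniq ?iota_uniq// => i j; lia.
have mr (k l : 'I_L) : (k%:Z - l%:Z) \in r.
  apply/mapP; exists (k + L - l)%N; last by have := ltn_ord l; lia.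
  by rewrite mem_iota; have := ltn_ord k; have := ltn_ord l; lia.
rewrite -(@fsbig_widen _ _ _ _ [set` r] setT)//; last first.
  move=> j [_ /= jr]; rewrite /autoconv big1 ?mul0r// => k _.
  by apply: big1 => l /eqP kl; case: jr; rewrite /= -kl mr.
rewrite -fsbig_seq//.
under eq_bigr do rewrite /autoconv mulr_suml.
rewrite exchange_big; apply: eq_bigr => k _.
under eq_bigr do rewrite mulr_suml big_mkcond.
rewrite exchange_big; apply: eq_bigr => l _.
rewrite -big_mkcond/=.
under eq_bigl do rewrite eq_sym.
rewrite (big_rem (k%:Z - l%:Z)) ?mr//= eqxx big1_seq ?addr0// => j.
by rewrite mem_rem_uniq// inE => /andP[/eqP-> /andP[]]; rewrite eqxx.
Qed.

(** The integral in [Rfun] is the integral form of the Taylor remainder: it turns j^(2D) |j eta|^s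
    into kappa |j|^(2D + s). This identifies the denominator of the estimator with the limiting
    variance of one difference. *)
Lemma Rfun_autoconv (a : seq R) (D : nat) (s : R) : 0 < s ->
  Rfun 0 1 (2 * D) (fun x : R => `|x| `^ s) (autoconv a) =
  - (kappa D s * sdiff a (fun y => `|y| `^ ((2 * D)%:R + s)) 0 1).
Proof.
move=> s0; rewrite /Rfun.
have [D0|D0] := eqVneq (2 * D)%N 0%N.
  rewrite D0 fsbig_autoconv /kappa D0 /ffactr big_ord0 invr1 mul1r /sdiff add0r.
  congr (- _); apply: eq_bigr => k _; apply: eq_bigr => l _.
  by rewrite !add0r !mulr1 rmorphB /= !pmulrn.
have -> : \sum_(j \in [set: int]) autoconv a j * j%:~R ^+ (2 * D) *
    \int[lebesgue_measure]_(eta in `[0, 1])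
    ((1 - eta) ^+ (2 * D).-1 / ((2 * D).-1)`!%:R * `|(0%:~R + j%:~R * eta) * 1| `^ s) =
    \sum_(j \in [set: int]) autoconv a j * (kappa D s * `|j%:~R| `^ ((2 * D)%:R + s)).
  apply: eq_fsbigr => j _; rewrite -mulrA; congr (_ * _).
  have D0' : (0 < 2 * D)%N by rewrite lt0n.
  have oD : odd (2 * D).-1 by rewrite -subn1 oddB// oddM.
  under eq_Rintegral => x _.
    rewrite add0r mulr1 normrM powRM// mulrCA.
    over.
  rewrite /= RintegralZl//; last first.
    apply: continuous_compact_integrable; first exact: segment_compact.
    apply: continuous_subspaceT; exact: continuous_beta_density.
  rewrite Rintegral_beta// prednK// -/(kappa D s) mulrA mulrC; congr (_ * _).
  have [->|j0] := eqVneq (j%:~R : R) 0.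
    by rewrite normr0 expr0n mulrb !powR0 ?mulr0 ?gt_eqF// addr_gt0// ltr0n.
  rewrite powRD ?normr_eq0 ?j0 ?implybT// powR_mulrn//; congr (_ * _).
  by rewrite !exprM real_normK ?num_real.
rewrite fsbig_autoconv /sdiff mulr_sumr; congr (- _).
apply: eq_bigr => k _; rewrite mulr_sumr; apply: eq_bigr => l _.
by rewrite add0r mulr1 rmorphB /= !pmulrn mulrCA.
Qed.

End RfunAutoconv.

(** * Dominated sums *)

Section DominatedSums.
Context (R : realType).
Implicit Types (b l : nat -> R) (u : nat -> nat -> R).

(** Comparison with the antiderivative f = - x^(q+1) / c of the decreasing function x^q: the
    increments of [f] dominate the terms, telescope, and [f] is nonpositive. *)
Lemma cvg_series_powR (q : R) : q < -1 ->
  cvgn (series (fun k : nat => k.+1%:R `^ q)).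
Proof.
move=> q1; pose c := - (q + 1); have c0 : 0 < c by rewrite /c; lra.
pose f (x : R) := - c^-1 * sgpow (q + 1) 0 x.
have fd (x : R) : 0 < x -> is_derive x 1 f (x `^ q).
  move=> x0; apply: (is_derive_eq (is_derive1Z _ (@is_derive1_sgpow_pos _ (q + 1) 0 x x0))).
  rewrite /sgpow /ffactr big_ord1 subr0 expr1 gtr0_sg// mul1r (gtr0_norm x0) addrK.
  by rewrite mulrA (_ : - c^-1 * (q + 1) = 1) ?mul1r// /c; field; lra.
have step (k : nat) : k.+2%:R `^ q <= f k.+2%:R - f k.+1%:R.
  have h := @is_derive1_ge0_le _ (fun x => f x - x * k.+2%:R `^ q)
    (fun x => x `^ q - 1 * k.+2%:R `^ q) k.+1%:R k.+2%:R.
  have {}h : f k.+1%:R - k.+1%:R * k.+2%:R `^ q <= f k.+2%:R - k.+2%:R * k.+2%:R `^ q.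
    apply: h => [|z /andP[z1 _]|z /andP[z1 z2]].
    - by rewrite ler_nat.
    - have z0 : 0 < z by apply: lt_le_trans z1.
      apply: is_derive1B; first exact: fd.
      under eq_fun do rewrite mulrC.
      by rewrite mulrC; apply: is_derive1Z; exact: is_derive1_id.
    - have z0 : 0 < z by apply: lt_le_trans z1.
      rewrite mul1r subr_ge0 -[q]opprK !(powRN _ (- q)) lef_pV2 ?posrE ?powR_gt0//.
      by apply: ge0_ler_powR => //; rewrite ?nnegrE ?(ltW z0)//; lra.
  move: h; set t := _ `^ q; rewrite (_ : k.+2%:R * t = k.+1%:R * t + t); first lra.
  by rewrite -[in LHS]natr1; ring.
apply: nondecreasing_is_cvgn.
  by apply: nondecreasing_series => n _ _; exact: powR_ge0.
exists (1 + c^-1) => _ [n _ <-].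
have fneg (x : R) : f x <= 0.
  by rewrite /f mulNr oppr_le0 mulr_ge0 ?invr_ge0 ?(ltW c0)// sgpow_0 powR_ge0.
have f1 : f 1 = - c^-1 by rewrite /f sgpow_0 normr1 powR1 mulr1.
have main k : series (fun k : nat => k.+1%:R `^ q) k.+1 <= 1 + f k.+1%:R - f 1.
  elim: k => [|k IHk].
    by rewrite seriesEnat /= big_nat1 powR1; lra.
  rewrite seriesEnat /= big_nat_recr //= -/(series (fun k : nat => k.+1%:R `^ q) k.+1).
  by have := step k; rewrite seriesEnat /= in IHk; lra.
case: n => [|n]; first by rewrite seriesEnat /= big_geq// addr_ge0// invr_ge0 ltW.
by have := main n; have := fneg n.+1%:R; rewrite f1; lra.
Qed.

Lemma series_tail b (eps : R) : (forall k, 0 <= b k) -> cvgn (series b) -> 0 < eps ->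
  \forall N \near \oo, forall m : nat, (N <= m)%N -> \sum_(N <= k < m) b k <= eps.
Proof.
move=> b0 cb e0.
have /cvgrPdist_le /(_ _ e0) := cb; apply: filterS => N hN m Nm.
have nb : nondecreasing_seq (series b) by apply: nondecreasing_series => n _ _.
have h := nondecreasing_cvgn_le nb cb m.
have := sub_series_geq b Nm => <-.
move: hN; rewrite ler_norml => /andP[_].
lra.
Qed.

(** Tannery's theorem, with a number of terms [m n] that tends to infinity. *)
Lemma dominated_sum_cvg u l b (m : nat -> nat) :
  (forall k, 0 <= b k) -> cvgn (series b) -> cvgn (series l) ->
  (forall k, u n k @[n --> \oo] --> l k) ->
  (\forall n \near \oo, forall k, (k < m n)%N -> `|u n k| <= b k) ->
  m n @[n --> \oo] --> \oo ->
  \sum_(k < m n) u n k @[n --> \oo] --> limn (series l).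
Proof.
move=> b0 cb cl ul ub moo; apply/cvgrPdist_le => eps e0.
have e3 : 0 < eps / 3 by rewrite divr_gt0.
have [N [tN lN]] : exists N, (forall m : nat, (N <= m)%N -> \sum_(N <= k < m) b k <= eps / 3) /\
    `|limn (series l) - series l N| <= eps / 3.
  have h1 := series_tail b0 cb e3.
  have /cvgrPdist_le /(_ _ e3) h2 := cl.
  have [N _ /(_ N (leqnn N)) hN] := filterI h1 h2.
  by exists N; case: hN.
have fin : \sum_(k < N) u n k @[n --> \oo] --> \sum_(k < N) l k.
  by apply: cvg_sumr => k; exact: ul.
have /cvgrPdist_le /(_ _ e3) fin3 := fin.
have moo' N' : \forall n \near \oo, (N' <= m n)%N := moo _ (nbhs_infty_ge N').
near=> n.
have mN : (N <= m n)%N by near: n; exact: moo'.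
rewrite -(big_mkord xpredT (u n)) (@big_cat_nat _ _ _ N)//= big_mkord.
have -> : limn (series l) - (\sum_(i < N) u n i + \sum_(N <= i < m n) u n i) =
    (limn (series l) - series l N) + (\sum_(k < N) l k - \sum_(k < N) u n k)
    - \sum_(N <= i < m n) u n i by rewrite seriesEord /=; ring.
apply: le_trans (ler_normB _ _) _; rewrite (_ : eps = eps / 3 + eps / 3 + eps / 3); last by field.
apply: lerD; last first.
  apply: le_trans (ler_norm_sum _ _ _) _; apply: le_trans (tN _ mN).
  apply: ler_sum_nat => k /andP[_ km].
  suff : forall k, (k < m n)%N -> `|u n k| <= b k by apply.
  by near: n.
apply: le_trans (ler_normD _ _) _; apply: lerD => //.
by near: n.
Unshelve. all: by end_near. Qed.

(** This is what makes row sums negligible against the Frobenius norm: a fixed initial segment is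
    o(sqrt m), and on the rest the tail of the sum of squares is small. *)
Lemma sum_littleo_sqrt b (m : nat -> nat) :
  (forall k, 0 <= b k) -> cvgn (series (fun k => b k ^+ 2)) ->
  m n @[n --> \oo] --> \oo ->
  (\sum_(k < m n) b k) / Num.sqrt (m n)%:R @[n --> \oo] --> (0 : R).
Proof.
move=> b0 cb moo; apply/cvgrPdist_le => eps e0.
have e2 : 0 < eps / 2 by rewrite divr_gt0.
have [N _ /(_ N (leqnn N)) tN] :=
  series_tail (fun k => sqr_ge0 (b k)) cb (exprn_gt0 2 e2).
have moo' N' : \forall n \near \oo, (N' <= m n)%N := moo _ (nbhs_infty_ge N').
near=> n.
have mN : (N <= m n)%N by near: n; exact: moo'.
have m0 : (0 < m n)%N by near: n; exact: (moo' 1%N).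
set r := Num.sqrt (m n)%:R.
have r0 : 0 < r by rewrite sqrtr_gt0 ltr0n.
have r2 : r ^+ 2 = (m n)%:R by rewrite sqr_sqrtr.
rewrite sub0r normrN ger0_norm ?divr_ge0 ?sumr_ge0 ?(ltW r0)// ler_pdivrMr//.
rewrite -(big_mkord xpredT b) (@big_cat_nat _ _ _ N)//= big_mkord.
have c1 : \sum_(k < N) b k <= eps / 2 * r.
  set c := \sum_(k < N) b k; have c0 : 0 <= c by exact: sumr_ge0.
  have ce0 : 0 <= c / (eps / 2) by rewrite divr_ge0// ltW.
  rewrite -ler_pdivrMl// mulrC -(@ler_pXn2r _ 2) ?nnegrE ?(ltW r0)// r2.
  have : (c / (eps / 2)) ^+ 2 <= (Num.bound ((c / (eps / 2)) ^+ 2))%:R.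
    by apply/ltW/archi_boundP; exact: sqr_ge0.
  move=> /le_trans -> //; rewrite ler_nat; near: n; exact: moo'.
(* A linearized Cauchy-Schwarz inequality: summed over at most r^2 indices, with squares adding up
   to at most (eps / 2)^2, each term contributes [eps * r / 4]. *)
have h k : b k <= r / eps * b k ^+ 2 + eps / (4 * r).
  rewrite -subr_ge0 (_ : _ - _ = r / eps * (b k - eps / (2 * r)) ^+ 2).
    by rewrite mulr_ge0 ?sqr_ge0// divr_ge0// ltW.
  by field; rewrite !gt_eqF.
have c2 : \sum_(N <= k < m n) b k <= eps / 2 * r.
  have : \sum_(N <= k < m n) b k <= \sum_(N <= k < m n) (r / eps * b k ^+ 2 + eps / (4 * r)).
    by apply: ler_sum => k _; exact: h.
  move=> /le_trans; apply; rewrite big_split /= -mulr_sumr sumr_const_nat.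
  have -> : eps / 2 * r = r / eps * (eps / 2) ^+ 2 + eps / (4 * r) * r ^+ 2.
    by field; rewrite !gt_eqF.
  apply: lerD; first by rewrite ler_wpM2l ?tN// divr_ge0// ltW.
  rewrite r2 -[_ *+ (m n - N)]mulr_natr ler_wpM2l ?ler_nat ?leq_subr// divr_ge0 ?(ltW e0)//.
  by rewrite mulr_ge0// ltW.
lra.
Unshelve. all: by end_near. Qed.

(** The truncated sum [i - j + (j - i)] is |i - j|, and [(0 < k)%N.+1] is 1 for k = 0 and 2
    otherwise: there are m pairs at distance 0 and 2 (m - k) at distance k > 0. *)
Lemma sum_sum_dist (f : nat -> R) (m : nat) :
  \sum_(i < m) \sum_(j < m) f (i - j + (j - i))%N =
  \sum_(k < m) (0 < k)%N.+1%:R * (m - k)%:R * f k.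
Proof.
elim: m => [|m IHm]; first by rewrite !big_ord0.
have rev : \sum_(i < m) f (m - i)%N = \sum_(k < m) f k.+1.
  rewrite (reindex_inj rev_ord_inj) /=; apply: eq_bigr => k _.
  by congr f; have := ltn_ord k; lia.
rewrite big_ord_recr /=; under eq_bigr do rewrite big_ord_recr /=.
rewrite big_split /= IHm big_ord_recr /= subnn addn0.
have -> : \sum_(i < m) f (i - m + (m - i))%N = \sum_(k < m) f k.+1.
  by rewrite -rev; apply: eq_bigr => i _; congr f; have := ltn_ord i; lia.
have -> : \sum_(i < m) f (m - i + (i - m))%N = \sum_(k < m) f k.+1.
  by rewrite -rev; apply: eq_bigr => i _; congr f; have := ltn_ord i; lia.
have -> : \sum_(k < m.+1) (0 < k)%N.+1%:R * (m.+1 - k)%:R * f k =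
    \sum_(k < m.+1) ((0 < k)%N.+1%:R * (m - k)%:R * f k + (0 < k)%N.+1%:R * f k).
  apply: eq_bigr => k _; rewrite subSn; last by rewrite -ltnS.
  by rewrite -[(m - k).+1%:R]natr1; ring.
rewrite big_split /= big_ord_recr /= subnn mulr0 mul0r addr0.
rewrite [X in _ = _ + X]big_ord_recl /= mul1r.
under [X in _ = _ + (_ + X)]eq_bigr do rewrite /bump /= add1n.
rewrite -mulr_sumr; ring.
Qed.

End DominatedSums.

(** * Stationary triangular arrays *)

Lemma near_eq_cvgr (R : realType) (f g : nat -> R) (l : R) :
  (\forall n \near \oo, f n = g n) -> f n @[n --> \oo] --> l -> g n @[n --> \oo] --> l.
Proof. by move=> fg; apply: cvg_trans; exact: near_eq_cvg. Qed.

Fact dist_ltn (i j m : nat) : (i < m)%N -> (j < m)%N -> (i - j + (j - i) < m)%N.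
Proof. by lia. Qed.

Lemma cvg_inv_natr (R : realType) : n%:R^-1 @[n --> \oo] --> (0 : R).
Proof.
apply/cvgrPdist_le => eps e0; near=> n; have n0 : (0 < n)%N by near: n; exact: nbhs_infty_gt.
rewrite sub0r normrN ger0_norm ?invr_ge0// -[eps]invrK lef_pV2 ?posrE ?invr_gt0 ?ltr0n//.
apply/ltW/(lt_le_trans (archi_boundP _)); first by rewrite invr_ge0 ltW.
by rewrite ler_nat; near: n; exact: nbhs_infty_ge.
Unshelve. all: by end_near. Qed.

Section SecondMoment.
Context d (T : measurableType d) (R : realType) (P : probability T R).
Local Notation E Z := (Rintegral P [set: T] Z).

(** The integration by parts formula for the identity matrix and exponent 1. *)
Lemma mean_csum_sqr_sqr (G : (T -> R) -> Prop) (gaussG : gaussian_family P G) n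
    (X : 'I_n -> T -> R) (GX : forall i, G (X i)) :
  E (fun w => csum_sqr P X w ^+ 2) = 2 * frob (cov_mx P X).
Proof.
have aX i : all_moments P (X i) by exact: (gauss_all_moments gaussG).
have aF := all_moments_csum_sqr gaussG GX.
have := mean_qform_csum_sqr gaussG GX 1%:M 1; rewrite (qform1 P X).
rewrite mulmx1 mulr1 /=.
under [X in Rintegral _ _ X = _]eq_fun do rewrite expr1 mulrDl -expr2.
under [X in _ = _ + 2 * Rintegral _ _ X]eq_fun do rewrite expr0 mulr1.
under [X in _ = _ * Rintegral _ _ X + _]eq_fun do rewrite expr1.
rewrite (mean_csum_sqr gaussG GX) mulr0 add0r meanD; last 2 first.
- exact: all_momentsX.
- exact: all_momentsZ.
rewrite meanZ// (mean_csum_sqr gaussG GX) mulr0 addr0 => ->; congr (_ * _).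
rewrite (mean_qform gaussG GX) /frob.
by apply: eq_bigr => i _; apply: eq_bigr => j _; rewrite expr2.
Qed.

Lemma variance_affine (Y : {RV P >-> R}) (F : T -> R) (c e : R) :
  all_moments P F -> E F = 0 -> (forall w, Y w = c * F w + e) ->
  ('V_P[Y])%E = (c ^+ 2 * E (fun w => F w ^+ 2))%:E.
Proof.
move=> aF F0 YE.
have aY : all_moments P Y.
  rewrite (_ : (Y : T -> R) = (fun w => c * F w + e)); last exact/funext.
  by apply: all_momentsD; [exact: all_momentsZ|exact: all_moments_cst].
have EY : ('E_P[Y] = e%:E)%E.
  rewrite unlock; have iY := all_moments_integrable aY.
  have := @fineK _ (\int[P]_w (Y w)%:E)%E; rewrite -/(Rintegral P setT Y) => <-; last first.
    exact: integrable_fin_num.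
  rewrite (_ : (Y : T -> R) = (fun w => c * F w + e)); last exact/funext.
  rewrite meanD ?meanZ ?F0 ?mulr0 ?add0r ?mean_cst//; last exact: all_moments_cst.
  exact: all_momentsZ.
rewrite /variance covariance.unlock EY /= unlock.
transitivity (\int[P]_w (c ^+ 2 * F w ^+ 2)%:E)%E.
  apply: eq_integral => w _; congr (_%:E).
  by rewrite -[LHS]/((Y w - e) * (Y w - e)) YE; ring.
have a2 : all_moments P (fun w => c ^+ 2 * F w ^+ 2) by exact/all_momentsZ/all_momentsX.
rewrite -meanZ; last exact: all_momentsX.
rewrite /Rintegral fineK//; exact/integrable_fin_num/all_moments_integrable.
Qed.

End SecondMoment.

Lemma sum_dist_le (R : realType) (B : nat -> R) (i m : nat) : (forall k, 0 <= B k) ->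
  (i < m)%N -> \sum_(j < m) B (i - j + (j - i))%N <= 2 * \sum_(k < m) B k.
Proof.
move=> B0 im.
have tail p q : (p <= q)%N -> \sum_(0 <= k < p) B k <= \sum_(0 <= k < q) B k.
  move=> pq; rewrite (@big_cat_nat _ _ _ p 0 q)//= lerDl; exact: sumr_ge0.
rewrite -(big_mkord xpredT (fun j => B (i - j + (j - i))%N)) -(big_mkord xpredT B).
rewrite (@big_cat_nat _ _ _ i.+1)//= mulrDl !mul1r; apply: lerD.
  apply: le_trans (tail _ _ im).
  rewrite big_nat_rev /= big_nat [leRHS]big_nat le_eqVlt; apply/orP; left; apply/eqP.
  by apply: eq_bigr => j ji; congr B; lia.
rewrite -(add1n i) big_addn.
apply: (@le_trans _ _ (\sum_(1 <= k < m - i) B k)).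
  rewrite big_nat [leRHS]big_nat le_eqVlt; apply/orP; left; apply/eqP.
  by apply: eq_bigr => j ji; congr B; lia.
apply: (@le_trans _ _ (\sum_(0 <= k < m - i) B k)); last by apply: tail; exact: leq_subr.
by rewrite (@big_cat_nat _ _ _ 1 0 (m - i)) ?subn_gt0//= lerDr sumr_ge0.
Qed.

Fact sqrt_ratio (R : realType) (f m t : R) : 0 <= f -> 0 <= m -> 0 < t ->
  Num.sqrt (2 * (f / (m * t ^+ 2))) = Num.sqrt (2 * f) / (Num.sqrt m * t).
Proof.
move=> f0 m0 t0; have f20 : 0 <= 2 * f by rewrite mulr_ge0.
have mt0 : 0 <= m * t ^+ 2 by rewrite mulr_ge0// sqr_ge0.
by rewrite mulrA (sqrtrM _ f20) (sqrtrV mt0) (sqrtrM _ m0) sqrtr_sqr gtr0_norm.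
Qed.

Section StationaryArray.
Context d (T : measurableType d) (R : realType) (P : probability T R).
Local Notation E Z := (Rintegral P [set: T] Z).
Variables (G : (T -> R) -> Prop) (m : nat -> nat) (Y : forall n, 'I_(m n) -> T -> R).
Variables (tau : nat -> R) (rho : nat -> nat -> R) (g B : nat -> R).
Hypothesis gaussG : gaussian_family P G.
Hypothesis GY : forall n i, G (@Y n i).
Hypothesis covY : \forall n \near \oo, 0 < tau n /\
  forall i j, cov_mx P (@Y n) i j = tau n * rho n (i - j + (j - i))%N.
Hypothesis rho_cvg : forall k, rho n k @[n --> \oo] --> g k.
Hypothesis rho_le : \forall n \near \oo, forall k, (k < m n)%N -> `|rho n k| <= B k.
Hypothesis B_ge0 : forall k, 0 <= B k.
Hypothesis cvg_B : cvgn (series (fun k => B k ^+ 2)).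
Hypothesis m_oo : m n @[n --> \oo] --> \oo.
Hypothesis g_gt0 : 0 < g 0%N.

Local Notation F n := (csum_sqr P (@Y n)).
Local Notation frobK n := (frob (cov_mx P (@Y n))).

(** The sum of g(|k|)^2 over all integers k, the weight counting k and -k. *)
Definition corr_sum : R := limn (series (fun k => (0 < k)%N.+1%:R * g k ^+ 2)).

Let g_le k : `|g k| <= B k.
Proof.
have h : `|rho n k| @[n --> \oo] --> `|g k| by exact: cvg_norm.
apply: (ler_cvg_to h (cvg_cst _)).
have mk := m_oo (nbhs_infty_gt k).
near=> n; have kn : (k < m n)%N by near: n; exact: mk.
suff : forall k, (k < m n)%N -> `|rho n k| <= B k by apply.
by near: n.
Unshelve. all: by end_near. Qed.

Let dom2 (c x b : R) : 0 <= c -> c <= 2 -> `|x| <= b -> `|c * x ^+ 2| <= 2 * b ^+ 2.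
Proof.
move=> c0 c2 xb; rewrite normrM (ger0_norm c0) normrX; apply: ler_pM => //.
by apply: lerXn2r; rewrite ?nnegrE// (le_trans _ xb).
Qed.

Let cvg_2B : cvgn (series (fun k => 2 * B k ^+ 2)).
Proof. exact: (@is_cvg_seriesZ _ (fun k => B k ^+ 2) 2 cvg_B). Qed.

Let weight_le k : (0 < k)%N.+1%:R <= 2 :> R.
Proof. by rewrite ler_nat; case: k. Qed.

Lemma cvg_corr_sum : cvgn (series (fun k => (0 < k)%N.+1%:R * g k ^+ 2)).
Proof.
apply: (series_le_cvg _ _ _ cvg_2B) => k; first by rewrite mulr_ge0// sqr_ge0.
  by rewrite mulr_ge0// sqr_ge0.
by apply: le_trans (dom2 _ (weight_le k) (@g_le k)); rewrite ?ler_norm.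
Qed.

Lemma corr_sum_gt0 : 0 < corr_sum.
Proof.
apply: (@lt_le_trans _ _ (g 0%N ^+ 2)); first by rewrite exprn_gt0.
have nb : nondecreasing_seq (series (fun k => (0 < k)%N.+1%:R * g k ^+ 2)).
  by apply: nondecreasing_series => n _ _; rewrite mulr_ge0// sqr_ge0.
have := nondecreasing_cvgn_le nb cvg_corr_sum 1%N.
by rewrite /series /= big_nat1 mul1r.
Qed.

Let m_gt0 : \forall n \near \oo, (0 < m n)%N. Proof. exact: m_oo (nbhs_infty_gt 0). Qed.

Let cvg_inv_m : (m n)%:R^-1 @[n --> \oo] --> (0 : R).
Proof. exact: cvg_comp m_oo (@cvg_inv_natr R). Qed.

Lemma cvg_frob_cov_mx :
  frobK n / ((m n)%:R * tau n ^+ 2) @[n --> \oo] --> corr_sum.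
Proof.
(* By [sum_sum_dist], 1 - k / m is the weight of lag k relative to its limit. *)
have := @dominated_sum_cvg _ (fun n k => (0 < k)%N.+1%:R * (1 - k%:R / (m n)%:R) * rho n k ^+ 2)
  _ _ m _ cvg_2B cvg_corr_sum _ _ m_oo.
have minv := cvg_inv_m.
have /[swap] /[apply] : forall k, 0 <= 2 * B k ^+ 2 by move=> k; rewrite mulr_ge0// sqr_ge0.
have /[swap] /[apply] : forall k,
    (0 < k)%N.+1%:R * (1 - k%:R / (m n)%:R) * rho n k ^+ 2 @[n --> \oo] -->
    (0 < k)%N.+1%:R * g k ^+ 2.
  move=> k; have {2}-> : (0 < k)%N.+1%:R = (0 < k)%N.+1%:R * (1 - k%:R * 0) :> R by ring.
  apply: cvgM; last by rewrite expr2; under eq_fun do rewrite expr2; exact: cvgM.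
  apply: cvgM; first exact: cvg_cst.
  by apply: cvgB; [exact: cvg_cst|apply: cvgM => //; exact: cvg_cst].
have /[swap] /[apply] : \forall n \near \oo, forall k, (k < m n)%N ->
    `|(0 < k)%N.+1%:R * (1 - k%:R / (m n)%:R) * rho n k ^+ 2| <= 2 * B k ^+ 2.
  near=> n => k km; have m0 : 0 < (m n)%:R :> R by rewrite ltr0n; lia.
  apply: dom2.
  - by rewrite mulr_ge0// subr_ge0 ler_pdivrMr// mul1r ler_nat ltnW.
  - rewrite -[leRHS]mulr1; apply: ler_pM => //.
    by rewrite subr_ge0 ler_pdivrMr// mul1r ler_nat ltnW.
  - by move: k km; near: n.
apply: cvg_trans; apply: near_eq_cvg.
near=> n.
have [t0 KE] : 0 < tau n /\
  forall i j, cov_mx P (@Y n) i j = tau n * rho n (i - j + (j - i))%N by near: n.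
have m0 : (0 < m n)%N by near: n; exact: m_gt0.
have -> : frobK n = tau n ^+ 2 * \sum_(i < m n) \sum_(j < m n) rho n (i - j + (j - i))%N ^+ 2.
  rewrite mulr_sumr; apply: eq_bigr => i _; rewrite mulr_sumr; apply: eq_bigr => j _.
  by rewrite KE exprMn.
rewrite (sum_sum_dist (fun k => rho n k ^+ 2)) [_ * tau n ^+ 2]mulrC.
rewrite -mulf_div divff ?mul1r; last first.
  by rewrite expf_neq0// gt_eqF.
rewrite mulr_suml; apply: eq_bigr => k _; rewrite natrB; last by rewrite ltnW.
by field; rewrite pnatr_eq0 -lt0n.
Unshelve. all: by end_near. Qed.

(** Dividing the estimate of [mean_csum_sqr_exp] by sig^(k+2) leaves a constant times lam / sig. In
    the scale sqrt(m) tau, [sig] has a positive limit and [lam] tends to 0. *)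
Lemma cvg_standardized_csum_sqr k :
  E (fun w => (F n w / Num.sqrt (2 * frobK n)) ^+ k.+2) -
  k.+1%:R * E (fun w => (F n w / Num.sqrt (2 * frobK n)) ^+ k) @[n --> \oo] --> (0 : R).
Proof.
(* The factor 2 accounts for the two sides of the diagonal, and the summand 1 keeps [lam] positive
   in all cases. *)
pose lam n := tau n * (1 + 2 * \sum_(k < m n) B k).
pose sig n := Num.sqrt (2 * frobK n).
have S0 := corr_sum_gt0.
have frobS := cvg_frob_cov_mx.
have lamsig : lam n / sig n @[n --> \oo] --> (0 : R).
  have h1 : (1 + 2 * \sum_(k < m n) B k) / Num.sqrt (m n)%:R @[n --> \oo] --> (0 : R).
    have e0 : Num.sqrt 0 + 2 * 0 = 0 :> R by rewrite sqrtr0 mulr0 addr0.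
    rewrite -[X in _ --> X]e0 (_ : (fun n => (1 + 2 * \sum_(k < m n) B k) / Num.sqrt (m n)%:R) =
      (fun n => Num.sqrt ((m n)%:R^-1) +
        2 * ((\sum_(k < m n) B k) / Num.sqrt (m n)%:R))); last first.
      by apply/funext => n; rewrite mulrDl mul1r mulrA sqrtrV.
    apply: cvgD; first by apply: continuous_cvg => //; exact: sqrt_continuous.
    by apply: cvgM; [exact: cvg_cst|exact: sum_littleo_sqrt].
  have h2 : (Num.sqrt (2 * (frobK n / ((m n)%:R * tau n ^+ 2))))^-1 @[n --> \oo] -->
      (Num.sqrt (2 * corr_sum))^-1.
    apply: cvgV; first by rewrite gt_eqF// sqrtr_gt0 mulr_gt0.
    apply: continuous_cvg; first exact: sqrt_continuous.
    by apply: cvgM => //; exact: cvg_cst.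
  rewrite -[X in _ --> X](mul0r (Num.sqrt (2 * corr_sum))^-1).
  apply: near_eq_cvgr (cvgM h1 h2).
  near=> n.
  have t0 : 0 < tau n by near: n; apply: filterS covY => n [].
  have m0 : (0 < m n)%N by near: n; exact: m_gt0.
  have -> : Num.sqrt (2 * (frobK n / ((m n)%:R * tau n ^+ 2))) =
      sig n / (Num.sqrt (m n)%:R * tau n).
    by apply: sqrt_ratio => //; exact: frob_ge0.
  rewrite /lam invfM invrK.
  have : Num.sqrt (m n)%:R != 0 :> R by rewrite gt_eqF// sqrtr_gt0 ltr0n.
  by move: (Num.sqrt _) ((sig n)^-1) (\sum_(k0 < _) _) => u v w u0; field.
pose c : R := 2 * k.+1%:R * (3 ^+ k * k`!%:R).
have c0 : 0 <= c by rewrite !mulr_ge0// exprn_ge0.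
have cls x : c * (lam n / sig n) * x @[n --> \oo] --> (0 : R).
  have -> : (0 : R) = c * 0 * x by rewrite mulr0 mul0r.
  by apply: cvgM; [apply: cvgM => //; exact: cvg_cst|exact: cvg_cst].
apply: (squeeze_cvgr _ (cls (-1)) (cls 1)).
have ls1 : \forall n \near \oo, lam n / sig n < 1.
  by apply: (cvgr_lt 0) => //; exact: ltr01.
have fpos : \forall n \near \oo, 0 < frobK n / ((m n)%:R * tau n ^+ 2).
  exact: (cvgr_gt corr_sum).
near=> n.
have [t0 KE] : 0 < tau n /\
  forall i j, cov_mx P (@Y n) i j = tau n * rho n (i - j + (j - i))%N by near: n.
have m0 : (0 < m n)%N by near: n; exact: m_gt0.
have rB k' : (k' < m n)%N -> `|rho n k'| <= B k' by move: k'; near: n.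
have sB : 0 <= \sum_(k < m n) B k by exact: sumr_ge0.
have l0 : 0 < lam n by rewrite mulr_gt0// ltr_pwDl// mulr_ge0.
have f0 : 0 < frobK n.
  have : 0 < frobK n / ((m n)%:R * tau n ^+ 2) by near: n.
  by rewrite pmulr_lgt0// invr_gt0 mulr_gt0 ?ltr0n// exprn_gt0.
have s0 : 0 < sig n by rewrite sqrtr_gt0 mulr_gt0.
have ls : lam n <= sig n by rewrite -[sig n]mul1r -ler_pdivrMr// ltW//; near: n.
have row (i : 'I_(m n)) : \sum_j `|cov_mx P (@Y n) i j| <= lam n.
  rewrite /lam mulrDr mulr1; apply: (@le_trans _ _ (tau n * (2 * \sum_(k < m n) B k))); last first.
    by rewrite lerDr ltW.
  apply: le_trans (ler_wpM2l (ltW t0) (sum_dist_le B_ge0 (ltn_ord i))).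
  rewrite mulr_sumr; apply: ler_sum => j _; rewrite KE normrM gtr0_norm// ler_wpM2l ?(ltW t0)//.
  by apply: rB; exact: dist_ltn.
have := mean_csum_sqr_exp gaussG (@GY n) k l0 row _ (erefl (sig n)).
have -> : lam n ^+ 2 <= 2 * frobK n.
  rewrite -[leRHS]sqr_sqrtr ?mulr_ge0 ?frob_ge0//.
  by apply: (lerXn2r 2 _ _ ls); rewrite nnegrE ltW.
move=> /(_ isT); rewrite -/(sig n) -/c.
have EZ j : E (fun w => (F n w / sig n) ^+ j) = sig n ^- j * E (fun w => F n w ^+ j).
  rewrite -meanZ; last exact/all_momentsX/(all_moments_csum_sqr gaussG).
  by apply: eq_Rintegral => w _; rewrite exprMn exprVn mulrC.
rewrite -/(sig n) !EZ; set e2 := E _; set e1 := E _ => h.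
have -> : sig n ^- k.+2 * e2 - k.+1%:R * (sig n ^- k * e1) =
    sig n ^- k.+2 * (e2 - k.+1%:R * sig n ^+ 2 * e1).
  have sn0 : sig n != 0 by rewrite gt_eqF.
  rewrite !exprS expr0; move: (expf_neq0 k sn0) (sn0); move: (sig n ^+ k) (k.+1%:R) (sig n).
  by move=> u v t u0 t0'; field; rewrite u0 t0'.
rewrite mulrN1 mulr1 -ler_norml normrM ger0_norm ?invr_ge0 ?exprn_ge0 ?(ltW s0)//.
rewrite ler_pdivrMl ?exprn_gt0//; apply: (le_trans h).
rewrite le_eqVlt; apply/orP; left; apply/eqP; rewrite !exprS.
have sn0 : sig n != 0 by rewrite gt_eqF.
by move: (c) (sig n ^+ k) (lam n) sn0; move: (sig n) => t c' u v t0'; field.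
Unshelve. all: by end_near. Qed.

End StationaryArray.

(** * Covariances of the discrete differences *)

Section Covariance.
Context d (T : measurableType d) (R : realType) (P : probability T R).
Variables (X : R -> {RV P >-> R}) (V : R -> R) (a : seq R) (alpha : R).
Hypotheses (gX : gaussian_process X) (cX : centered X) (VX : is_semivariogram X V).
Hypothesis a_sum0 : \sum_(j < size a) a`_j = 0.
Local Notation E Z := (Rintegral P [set: T] Z).
Local Notation dl n := (mesh alpha n).

Let aX t : all_moments P (X t).
Proof. exact: gaussian_process_all_moments. Qed.

Lemma mean_increment_sqr t u : E (fun w => (X t w - X u w) ^+ 2) = 2 * V (t - u).
Proof.
have := VX u (t - u); rewrite (addrC u) subrK unlock => h.
have iX : P.-integrable [set: T] (EFin \o (fun w => (X t w - X u w) ^+ 2)).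
  exact/all_moments_integrable/all_momentsX/all_momentsB.
have h2 : (\int[P]_w ((X t w - X u w) ^+ 2)%:E)%E = (E (fun w => (X t w - X u w) ^+ 2))%:E.
  by rewrite /Rintegral fineK// integrable_fin_num.
by move: h; rewrite h2 -EFinM => -[->]; rewrite mulrA divff// mul1r.
Qed.

Lemma mean_increment_mul t u z :
  E (fun w => (X t w - X z w) * (X u w - X z w)) = V (t - z) + V (u - z) - V (t - u).
Proof.
have e w : (X t w - X z w) * (X u w - X z w) =
    2^-1 * ((X t w - X z w) ^+ 2 + (X u w - X z w) ^+ 2 - (X t w - X u w) ^+ 2) by field.
under eq_Rintegral => w _ do rewrite e.
have aB t' u' : all_moments P (fun w => (X t' w - X u' w) ^+ 2) by exact/all_momentsX/all_momentsB.
rewrite meanZ; last by apply: all_momentsB => //; exact: all_momentsD.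
rewrite meanB//; last exact: all_momentsD.
by rewrite meanD// !mean_increment_sqr; field.
Qed.

Lemma adiffE n i w :
  adiff X a alpha n i w = \sum_(k < size a) a`_k * (X ((i + k)%:R * dl n) w - X 0 w).
Proof.
under [RHS]eq_bigr do rewrite mulrBr.
by rewrite sumrB -mulr_suml a_sum0 mul0r subr0.
Qed.

Lemma lincomb_adiff n i : lincomb X (adiff X a alpha n i).
Proof.
exists [seq (a`_k, (i + k)%:R * dl n) | k <- index_iota 0 (size a)].
by apply/funext => w; rewrite big_map /= big_mkord.
Qed.

(** Since [a] sums to zero, X may be replaced by X - X(0), whose products have means given by [V]
    through polarization; of the three resulting terms, the two that depend on one summation index
    only vanish for the same reason. *)
Lemma mean_adiff_mul n i j :
  E (fun w => adiff X a alpha n i w * adiff X a alpha n j w) =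
  - sdiff a V ((i%:R - j%:R) * dl n) (dl n).
Proof.
pose Y k w := X (k%:R * dl n) w - X 0 w.
have aY k : all_moments P (Y k) by exact: all_momentsB.
under eq_Rintegral => w _.
  rewrite !adiffE big_distrlr /=.
  over.
rewrite mean_sum; last first.
  by move=> k; apply: all_moments_sum => l; apply: all_momentsM; exact/all_momentsZ/aY.
under eq_bigr => k _.
  rewrite mean_sum; last by move=> l; apply: all_momentsM; exact/all_momentsZ/aY.
  under eq_bigr => l _.
    under eq_Rintegral => w _ do rewrite mulrACA.
    rewrite meanZ; last by apply: all_momentsM; exact: aY.
    rewrite mean_increment_mul !subr0 mulrBr mulrDr.
    over.
  rewrite sumrB big_split /= -mulr_suml.
  over.
rewrite sumrB big_split /=.
have -> : \sum_(k < size a) (\sum_(l < size a) a`_k * a`_l) * V ((i + k)%:R * dl n) = 0.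
  by apply: big1 => k _; rewrite -mulr_sumr a_sum0 mulr0 mul0r.
rewrite add0r exchange_big /= big1 ?add0r; last first.
  by move=> l _; under eq_bigr do rewrite -mulrA; rewrite -mulr_suml a_sum0 mul0r.
congr (- _); apply: eq_bigr => k _; apply: eq_bigr => l _; congr (_ * V _).
by rewrite !natrD; ring.
Qed.

End Covariance.

Section Mesh.
Context (R : realType) (alpha : R).
Hypothesis alpha_gt0 : 0 < alpha.
Local Notation dl n := (mesh alpha n).

Lemma mesh_gt0 n : (0 < n)%N -> 0 < dl n.
Proof. by move=> n0; rewrite powR_gt0// ltr0n. Qed.

Lemma mesh_le1 n : (0 < n)%N -> dl n <= 1.
Proof.
move=> n0; rewrite /mesh powRN invf_le1 ?powR_gt0 ?ltr0n//.
have h : 1 `^ alpha <= n%:R `^ alpha :> R.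
  by apply: ge0_ler_powR; rewrite ?nnegrE ?ler1n// ltW.
by rewrite powR1 in h.
Qed.

Lemma mesh_lt eps : 0 < eps -> \forall n \near \oo, dl n < eps.
Proof.
move=> e0; pose x := eps `^ (- alpha^-1).
have x0 : 0 < x by rewrite powR_gt0.
near=> n.
have nx : x < n%:R.
  apply: (lt_le_trans (archi_boundP (ltW x0))); rewrite ler_nat.
  by near: n; exact: nbhs_infty_ge.
have -> : eps = x `^ (- alpha).
  by rewrite -powRrM mulrNN mulVf ?gt_eqF// powRr1// ltW.
rewrite /mesh !powRN ltf_pV2 ?posrE ?powR_gt0//; last exact: lt_trans nx.
by apply: gt0_ltr_powR; rewrite // nnegrE ltW// (lt_trans x0).
Unshelve. all: by end_near. Qed.

Lemma mesh_powR n (t : R) : dl n `^ t = n%:R `^ (- (alpha * t)).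
Proof. by rewrite /mesh -powRrM mulNr. Qed.

End Mesh.

(** * Limit and domination of the rescaled covariances *)

Section Correlations.
Context (R : realType) (V r : R -> R) (alpha : R) (D : nat) (C s : R) (a : seq R) (M : nat).
Hypothesis alpha_gt0 : 0 < alpha.
Hypothesis V_smooth : smooth_on [set x | 0 < x] V.
Hypothesis V_derivable : times_derivable (2 * D)%N V.
Hypothesis s_gt0 : 0 < s.
Hypothesis V_expansion : forall h : R,
  derive1n (2 * D)%N V h =
  derive1n (2 * D)%N V 0 + C * (-1) ^+ D * `|h| `^ s + r h.
Hypothesis aM : is_order a M.
Hypothesis DM : (D < M)%N.
Hypothesis L_gt0 : (0 < size a)%N.

Local Notation L := (size a).
Local Notation dl n := (mesh alpha n).
Let p : R := (2 * D)%N%:R + s.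
Local Notation W := (fun y : R => `|y| `^ p).
Local Notation res x dl := (sdiff a (resid V D C s 0) x dl).

(** The covariance at lag k of unit-step differences under the pure power semi-variogram C (-1)^D
    kappa |h|^p. By homogeneity, this part of the covariance scales exactly as delta_n^p. *)
Definition limit_corr (k : nat) : R :=
  - (C * (-1) ^+ D * kappa D s * sdiff a W k%:R 1).

(* The covariance of two a-differences at distance [k], divided by delta_n^p. *)
Definition corr (n k : nat) : R := - sdiff a V (k%:R * dl n) (dl n) / dl n `^ p.

Lemma corrE n k : (0 < n)%N ->
  corr n k = limit_corr k - res (k%:R * dl n) (dl n) / dl n `^ p.
Proof.
move=> n0; have d0 := mesh_gt0 alpha n0.
rewrite /corr (sdiff_semivariogram V C s aM DM) sdiff_scale_pow ?(ltW d0)// /limit_corr.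
have : dl n `^ p != 0 by rewrite gt_eqF// powR_gt0.
by rewrite -/p; move: (_ `^ _) (sdiff a W _ _) (res _ _) => u v w u0; field.
Qed.

Lemma resid_near n k (eps rho t : R) : (0 < n)%N -> 0 <= eps -> 0 <= t ->
  (k + L)%:R * dl n < rho -> (forall z, `|z| < rho -> `|r z| <= eps * `|z| `^ t) ->
  `|res (k%:R * dl n) (dl n)| / dl n `^ ((2 * D)%:R + t) <=
    eps * (asum a ^+ 2 * (k + L)%:R `^ ((2 * D)%:R + t)).
Proof.
move=> n0 e0 t0 kL rb; have d0 := mesh_gt0 alpha n0.
have kp : 0 < (k + L)%:R :> R by rewrite ltr0n; lia.
rewrite ler_pdivrMr ?(powR_gt0 _ d0)//.
apply: le_trans (sdiff_resid_near0 s_gt0 V_derivable V_expansion aM DM d0 e0 t0 kL rb) _.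
set x := (k + L)%:R * dl n; have x0 : 0 < x by rewrite mulr_gt0.
have -> : eps * x `^ t * x ^+ (2 * D) =
    eps * ((k + L)%:R `^ ((2 * D)%:R + t) * dl n `^ ((2 * D)%:R + t)).
  rewrite -powRM ?(ltW d0) ?(ltW kp)// -/x powRD ?(gt_eqF x0) ?implybT//.
  by rewrite powR_mulrn ?(ltW x0)//; ring.
by rewrite le_eqVlt; apply/orP; left; apply/eqP; ring.
Qed.

(** Used with t = s for the limit of the correlations and with t = s + 1 / (2 alpha) for the
    bias. *)
Lemma cvg_resid k (t : R) : 0 <= t -> r =o_ (0 : R) (fun h : R => `|h| `^ t) ->
  res (k%:R * dl n) (dl n) / dl n `^ ((2 * D)%:R + t) @[n --> \oo] --> (0 : R).
Proof.
move=> t0 ro; apply/cvgrPdist_le => eps e0.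
have kp : 0 < (k + L)%:R :> R by rewrite ltr0n; lia.
pose c := 1 + asum a ^+ 2 * (k + L)%:R `^ ((2 * D)%:R + t).
have c1 : 0 <= asum a ^+ 2 * (k + L)%:R `^ ((2 * D)%:R + t) by rewrite mulr_ge0 ?sqr_ge0 ?powR_ge0.
have c0 : 0 < c by rewrite /c ltr_pwDl.
have [rho [rho0 rb]] := littleo_bound ro (divr_gt0 e0 c0).
have small := mesh_lt alpha_gt0 (divr_gt0 rho0 kp).
near=> n; have n0 : (0 < n)%N by near: n; exact: nbhs_infty_gt.
rewrite sub0r normrN normrM normfV [`|dl n `^ _|]ger0_norm ?powR_ge0//.
have kL : (k + L)%:R * dl n < rho by rewrite mulrC -ltr_pdivlMr//; near: n.
have e1 : 0 <= eps / c by rewrite divr_ge0// ltW.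
have rb' z : `|z| < rho -> `|r z| <= eps / c * `|z| `^ t.
  by move=> /rb; rewrite (ger0_norm (powR_ge0 _ _)).
apply: le_trans (resid_near n0 e1 t0 kL rb') _.
rewrite mulrAC ler_pdivrMr// ler_wpM2l ?(ltW e0)// /c; lra.
Unshelve. all: by end_near. Qed.

Lemma cvg_corr k : r =o_ (0 : R) (fun h : R => `|h| `^ s) ->
  corr n k @[n --> \oo] --> limit_corr k.
Proof.
move=> ro; rewrite -[X in _ --> X]subr0.
have h := cvg_resid k (ltW s_gt0) ro.
have n0 : \forall n \near \oo, (0 < n)%N by exact: nbhs_infty_gt.
apply: (@near_eq_cvgr _ (fun n => limit_corr k - res (k%:R * dl n) (dl n) / dl n `^ p)).
  by near=> n; rewrite corrE//; near: n.
by apply: cvgB => //; exact: cvg_cst.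
Unshelve. all: by end_near. Qed.

(** The falling factorial of p of length 2M vanishes only if p is one of the integers below 2M; as
    2D < p < 2D + 2, this forces s = 1, and then p is odd. *)
Lemma limit_corr_neq0 : C != 0 -> s < 2 -> p <= (2 * M)%:R -> trimmed a -> (1 < L)%N ->
  exists k, limit_corr k != 0.
Proof.
move=> C0 s2 pM ta L1.
suff [k hk] : exists k : nat, sdiff a W k%:R 1 != 0.
  by exists k; rewrite oppr_eq0 !mulf_neq0// ?signr_eq0// gt_eqF// kappa_gt0.
have [s1|s1] := eqVneq s 1.
  exists (L - 2)%N; apply: (@sdiff_pow_odd_neq0 _ a M p aM L_gt0 (2 * D).+1) => //.
  - by rewrite /p s1 natr1.
  - by rewrite /= oddM.
  - lia.
apply: (sdiff_pow_neq0 aM L_gt0 pM); apply/prodf_neq0 => j _; rewrite subr_eq0.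
apply/negP => /eqP pj; case/eqP : s1.
have : (2 * D < j)%N by rewrite -(ltr_nat R) -pj /p ltrDl.
have : (j < 2 * D + 2)%N by rewrite -(ltr_nat R) -pj /p natrD ltrD2l.
move=> h1 h2; have jE : nat_of_ord j = (2 * D).+1 by lia.
by move: pj; rewrite /p jE -natr1 => /addrI.
Qed.

Lemma corr_dominated d (beta K' : R) :
  r =o_ (0 : R) (fun h : R => `|h| `^ s) -> alpha <= 1 ->
  (0 < d)%N -> (2 * D + d <= 2 * M)%N -> p - (2 * M)%:R < - (1 / 2) ->
  s - d%:R < beta -> beta < - (1 / 2) ->
  (alpha = 1 -> forall h : R, 0 < `|h| < 1 -> `|derive1n d r h| <= K' * `|h| `^ beta) ->
  (alpha < 1 -> forall h : R, h != 0 -> `|derive1n d r h| <= K' * `|h| `^ beta) ->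
  exists c e : R, [/\ 0 <= c, e < - (1 / 2) &
    \forall n \near \oo, forall k, (k < n.+1 - L)%N -> `|corr n k| <= c * k.+1%:R `^ e].
Proof.
move=> ro a1 d0 dM pM sb b0 r1 r2.
(* The first exponent is the decay of the limiting correlations, the second that of the residual
   part. *)
pose e := Num.max (p - (2 * M)%:R) beta.
have e0 : e < - (1 / 2) by rewrite gt_max pM.
have b0' : beta <= 0 by lra.
have pM0 : p <= (2 * M)%:R by lra.
(* For k >= L one has k + 1 <= (L + 1) (k - L + 1), so the shift of the index costs only a
   constant. *)
have shift q k : q <= e -> q <= 0 -> (L <= k)%N ->
    (k - L.-1)%:R `^ q <= (L.+1)%:R `^ (- q) * k.+1%:R `^ e.
  move=> qe q0 Lk.
  have x0 : 0 < (k - L.-1)%:R :> R by rewrite ltr0n subn_gt0 prednK.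
  apply: (@le_trans _ _ (L.+1%:R `^ (- q) * k.+1%:R `^ q)); last first.
    rewrite ler_wpM2l ?powR_ge0//; apply: ler_powR => //.
    by rewrite ler1n.
  rewrite powRN ler_pdivlMl ?powR_gt0// -powRM//.
  apply: ler_powR_npos => //.
  rewrite -natrM ler_nat; have := L_gt0; move: Lk; clear; nia.
have [c1 [c10 far1]] : exists c, 0 <= c /\
    forall k, (L <= k)%N -> `|limit_corr k| <= c * k.+1%:R `^ e.
  pose c := `|C * (-1) ^+ D * kappa D s| * (asum a ^+ 2 *
    (`|ffactr p (2 * M)| * (L.-1%:R * 1) ^+ (2 * M) / (2 * M)`!%:R)).
  have c0 : 0 <= c.
    rewrite mulr_ge0// mulr_ge0 ?sqr_ge0// divr_ge0// mulr_ge0// exprn_ge0// mulr_ge0//.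
  exists (c * L.+1%:R `^ (- (p - (2 * M)%:R))); split; first by rewrite mulr_ge0// powR_ge0.
  move=> k Lk; rewrite /limit_corr normrN normrM.
  apply: (@le_trans _ _ (c * (k - L.-1)%:R `^ (p - (2 * M)%:R))); last first.
    rewrite -[leRHS]mulrA; apply: (ler_wpM2l c0); apply: shift => //.
      by rewrite /e le_max lexx.
    by rewrite subr_le0.
  rewrite /c -[leRHS]mulrA; apply: ler_wpM2l => //.
  apply: le_trans (sdiff_pow_le aM L_gt0 pM0 Lk) _.
  by rewrite le_eqVlt; apply/orP; left; apply/eqP; move: (_^-1) (_ `^ _) => u v; ring.
have [c2 [c20 far2]] : exists c, 0 <= c /\ \forall n \near \oo, forall k,
    (L <= k)%N -> (k < n.+1 - L)%N ->
    `|res (k%:R * dl n) (dl n)| / dl n `^ p <= c * k.+1%:R `^ e.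
  pose c := asum a ^+ 2 * (`|K'| * L.-1%:R ^+ (2 * D + d) / (2 * D + d)`!%:R).
  have c0 : 0 <= c by rewrite mulr_ge0 ?sqr_ge0// divr_ge0// mulr_ge0// exprn_ge0.
  exists (c * L.+1%:R `^ (- beta)); split; first by rewrite mulr_ge0// powR_ge0.
  near=> n => k Lk kn.
  have n0 : (0 < n)%N by near: n; exact: nbhs_infty_gt.
  have dn0 := mesh_gt0 alpha n0; have dn1 := mesh_le1 alpha_gt0 n0.
  have k0 : 0 < (k - L.-1)%:R :> R by rewrite ltr0n subn_gt0 prednK.
  have rb z : 0 < z <= (k + L.-1)%:R * dl n -> `|derive1n d r z| <= `|K'| * `|z| `^ beta.
    move=> /andP[z0 z1]; apply: (@le_trans _ _ (K' * `|z| `^ beta)); last first.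
      by rewrite ler_wpM2r ?powR_ge0// ler_norm.
    (* For alpha = 1 the bound on the derivative is available below 1 only; k < n + 1 - L gives (k +
       L - 1) / n < 1. *)
    have [a_1|/eqP a_1] := eqVneq alpha 1; last first.
      apply: r2; first by rewrite lt_neqAle a1 andbT; apply/eqP.
      by rewrite gt_eqF.
    apply: r1 => //; rewrite gtr0_norm// z0; apply: le_lt_trans z1 _.
    rewrite /mesh a_1 powRN powRr1// ltr_pdivrMr ?ltr0n// mul1r ltr_nat.
    by move: kn; rewrite ltn_subRL ltnS addnC -addnS prednK.
  rewrite ler_pdivrMr ?(powR_gt0 _ dn0)//.
  apply: le_trans (sdiff_resid_far s_gt0 V_smooth V_derivable V_expansion aM DM L_gt0
    dn0 Lk d0 dM b0' rb) _.
  rewrite powRM ?(ltW k0) ?(ltW dn0)// exprMn.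
  (* Here s - d < beta is used: the exponent beta + 2D + d exceeds p, and the mesh is at most 1. *)
  have dd : dl n `^ beta * dl n ^+ (2 * D + d) <= dl n `^ p.
    rewrite -powR_mulrn ?(ltW dn0)// -powRD ?(gt_eqF dn0) ?implybT//.
    apply: ger_powR; first by rewrite dn0.
    by rewrite /p natrD; lra.
  apply: (@le_trans _ _ (c * (k - L.-1)%:R `^ beta * (dl n `^ beta * dl n ^+ (2 * D + d)))).
    by rewrite le_eqVlt; apply/orP; left; apply/eqP; rewrite /c; move: (_^-1) (_ `^ _) => u v; ring.
  apply: ler_pM => //; first exact: mulr_ge0 c0 (powR_ge0 _ _).
    by apply: mulr_ge0; rewrite ?powR_ge0// exprn_ge0// ltW.
  rewrite -[leRHS]mulrA; apply: (ler_wpM2l c0); apply: shift => //.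
  by rewrite /e le_max lexx orbT.
have [c3 [c30 near3]] : exists c, 0 <= c /\ \forall n \near \oo, forall k,
    (k < L)%N -> `|corr n k| <= c * k.+1%:R `^ e.
  pose c := \sum_(k < L) `|limit_corr k| + asum a ^+ 2 * (2 * L)%:R `^ p.
  have c0 : 0 <= c by rewrite addr_ge0 ?sumr_ge0// mulr_ge0 ?sqr_ge0 ?powR_ge0.
  exists (c * L%:R `^ (- e)); split; first by rewrite mulr_ge0// powR_ge0.
  have [rho [rho0 rb]] := littleo_bound ro ltr01.
  have Lp : 0 < (2 * L)%:R :> R by rewrite ltr0n muln_gt0.
  have small := mesh_lt alpha_gt0 (divr_gt0 rho0 Lp).
  near=> n => k kL.
  have n0 : (0 < n)%N by near: n; exact: nbhs_infty_gt.
  have dn0 := mesh_gt0 alpha n0.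
  have klL : (k + L)%:R <= (2 * L)%:R :> R by rewrite ler_nat mul2n -addnn leq_add2r ltnW.
  have kLr : (k + L)%:R * dl n < rho.
    apply: (@le_lt_trans _ _ ((2 * L)%:R * dl n)); first by rewrite ler_wpM2r// ltW.
    by rewrite mulrC -ltr_pdivlMr//; near: n.
  have rb' z : `|z| < rho -> `|r z| <= 1 * `|z| `^ s.
    by move=> /rb; rewrite (ger0_norm (powR_ge0 _ _)).
  have h := resid_near n0 ler01 (ltW s_gt0) kLr rb'.
  have h2 : `|limit_corr k| <= \sum_(k < L) `|limit_corr k|.
    by rewrite (bigD1 (Ordinal kL))//= lerDl sumr_ge0.
  apply: (@le_trans _ _ (c * 1)); last first.
    rewrite -[leRHS]mulrA; apply: (ler_wpM2l c0).
    rewrite powRN mulrC ler_pdivlMr ?mul1r ?powR_gt0 ?ltr0n//.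
    by apply: ler_powR_npos; rewrite ?ler_nat//; lra.
  rewrite mulr1 corrE//; apply: le_trans (ler_normB _ _) _; apply: lerD => //.
  rewrite normrM normfV [`|dl n `^ _|]ger0_norm ?powR_ge0//.
  apply: le_trans h _; rewrite mul1r ler_wpM2l ?sqr_ge0//.
  by apply: ge0_ler_powR; rewrite ?nnegrE// addr_ge0// ltW.
exists (c1 + c2 + c3), e; split => //; first by rewrite !addr_ge0.
near=> n => k kn.
have n0 : (0 < n)%N by near: n; exact: nbhs_infty_gt.
have ke : 0 <= k.+1%:R `^ e by exact: powR_ge0.
rewrite !mulrDl.
have [kL|Lk] := ltnP k L.
  have : `|corr n k| <= c3 * k.+1%:R `^ e by move: k kL {kn ke}; near: n.
  move=> /le_trans; apply; rewrite lerDr addr_ge0 ?mulr_ge0//.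
have h1 := far1 k Lk.
have h2 : `|res (k%:R * dl n) (dl n)| / dl n `^ p <= c2 * k.+1%:R `^ e.
  by move: k Lk kn {ke h1}; near: n.
rewrite corrE//; apply: le_trans (ler_normB _ _) _.
rewrite normrM normfV [`|dl n `^ _|]ger0_norm ?powR_ge0//.
apply: le_trans (lerD h1 h2) _; rewrite lerDl mulr_ge0//.
Unshelve. all: by end_near. Qed.

End Correlations.

(** * The estimator *)

Lemma size_gt1 (R : realType) (a : seq R) : trimmed a -> \sum_(j < size a) a`_j = 0 ->
  (1 < size a)%N.
Proof.
case: a => [|x [|y a]] [/= a0 _] //; first by rewrite eqxx in a0.
by rewrite big_ord1 /= => x0; rewrite x0 eqxx in a0.
Qed.

Fact variance_ratio (K : fieldType) (C n m t S g f : K) :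
  n != 0 -> m != 0 -> t != 0 -> S != 0 -> g != 0 ->
  (C / (n * t * g)) ^+ 2 * (2 * f) =
  2 * C ^+ 2 * S / g ^+ 2 * n^-1 * (1 + (m / n * (f / (m * t ^+ 2)) / S - 1)).
Proof. by move=> n0 m0 t0 S0 g0; field; rewrite n0 m0 t0 S0 g0. Qed.

Fact denominatorE (K : fieldType) (C e n t k w : K) : C != 0 ->
  n * e * t * - (k * w) = n * t * - (C * e * k * w) / C.
Proof. by move=> C0; field. Qed.

Fact estimator_split (K : fieldType) (C n t g F m h : K) :
  C != 0 -> n != 0 -> t != 0 -> g != 0 ->
  (F + m * (t * h)) / (n * t * g / C) = C / (n * t * g) * F + C * (m / n) * h / g.
Proof. by move=> C0 n0 t0 g0; field; rewrite ?C0 ?n0 ?t0 ?g0. Qed.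

Fact standardized_split (K : fieldType) (C n t g F m h sg : K) :
  C != 0 -> n != 0 -> t != 0 -> g != 0 -> sg != 0 ->
  (C / (n * t * g) * F + C * (m / n) * h / g - C) / (C / (n * t * g) * sg) =
  F / sg + (m * h - n * g) * (t / sg).
Proof. by move=> C0 n0 t0 g0 s0; field; rewrite ?C0 ?n0 ?t0 ?g0 ?s0. Qed.

Fact bias_split (K : fieldType) (sn sm l h g t sg : K) :
  sn != 0 -> sm != 0 -> t != 0 -> sg != 0 ->
  (sn * (h - g) - l * (sn^-1 * h)) * (sn / sm) * (sg / (sm * t))^-1 =
  ((sn ^+ 2 - l) * h - sn ^+ 2 * g) * (t / sg).
Proof. by move=> n0 m0 t0 s0; field; rewrite ?n0 ?m0 ?t0 ?s0. Qed.

Section Assembly.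
Context d (T : measurableType d) (R : realType) (P : probability T R).
Context (X : R -> {RV P >-> R}) (V r : R -> R) (alpha : R) (D : nat) (C s : R).
Context (a : seq R) (M : nat).
Hypotheses (gX : gaussian_process X) (cX : centered X) (VX : is_semivariogram X V).
Hypothesis alpha_gt0 : 0 < alpha.
Hypothesis V_derivable : times_derivable (2 * D)%N V.
Hypothesis C_gt0 : 0 < C.
Hypothesis s_gt0 : 0 < s.
Hypothesis s_lt2 : s < 2.
Hypothesis V_expansion : forall h : R,
  derive1n (2 * D)%N V h =
  derive1n (2 * D)%N V 0 + C * (-1) ^+ D * `|h| `^ s + r h.
Hypothesis r_o : r =o_ (0 : R) (fun h : R => `|h| `^ s).
Hypothesis r_o_bias : r =o_ (0 : R) (fun h : R => `|h| `^ (s + 1 / (2 * alpha))).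
Hypothesis a_trimmed : trimmed a.
Hypothesis a_sum0 : \sum_(j < size a) a`_j = 0.
Hypothesis aM : is_order a M.
Hypothesis DM : (D < M)%N.
Local Notation p := ((2 * D)%N%:R + s).
Hypothesis pM : p <= (2 * M)%N%:R.
Variable B : nat -> R.
Hypothesis B_ge0 : forall k, 0 <= B k.
Hypothesis cvg_B : cvgn (series (fun k => B k ^+ 2)).
Local Notation L := (size a).
Local Notation m n := (n.+1 - L)%N.
Local Notation rho := (corr V alpha D s a).
Local Notation g := (limit_corr D C s a).
Local Notation dl n := (mesh alpha n).
Hypothesis rho_le : \forall n \near \oo, forall k, (k < m n)%N -> `|rho n k| <= B k.
Local Notation E Z := (Rintegral P [set: T] Z).

Let L_gt1 : (1 < L)%N. Proof. exact: size_gt1. Qed.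
Let L_gt0 : (0 < L)%N. Proof. exact: ltnW. Qed.

Let Y n (i : 'I_(m n)) : T -> R := adiff X a alpha n i.+1.
Let tau n : R := dl n `^ p.
Let F n := csum_sqr P (@Y n).
Let frobK n := frob (cov_mx P (@Y n)).
Let sig n := Num.sqrt (2 * frobK n).

Let gaussG : gaussian_family P (lincomb X). Proof. exact: gaussian_family_lincomb. Qed.
Let GY n i : lincomb X (@Y n i). Proof. exact: lincomb_adiff. Qed.
Let tau_gt0 n : (0 < n)%N -> 0 < tau n.
Proof. by move=> n0; rewrite powR_gt0// mesh_gt0. Qed.
Let rho_cvg k : rho n k @[n --> \oo] --> g k.
Proof. exact: (cvg_corr alpha_gt0 V_derivable s_gt0 V_expansion aM DM L_gt0). Qed.

Let mean_adiff n i j : (0 < n)%N -> (j <= i)%N ->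
  E (fun w => adiff X a alpha n i w * adiff X a alpha n j w) = tau n * rho n (i - j)%N.
Proof.
move=> n0 ji; rewrite (mean_adiff_mul alpha gX VX a_sum0) /corr -/(tau n) -natrB//.
by rewrite mulrCA divff ?mulr1// gt_eqF// tau_gt0.
Qed.

Let covY : \forall n \near \oo, 0 < tau n /\
  forall i j, cov_mx P (@Y n) i j = tau n * rho n (i - j + (j - i))%N.
Proof.
near=> n; have n0 : (0 < n)%N by near: n; exact: nbhs_infty_gt.
split; first exact: tau_gt0.
have main (i j : 'I_(m n)) : (j <= i)%N ->
    cov_mx P (@Y n) i j = tau n * rho n (i - j + (j - i))%N.
  by move=> ji; rewrite mxE mean_adiff// subSS (_ : (j - i)%N = 0%N) ?addn0//; apply/eqP.
move=> i j; have [ji|ij] := leqP j i; first exact: main.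
by rewrite cov_mx_sym main 1?ltnW// addnC.
Unshelve. all: by end_near. Qed.

Let m_oo : m n @[n --> \oo] --> \oo.
Proof.
apply/cvgnyPge => N; near=> n.
have h : (N + L <= n)%N by near: n; exact: nbhs_infty_ge.
by rewrite leq_subRL; [rewrite addnC ltnW|rewrite ltnW// ltnS (leq_trans _ h)// leq_addl].
Unshelve. all: by end_near. Qed.

Let rho_max n k : (0 < n)%N -> `|rho n k| <= rho n 0%N.
Proof.
move=> n0.
have aD i : all_moments P (adiff X a alpha n i).
  exact/(gauss_all_moments gaussG)/lincomb_adiff.
have sq i : E (fun w => adiff X a alpha n i w ^+ 2) = tau n * rho n 0%N.
  have := mean_adiff n0 (leqnn i); rewrite subnn => <-.
  by apply: eq_Rintegral => w _; rewrite expr2.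
have := mean_CauchySchwarz (aD k) (aD 0%N); rewrite !sq => /(_ erefl).
rewrite mean_adiff// subn0 normrM gtr0_norm ?tau_gt0// ler_pM2l// tau_gt0//.
Qed.

(** The bound |g k| <= g 0 is the limit of the Cauchy-Schwarz bound on covariances, so one non-zero
    g(k) suffices. The sign of g(0) is thus obtained without evaluating it. *)
Let g_gt0 : 0 < g 0%N.
Proof.
have g_max k : `|g k| <= g 0%N.
  have h : `|rho n k| @[n --> \oo] --> `|g k| by apply: cvg_norm; exact: rho_cvg.
  apply: (ler_cvg_to h (@rho_cvg 0%N)); near=> n; apply: rho_max.
  by near: n; exact: nbhs_infty_gt.
have C0 : C != 0 by rewrite gt_eqF.
have [k gk] := limit_corr_neq0 alpha_gt0 s_gt0 aM DM L_gt0 C0 s_lt2 pM a_trimmed L_gt1.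
by apply: lt_le_trans (g_max k); rewrite normr_gt0.
Unshelve. all: by end_near. Qed.

Let S := corr_sum g.

Let S_gt0 : 0 < S.
Proof. exact: (corr_sum_gt0 rho_cvg rho_le cvg_B m_oo g_gt0). Qed.

Let cvg_frob : frobK n / ((m n)%:R * tau n ^+ 2) @[n --> \oo] --> S.
Proof. exact: (cvg_frob_cov_mx covY rho_cvg rho_le cvg_B m_oo g_gt0). Qed.

Let quadvarE n w : (0 < n)%N ->
  quadvar X a alpha n w = F n w + (m n)%:R * (tau n * rho n 0%N).
Proof.
move=> n0; rewrite /quadvar big_add1 /= big_mkord /F /csum_sqr -addrA; rewrite addrC.
have -> : \sum_i cov_mx P (@Y n) i i = (m n)%:R * (tau n * rho n 0%N).
  under eq_bigr do rewrite mxE mean_adiff// subnn.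
  by rewrite sumr_const card_ord mulr_natl.
by rewrite addNr add0r.
Qed.

(** By [Rfun_autoconv] the denominator is n tau g(0) / C, so the estimator is an affine function of
    the centered quadratic form F. *)
Let estimatorE n w : (0 < n)%N ->
  estimatorC X a alpha n D s w =
  C / (n%:R * tau n * g 0%N) * F n w + C * ((m n)%:R / n%:R) * rho n 0%N / g 0%N.
Proof.
move=> n0; rewrite /estimatorC quadvarE// Rfun_autoconv//.
have t0 : tau n != 0 by rewrite gt_eqF// tau_gt0.
have n1 : n%:R != 0 :> R by rewrite pnatr_eq0 -lt0n.
have C1 : C != 0 by rewrite gt_eqF.
have g0 : g 0%N != 0 by rewrite gt_eqF.
have -> : n%:R * (-1) ^+ D * dl n `^ p *
    - (kappa D s * sdiff a (fun y : R => `|y| `^ p) 0 1) = n%:R * tau n * g 0%N / C.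
  rewrite /limit_corr -/(tau n).
  exact: denominatorE.
exact: estimator_split.
Qed.

Let cvg_m : (m n)%:R / n%:R @[n --> \oo] --> (1 : R).
Proof.
have h : 1 - L.-1%:R * n%:R^-1 @[n --> \oo] --> (1 - L.-1%:R * 0 : R).
  by apply: cvgB; [exact: cvg_cst|apply: cvgM; [exact: cvg_cst|exact: cvg_inv_natr]].
rewrite -[X in _ --> X](_ : 1 - L.-1%:R * 0 = 1); last by rewrite mulr0 subr0.
apply: near_eq_cvgr h; near=> n.
have Ln : (L <= n)%N by near: n; exact: nbhs_infty_ge.
have n0 : n%:R != 0 :> R by rewrite pnatr_eq0 -lt0n (leq_trans _ Ln).
have -> : (m n)%:R = n%:R - L.-1%:R :> R.
  rewrite -natrB; last by rewrite (leq_trans (leq_pred _)).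
  by rewrite -{1}(prednK L_gt0) subSS.
by rewrite mulrBl divff.
Unshelve. all: by end_near. Qed.

Lemma variance_estimator n : (0 < n)%N ->
  ('V_P[estimatorC X a alpha n D s])%E =
  ((C / (n%:R * tau n * g 0%N)) ^+ 2 * (2 * frobK n))%:E.
Proof.
move=> n0; rewrite -(mean_csum_sqr_sqr gaussG (@GY n)).
apply: variance_affine (fun w => @estimatorE n w n0).
  exact: (all_moments_csum_sqr gaussG).
exact: (mean_csum_sqr gaussG).
Qed.

Lemma variance_estimator_equiv : exists c : R, 0 < c /\
  exists eps : nat -> R, eps @ \oo --> 0 /\
    \forall n \near \oo, ('V_P[estimatorC X a alpha n D s])%E =
      (c * n%:R^-1 * (1 + eps n))%:E.
Proof.
pose c := 2 * C ^+ 2 * S / g 0%N ^+ 2.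
pose eps n := (m n)%:R / n%:R * (frobK n / ((m n)%:R * tau n ^+ 2)) / S - 1.
exists c; split.
  by apply: divr_gt0; [apply: mulr_gt0 => //; apply: mulr_gt0 => //|]; exact: exprn_gt0.
exists eps; split.
  have S0 : S != 0 by rewrite gt_eqF.
  rewrite -[X in _ --> X](_ : 1 * S / S - 1 = 0); last by rewrite mul1r divff// subrr.
  apply: cvgB; last exact: cvg_cst.
  by apply: cvgM; [apply: cvgM|exact: cvg_cst].
near=> n; have n0 : (0 < n)%N by near: n; exact: nbhs_infty_gt.
have mn0 : (0 < m n)%N by near: n; exact: m_oo (nbhs_infty_gt 0).
rewrite variance_estimator//; congr (_%:E); rewrite /eps /c.
have n1 : n%:R != 0 :> R by rewrite pnatr_eq0 -lt0n.
have m1 : (m n)%:R != 0 :> R by rewrite pnatr_eq0 -lt0n.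
have t1 : tau n != 0 by rewrite gt_eqF// tau_gt0.
have S1 : S != 0 by rewrite gt_eqF.
have g1 : g 0%N != 0 by rewrite gt_eqF.
exact: variance_ratio.
Unshelve. all: by end_near. Qed.

(** The deterministic bias E[C_{a,n}] - C, divided by the standard deviation of the estimator. *)
Let b n := ((m n)%:R * rho n 0%N - n%:R * g 0%N) * (tau n / sig n).

Let sig_gt0 : \forall n \near \oo, 0 < sig n.
Proof.
have fpos : \forall n \near \oo, 0 < frobK n / ((m n)%:R * tau n ^+ 2).
  exact: (cvgr_gt S).
near=> n; have n0 : (0 < n)%N by near: n; exact: nbhs_infty_gt.
have m0 : (0 < m n)%N by near: n; exact: m_oo (nbhs_infty_gt 0).
rewrite sqrtr_gt0 mulr_gt0//.
have : 0 < frobK n / ((m n)%:R * tau n ^+ 2) by near: n.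
by rewrite pmulr_lgt0// invr_gt0 mulr_gt0 ?ltr0n// exprn_gt0// tau_gt0.
Unshelve. all: by end_near. Qed.

Let standardizedE : \forall n \near \oo, forall w,
  standardized_error X a alpha n D s C w = F n w / sig n + b n.
Proof.
near=> n => w; have n0 : (0 < n)%N by near: n; exact: nbhs_infty_gt.
have s0 : 0 < sig n by near: n.
have t0 := tau_gt0 n0.
have n1 : 0 < n%:R :> R by rewrite ltr0n.
have c0 : 0 < C / (n%:R * tau n * g 0%N) by rewrite divr_gt0// !mulr_gt0.
rewrite /standardized_error variance_estimator//= estimatorE//.
rewrite sqrtrM ?sqr_ge0// sqrtr_sqr (gtr0_norm c0) -/(sig n).
by apply: standardized_split; rewrite gt_eqF.
Unshelve. all: by end_near. Qed.

(** The exponent 1 / (2 alpha) in the bias hypothesis comes from here: delta_n^(1 / (2 alpha)) =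
    n^(-1/2). *)
Let cvg_bias : Num.sqrt n%:R * (rho n 0%N - g 0%N) @[n --> \oo] --> (0 : R).
Proof.
pose t : R := s + 1 / (2 * alpha).
have t0 : 0 <= t by rewrite addr_ge0 ?(ltW s_gt0)// divr_ge0// mulr_ge0// ltW.
have h := cvg_resid alpha_gt0 V_derivable s_gt0 V_expansion aM DM L_gt0 0 t0 r_o_bias.
rewrite -oppr0; apply: near_eq_cvgr (cvgN h); near=> n.
have n0 : (0 < n)%N by near: n; exact: nbhs_infty_gt.
have d0 := mesh_gt0 alpha n0.
rewrite (corrE V alpha C s aM DM)// addrAC subrr add0r mulrN; congr (- _).
rewrite [in RHS]mulrCA; congr (_ * _).
rewrite /t addrA powRD ?(gt_eqF d0) ?implybT// invfM mulrC; congr (_ * _).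
have a2 : alpha * (1 / (2 * alpha)) = 2^-1 by rewrite mul1r invfM mulrCA divff ?mulr1// gt_eqF.
by rewrite mesh_powR powRN invrK a2 powR12_sqrt.
Unshelve. all: by end_near. Qed.

Let cvg_b : b n @[n --> \oo] --> (0 : R).
Proof.
have h1 : (Num.sqrt (2 * (frobK n / ((m n)%:R * tau n ^+ 2))))^-1 @[n --> \oo] -->
    (Num.sqrt (2 * S))^-1.
  apply: cvgV; first by rewrite gt_eqF// sqrtr_gt0 mulr_gt0.
  apply: continuous_cvg; first exact: sqrt_continuous.
  by apply: cvgM => //; exact: cvg_cst.
have h2 : Num.sqrt (((m n)%:R / n%:R)^-1) @[n --> \oo] --> Num.sqrt (1^-1 : R).
  apply: continuous_cvg; first exact: sqrt_continuous.
  by apply: cvgV => //; exact: oner_neq0.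
have h3 : Num.sqrt (n%:R^-1) @[n --> \oo] --> Num.sqrt (0 : R).
  by apply: continuous_cvg; [exact: sqrt_continuous|exact: cvg_inv_natr].
(* Since n' = n - (L - 1), this is (n' rho(0) - n g(0)) / sqrt n: the bias of one term plus the
   effect of the L - 1 missing terms. *)
have h4 : Num.sqrt n%:R * (rho n 0%N - g 0%N) - L.-1%:R * (Num.sqrt n%:R^-1 * rho n 0%N)
    @[n --> \oo] --> (0 - L.-1%:R * (Num.sqrt 0 * g 0%N) : R).
  apply: cvgB; first exact: cvg_bias.
  by apply: cvgM; [exact: cvg_cst|apply: cvgM; [exact: h3|exact: rho_cvg]].
rewrite -[X in _ --> X](_ : (0 - L.-1%:R * (Num.sqrt 0 * g 0%N)) * Num.sqrt (1^-1 : R) *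
    (Num.sqrt (2 * S))^-1 = 0); last by rewrite sqrtr0 mul0r mulr0 subr0 !mul0r.
apply: near_eq_cvgr (cvgM (cvgM h4 h2) h1).
have m_gt0 : \forall n \near \oo, (0 < m n)%N by exact: m_oo (nbhs_infty_gt 0).
near=> n; have n0 : (0 < n)%N by near: n; exact: nbhs_infty_gt.
have m0 : (0 < m n)%N by near: n.
have s0 : 0 < sig n by near: n.
have sn0 : 0 < Num.sqrt n%:R :> R by rewrite sqrtr_gt0 ltr0n.
have sm0 : 0 < Num.sqrt (m n)%:R :> R by rewrite sqrtr_gt0 ltr0n.
rewrite /= sqrt_ratio ?frob_ge0//; last exact: tau_gt0.
rewrite -/(sig n) invf_div sqrtrM// !sqrtrV// bias_split ?gt_eqF// ?tau_gt0//.
rewrite sqr_sqrtr// /b; congr ((_ * _ - _) * _).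
have Ln : (L.-1 <= n)%N.
  have h : (L <= n)%N by rewrite -ltnS -subn_gt0.
  by rewrite (leq_trans _ h)// leq_pred.
by rewrite -natrB// -{2}(prednK L_gt0) subSS.
Unshelve. all: by end_near. Qed.

Lemma cvg_standardized_error :
  cvg_in_distribution
    (fun n => standardized_error X a alpha n D s C : {RV P >-> R}) (normal_prob 0 1).
Proof.
have aF n : all_moments P (F n) by exact: (all_moments_csum_sqr gaussG).
apply: (@cvg_in_distribution_normal _ _ _ P (fun n w => F n w / sig n) b) => //.
- move=> n; rewrite (_ : (fun w => F n w / sig n) = (fun w => (sig n)^-1 * F n w)).
    exact: all_momentsZ.
  by apply/funext => w; rewrite mulrC.
- rewrite (_ : (fun n => _) = (fun=> 0)); first exact: cvg_cst.
  apply/funext => n; under eq_Rintegral => w _ do rewrite expr1 mulrC.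
  by rewrite meanZ// (mean_csum_sqr gaussG) ?mulr0.
- move=> k; exact: (cvg_standardized_csum_sqr gaussG GY covY rho_cvg rho_le B_ge0 cvg_B m_oo g_gt0).
Qed.

End Assembly.

Theorem theorem3p7 (R : realType) (disp : measure_display)
    (T : measurableType disp) (P : probability T R)
    (X : R -> {RV P >-> R}) (V : R -> R)
    (alpha : R) (D : nat) (C s : R) (r : R -> R) (d : nat)
    (a : seq R) (M : nat)
    (X_gaussian : gaussian_process X)
    (X_centered : centered X)
    (X_stationary_increments : stationary_increments X)
    (V_semivariogram : is_semivariogram X V)
    (alpha_gt0 : 0 < alpha) (alpha_le1 : alpha <= 1)
    (V_smooth : smooth_on [set x | 0 < x] V)
    (V_derivable : times_derivable (2 * D)%N V)
    (C_gt0 : 0 < C) (s_gt0 : 0 < s) (s_lt2 : s < 2)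
    (V_expansion : forall h : R,
      derive1n (2 * D)%N V h =
        derive1n (2 * D)%N V 0 + C * (-1) ^+ D * `|h| `^ s + r h)
    (r_o : r =o_ (0 : R) (fun h : R => `|h| `^ s))
    (r_bound : alpha < 1 ->
      exists K : R, forall h : R, 1 < `|h| -> `|r h| <= K * `|h| `^ s)
    (d_def : d = if s < 3 / 2 then 2%N else 3%N)
    (dr_bound : exists beta K' : R,
      [/\ s - d%:R < beta, beta < - (1 / 2),
          alpha = 1 -> forall h : R, 0 < `|h| < 1 ->
            `|derive1n d r h| <= K' * `|h| `^ beta
        & alpha < 1 -> forall h : R, h != 0 ->
            `|derive1n d r h| <= K' * `|h| `^ beta])
    (r_o_bias : r =o_ (0 : R) (fun h : R => `|h| `^ (s + 1 / (2 * alpha))))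
    (a_trimmed : trimmed a)
    (a_sum0 : \sum_(j < size a) a`_j = 0)
    (a_order : is_order a M)
    (M_gt : D%:R + s / 2 + 1 / 4 < M%:R) :
  cvg_in_distribution
    (fun n => standardized_error X a alpha n D s C : {RV P >-> R})
    (normal_prob 0 1) /\
  exists c : R, 0 < c /\
    exists eps : nat -> R, eps @ \oo --> 0 /\
      \forall n \near \oo,
        ('V_P[estimatorC X a alpha n D s])%E =
          (c * n%:R^-1 * (1 + eps n))%:E.
Proof.
have L_gt1 := size_gt1 a_trimmed a_sum0.
have DM : (D < M)%N by rewrite -(ltr_nat R); lra.
have h2M : (2 * M)%N%:R = 2 * M%:R :> R by rewrite natrM.
have h2D : (2 * D)%N%:R = 2 * D%:R :> R by rewrite natrM.
(* Twice the hypothesis on the order of [a]: the correlations of the limit are square-summable. *)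
have pM1 : (2 * D)%N%:R + s - (2 * M)%N%:R < - (1 / 2) by rewrite h2M h2D; lra.
have pM : (2 * D)%N%:R + s <= (2 * M)%N%:R by lra.
(* D < M already gives 2M >= 2D + 2, enough for d = 2. For s >= 3/2 the hypothesis gives M > D + 1,
   hence 2M >= 2D + 4, which covers d = 3. *)
have [d0 dM] : (0 < d)%N /\ (2 * D + d <= 2 * M)%N.
  rewrite d_def; case: ifPn => [_|]; first by split => //; clear - DM; lia.
  rewrite -leNgt => s32; split => //.
  have : (D.+1 < M)%N by rewrite -(ltr_nat R) -natr1; lra.
  by clear; lia.
have [beta [K' [sb b0 r1 r2]]] := dr_bound.
have [c [e [c0 e0 dom]]] := corr_dominated alpha_gt0 V_smooth V_derivable s_gt0 V_expansion
  a_order DM (ltnW L_gt1) r_o alpha_le1 d0 dM pM1 sb b0 r1 r2.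
have B0 k : 0 <= c * k.+1%:R `^ e by rewrite mulr_ge0// powR_ge0.
(* Squaring doubles the exponent, and 2e < -1. *)
have cB : cvgn (series (fun k : nat => (c * k.+1%:R `^ e) ^+ 2)).
  rewrite (_ : (fun k => _) = c ^+ 2 *: (fun k : nat => k.+1%:R `^ (e + e))).
    by apply: is_cvg_seriesZ; apply: cvg_series_powR; lra.
  apply/funext => k /=.
  by rewrite exprMn expr2 [in LHS]expr2 -powRD// pnatr_eq0 implybT.
split.
  exact: (cvg_standardized_error X_gaussian X_centered V_semivariogram alpha_gt0
    V_derivable C_gt0 s_gt0 s_lt2 V_expansion r_o r_o_bias a_trimmed a_sum0
    a_order DM pM B0 cB dom).
exact: (variance_estimator_equiv X_gaussian X_centered V_semivariogram alpha_gt0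
    V_derivable C_gt0 s_gt0 s_lt2 V_expansion r_o a_trimmed a_sum0
    a_order DM pM cB dom).
Qed.
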